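(* For $d \in \mathbb{N}$, $d\ge 1$, let $m_0 = 1$ if $d = 1$ and $m_0 = \frac32$ if $d \geq 2$. There exist universal constants $\varepsilon_0, C, C_1 > 0$ with the following properties. If $(\alpha, \beta) \in H^{m_0 + \frac12}_0(\mathbb{T}^d,\mathbb{R}) \times H^{m_0 - \frac12}_0(\mathbb{T}^d,\mathbb{R})$ with $$\varepsilon := \| \alpha \|_{m_0 + \frac12} + \| \beta \|_{m_0 - \frac12} \leq \varepsilon_0,$$ then the Cauchy problem $$\partial_{tt} u - \Big( 1 + \int_{\mathbb{T}^d} |\nabla u|^2 \, dx \Big) \Delta u = 0, \quad u(0,x) = \alpha(x), \quad \partial_t u(0,x) = \beta(x)$$ has a unique solution $u \in C^0([0,T], H^{m_0 + \frac12}_0(\mathbb{T}^d,\mathbb{R})) \cap C^1([0,T], H^{m_0 - \frac12}_0(\mathbb{T}^d,\mathbb{R}))$ on the time interval $[0,T]$, where $T = C_1\varepsilon^{-4}$, and $$\max_{t \in [0,T]} \big( \| u(t) \|_{m_0 + \frac12} + \| \partial_t u(t) \|_{m_0 - \frac12} \big) \leq C \varepsilon.$$ If, in addition, $(\alpha,\beta) \in H^{s + \frac12}_0(\mathbb{T}^d,\mathbb{R}) \times H^{s - \frac12}_0(\mathbb{T}^d,\mathbb{R})$ for some $s \geq m_0$, then $u$ belongs to $C^0([0,T], H^{s + \frac12}_0(\mathbb{T}^d,\mathbb{R})) \cap C^1([0,T], H^{s - \frac12}_0(\mathbb{T}^d,\mathbb{R}))$, with $$\max_{t \in [0,T]} \big(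 \| u(t) \|_{s + \frac12} + \| \partial_t u(t) \|_{s - \frac12} \big) \leq C \big( \| \alpha \|_{s + \frac12} + \| \beta \|_{s - \frac12} \big),$$ with the same constant $C$ (in particular $C$ does not depend on $s$).
   Context: $\mathbb{T}^d = (\mathbb{R}/2\pi\mathbb{Z})^d$. Integrals over $\mathbb{T}^d$ are normalized so that $\int_{\mathbb{T}^d} w h\,dx = \sum_j w_j h_{-j}$ in terms of the Fourier coefficients of $w=\sum_j w_j e^{ij\cdot x}$, $h=\sum_j h_j e^{ij\cdot x}$. For real $s$, $H^s_0(\mathbb{T}^d,\mathbb{C})$ is the Sobolev space of zero-mean functions $u(x)=\sum_{j\in\mathbb{Z}^d\setminus\{0\}} u_j e^{ij\cdot x}$, $u_j\in\mathbb{C}$, with finite norm $\|u\|_s^2 := \sum_{j\in\mathbb{Z}^d\setminus\{0\}} |u_j|^2|j|^{2s}$, where $|j|$ is the Euclidean norm; $H^s_0(\mathbb{T}^d,\mathbb{R})$ is the subspace of real-valued functions. The equation is understood in the sense of distributions (equivalently, for each Fourier coefficient). *)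

(* Defs.v *)
From mathcomp Require Import all_boot all_order all_algebra.
From mathcomp Require Import complex.
From mathcomp Require Import all_classical all_reals all_analysis.

Set Implicit Arguments.
Unset Strict Implicit.
Unset Printing Implicit Defensive.

Import Order.TTheory GRing.Theory Num.Theory.
Import numFieldNormedType.Exports.

Local Open Scope classical_set_scope.
Local Open Scope ring_scope.

(* A function (or distribution) w on T^d is represented by its family of
   Fourier coefficients (w_j), j in Z^d.  Rcomplex R is R[i] seen as a real
   vector space, with `|z| : R the modulus. *)
Definition fourier (R : realType) (d : nat) : Type := 'rV[int]_d -> Rcomplex R.

Definition euclid_norm (R : realType) (d : nat) (j : 'rV[int]_d) : R :=
  Num.sqrt (\sum_(k < d) ((j ord0 k)%:~R ^+ 2)).

Definition sobolev_sq (R : realType) (d : nat) (s : R) (w : fourier R d) : \bar R :=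
  \esum_(j in [set j : 'rV[int]_d | j != 0])
    (`|w j| ^+ 2 * euclid_norm R j `^ (2 * s))%:E.

(* Meaningful only when sobolev_sq s w is finite: fine +oo = 0. *)
Definition sobolev_norm (R : realType) (d : nat) (s : R) (w : fourier R d) : R :=
  Num.sqrt (fine (sobolev_sq s w)).

(* H^s_0(T^d, C) *)
Definition H0C (R : realType) (d : nat) (s : R) : set (fourier R d) :=
  [set w | w 0 = 0 /\ (sobolev_sq s w < +oo)%E].

(* w is real-valued iff w_{-j} is the conjugate of w_j for every j. *)
Definition real_valued (R : realType) (d : nat) (w : fourier R d) : Prop :=
  forall j : 'rV[int]_d, w (- j) = conjc (w j).

(* H^s_0(T^d, R) *)
Definition H0 (R : realType) (d : nat) (s : R) : set (fourier R d) :=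
  [set w | H0C s w /\ real_valued w].

(* Partial derivative in the k-th variable: (d_k w)_j = i j_k w_j. *)
Definition partial (R : realType) (d : nat) (k : 'I_d) (w : fourier R d) :
    fourier R d :=
  fun j => (Complex 0 ((j ord0 k)%:~R : R) : Rcomplex R) * w j.

Definition laplacian (R : realType) (d : nat) (w : fourier R d) : fourier R d :=
  fun j => \sum_(k < d) partial k (partial k w) j.

(* int |w|^2 dx = sum_j |w_j|^2, by the normalization
   int w h dx = sum_j w_j h_{-j} with h the complex conjugate of w, for which
   h_{-j} is the conjugate of w_j. *)
Definition int_sq (R : realType) (d : nat) (w : fourier R d) : \bar R :=
  \esum_(j in [set: 'rV[int]_d]) (`|w j| ^+ 2)%:E.

(* int |grad w|^2 dx; finite for w in H^1, in particular for w in
   H^{m0 + 1/2}_0. *)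
Definition int_grad_sq (R : realType) (d : nat) (w : fourier R d) : R :=
  fine (\sum_(k < d) int_sq (partial k w))%E.

(* l is the derivative at t of f : I -> V with respect to the norm N; it is
   one-sided at the endpoints of an interval I. *)
Definition has_deriv_within (R : realType) (V : lmodType R) (N : V -> R)
    (I : set R) (f : R -> V) (t : R) (l : V) : Prop :=
  N ((t' - t)^-1 *: (f t' - f t) - l) @[t' --> within I t^'] --> (0 : R).

(* u belongs to C^0(I, H^s_0(T^d, R)) *)
Definition C0_H0 (R : realType) (d : nat) (I : set R) (s : R)
    (u : R -> fourier R d) : Prop :=
  (forall t, I t -> H0 s (u t)) /\
  (forall t, I t ->
    sobolev_norm s (u t' - u t) @[t' --> within I (nbhs t)] --> (0 : R)).

(* u belongs to C^1(I, H^s_0(T^d, R)), with time derivative v *)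
Definition C1_H0 (R : realType) (d : nat) (I : set R) (s : R)
    (u v : R -> fourier R d) : Prop :=
  [/\ C0_H0 I s u, C0_H0 I s v &
      forall t, I t -> has_deriv_within (@sobolev_norm R d s) I u t (v t)].

(* u is in C^0(I, H^{m+1/2}_0) and C^1(I, H^{m-1/2}_0), with u_t = v. *)
Definition evolution_class (R : realType) (d : nat) (I : set R) (m : R)
    (u v : R -> fourier R d) : Prop :=
  C0_H0 I (m + 2^-1) u /\ C1_H0 I (m - 2^-1) u v.

(* u, with u_t = v, solves the Cauchy problem for the Kirchhoff equation on
   the time interval I.  The equation holds for each Fourier coefficient. *)
Definition kirchhoff_solution (R : realType) (d : nat) (I : set R) (m : R)
    (alpha beta : fourier R d) (u v : R -> fourier R d) : Prop :=
  [/\ evolution_class I m u v,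
      u 0 = alpha, v 0 = beta &
      forall (j : 'rV[int]_d) (t : R), I t ->
        exists2 utt : Rcomplex R,
          has_deriv_within (fun z : Rcomplex R => `|z|) I (fun t' => v t' j) t utt
          & utt - (1 + int_grad_sq (u t)) *: laplacian (u t) j = 0].

Definition m0 (R : realType) (d : nat) : R := if d == 1%N then 1 else 3 / 2.

(* T = C1 eps^-4, with T = +oo when eps = 0 (zero initial data). *)
Definition lifespan (R : realType) (C1 eps : R) : \bar R :=
  if eps == 0 then +oo%E else (C1 * eps ^- 4)%:E.

(* The interval [0, T], which is [0, +oo) when T = +oo. *)
Definition time_interval (R : realType) (T : \bar R) : set R :=
  [set t | 0 <= t /\ (t%:E <= T)%E].

(* Main.v *)
Require Import Defs.
From mathcomp Require Import all_boot all_order all_algebra.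
From mathcomp Require Import complex.
From mathcomp Require Import all_classical all_reals all_analysis.
From mathcomp Require Import ring lra.

Set Implicit Arguments.
Unset Strict Implicit.
Unset Printing Implicit Defensive.

Import Order.TTheory GRing.Theory Num.Theory.
Import numFieldNormedType.Exports.

Local Open Scope classical_set_scope.
Local Open Scope ring_scope.

(* Proof idea.  Split the Fourier coefficients into real modes x_i of frequency
   o_i = |j|.  They solve x_i'' = - o_i^2 a(t) x_i, with the common coefficient
   a = 1 + int |grad u|^2 = 1 + sum_i o_i^2 x_i^2.  With l = a^(1/2), put
     e_i = l o_i x_i^2 + x_i'^2 / (l o_i),  B_i = l o_i x_i^2 - x_i'^2 / (l o_i),
     G_i = 2 x_i x_i',                      h = a' / (2 a),
   so that e_i' = h B_i, B_i' = 2 l o_i G_i + h e_i, G_i' = - 2 o_i l B_i and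
   a' = sum_k o_k^2 G_k.  The derivative of E = sum_j rho_j e_j (rho_j a function of
   o_j) is thus quartic, a combination of the products G_k B_j.  If o_k <> o_j, then
   G_k B_j is up to sextic terms the derivative of
     (o_k B_k B_j + o_j G_k G_j) / (2 l (o_k^2 - o_j^2)),
   and the products with o_k = o_j add up to a derivative by symmetry.
   Subtracting these quartic terms from E leaves an energy whose derivative is
   O(W^2 E), where W = sum_k o_k^(2 m0) e_k: o_k^2 - o_j^2 is a nonzero integer,
   and in dimension one a product of nonzero integers, which is what the value of
   m0 accounts for.  A continuity argument then keeps W of size eps^2 up to times
   of order eps^-4.

   These estimates are made on Galerkin truncations.  The difference of a truncation
   and any solution is estimated in H^(1/2) x H^(-1/2), one derivative below the
   regularity of the solutions; this gives both the convergence of the truncations and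
   uniqueness.  Since e_i' = h B_i with |B_i| <= e_i, every mode is dominated by its
   initial value, so the continuity in time of u in H^(s+1/2) and u_t in H^(s-1/2)
   follows from that of each mode by dominated convergence. *)

(** * Calculus on an interval *)

(** Without the correction, |h| <= W / 2 and |B_i| <= e_i give only |E'| <= W E / 2, that is, a
    lifespan of order eps^-2; removing the quartic part replaces W by W^2. In each product the small
    divisor is charged entirely to the mode k, the one that comes from a', through the weight o_k^(2
    m0), whereas rho_j enters linearly and may be any nonnegative function of o_j. This is why a
    single C serves every s: rho_j = o_j^(2 s) is just one more choice. Truncation is forced because
    o_i^2 a x_i is not Lipschitz in x when the frequencies are unbounded. The difference of two
    solutions with coefficients a_1, a_2 has the source (a_1 - a_2) o_i^2 x_i, which costs one
    derivative, so the difference is not controlled at the level of the solutions themselves. One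
    derivative below, the estimate needs only that the sum of o_i^3 x_i^2 be finite, and m0 >= 1
    ensures this. *)

Section OneVariableCalculus.
Variable R : realType.
Implicit Types (T c t : R) (f g h : R -> R).

(** Derivatives are asked in the open interval only: a solution of the Cauchy problem has one-sided
    derivatives at the endpoints, and the mean value theorem needs no more. *)
Definition C1in T f g : Prop :=
  {within `[0, T], continuous f} /\
  (forall t, 0 < t < T -> is_derive t (1 : R) f (g t)).

Lemma eq_C1in T f f' g g' : f =1 f' -> {in `]0, T[, g =1 g'} ->
  C1in T f g -> C1in T f' g'.
Proof.
move=> /funext <- gg' [cf df]; split => // t tT.
by rewrite -gg' ?in_itv//; exact: df.
Qed.

Lemma is_derive_C1in T f g :
  (forall t, 0 <= t <= T -> is_derive t (1 : R) f (g t)) -> C1in T f g.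
Proof.
move=> df; split; last by move=> t /andP[/ltW t0 /ltW tT]; apply: df; rewrite t0.
apply: derivable_within_continuous => t; rewrite in_itv/= => tT.
by have [] := df _ tT.
Qed.

Lemma C1in_cst T c : C1in T (fun=> c) (fun=> 0).
Proof. by apply: is_derive_C1in => t _; exact: is_derive_cst. Qed.

Lemma C1inD T f f' g g' : C1in T f f' -> C1in T g g' ->
  C1in T (fun t => f t + g t) (fun t => f' t + g' t).
Proof.
move=> [cf df] [cg dg]; split.
  by move=> t; apply: cvgD; [exact: cf|exact: cg].
by move=> t tT; apply: is_deriveD; [exact: df|exact: dg].
Qed.

Lemma C1inM T f f' g g' : C1in T f f' -> C1in T g g' ->
  C1in T (fun t => f t * g t) (fun t => f' t * g t + f t * g' t).
Proof.
move=> [cf df] [cg dg]; split.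
  by move=> t; apply: cvgM; [exact: cf|exact: cg].
move=> t tT; have ? := df _ tT; have ? := dg _ tT.
apply: is_derive_eq; rewrite /GRing.scale/=; ring.
Qed.

Lemma C1inZ T c f f' : C1in T f f' -> C1in T (fun t => c * f t) (fun t => c * f' t).
Proof.
move=> Cf; apply: eq_C1in (C1inM (C1in_cst T c) Cf) => // t _.
by rewrite mul0r add0r.
Qed.

Lemma C1inB T f f' g g' : C1in T f f' -> C1in T g g' ->
  C1in T (fun t => f t - g t) (fun t => f' t - g' t).
Proof.
move=> Cf /(C1inZ (-1)) Cg; apply: eq_C1in (C1inD Cf Cg) => [t|t _];
  by rewrite mulN1r.
Qed.

Lemma C1in_sum T (I : Type) (s : seq I) (F G : I -> R -> R) :
  (forall i, C1in T (F i) (G i)) ->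
  C1in T (fun t => \sum_(i <- s) F i t) (fun t => \sum_(i <- s) G i t).
Proof.
move=> FG; elim: s => [|i s ih].
  by apply: eq_C1in (C1in_cst T 0) => [t|t _]; rewrite big_nil.
by apply: eq_C1in (C1inD (FG i) ih) => [t|t _]; rewrite big_cons.
Qed.

Lemma C1in_expR T c : C1in T (fun t => expR (c * t)) (fun t => c * expR (c * t)).
Proof.
apply: is_derive_C1in => t _; apply: is_derive_eq.
by rewrite /GRing.scale/=; ring.
Qed.

Lemma C1in_le T f f' g g' : C1in T f f' -> C1in T g g' -> f 0 <= g 0 ->
  (forall t, 0 < t < T -> f' t <= g' t) -> forall t, 0 <= t <= T -> f t <= g t.
Proof.
move=> Cf Cg fg0 fg' t /andP[t0 tT].
have [ch dh] := C1inB Cg Cf.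
suff : g 0 - f 0 <= g t - f t by lra.
apply: (@ger0_derive1_le_cc R (fun x => g x - f x) 0 T) => //.
- by move=> x; rewrite in_itv/= => /dh[].
- move=> x; rewrite in_itv/= => xT; rewrite derive1E.
  by rewrite (@derive_val _ _ _ _ _ _ _ (dh _ xT)) subr_ge0 fg'.
- by rewrite in_itv/= lexx (le_trans t0 tT).
- by rewrite in_itv/= t0.
Qed.

Lemma gronwall T c f f' : C1in T f f' ->
  (forall t, 0 < t < T -> f' t <= c * f t) ->
  forall t, 0 <= t <= T -> f t <= expR (c * t) * f 0.
Proof.
move=> Cf f'le t tT.
have := C1in_le (C1inM (C1in_expR T (- c)) Cf) (C1in_cst T (f 0)).
move=> /(_ _ _ t tT); rewrite mulr0 expR0 mul1r lexx => /(_ isT) H.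
have {H} : expR (- c * t) * f t <= f 0.
  apply: H => s sT; have := f'le s sT; have := expR_gt0 (- c * s).
  by nra.
rewrite mulNr expRN => H.
by rewrite -ler_pdivrMl// expR_gt0.
Qed.

Lemma C1in_MVT T f g (s t : R) : C1in T f g -> 0 <= s -> s < t -> t <= T ->
  exists2 c, s < c < t & f t - f s = g c * (t - s).
Proof.
move=> [cf df] s0 st tT.
have [| |c] := @MVT R f g s t st.
- move=> x; rewrite in_itv/= => /andP[sx xt]; apply: df.
  by rewrite (le_lt_trans s0 sx) (lt_le_trans xt tT).
- apply: continuous_subspaceW cf => x /=; rewrite !in_itv/= => /andP[sx xt].
  by rewrite (le_trans s0 sx) (le_trans xt tT).
- by rewrite in_itv/= => ? ?; exists c.
Qed.

End OneVariableCalculus.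

(** * Ordinary differential equations with a bounded Lipschitz field *)

Section Sequences.
Variable R : realType.

(** The limit is the supremum of the lower bounds [u n - r n]; taken this way, it keeps the rates
    [r n] with the same constants. *)
Lemma cauchy_rate (u r : nat -> R) :
  (forall n m, (n <= m)%N -> `|u m - u n| <= r n) ->
  exists l : R, forall n, `|u n - l| <= r n.
Proof.
move=> ur.
have r0 n : 0 <= r n by have := ur n n (leqnn n); rewrite subrr normr0.
pose E := range (fun n => u n - r n).
have Eub m : ubound E (u m + r m).
  move=> _ [n _ <-]; have [nm|/ltnW mn] := leqP n m.
    by have := ur _ _ nm; rewrite ler_norml => /andP[]; have := r0 m; lra.
  by have := ur _ _ mn; rewrite ler_norml => /andP[]; have := r0 n; lra.
exists (sup E) => n.
have : sup E <= u n + r n by apply: ge_sup; [by exists (u 0%N - r 0%N), 0%N|].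
have : u n - r n <= sup E.
  by apply: ub_le_sup; [exists (u 0%N + r 0%N)|exists n].
by rewrite ler_norml; lra.
Qed.

(** Lets the number of iterations go to infinity, in Picard's scheme and in the stability
    estimate. *)
Lemma geometric_squeeze (x C q : R) : `|q| < 1 ->
  (forall n, x <= C * q ^+ n) -> x <= 0.
Proof.
move=> q1 H; have := cvg_geometric C q1 => cg.
have -> : 0 = lim (geometric C q @ \oo) by rewrite (cvg_lim _ cg).
apply: limr_ge; first by apply/cvg_ex; exists 0.
by near=> n; exact: H.
Unshelve. all: by end_near. Qed.

End Sequences.

Section Primitive.
Variable R : realType.

(** Integrating from -1 makes 0 an interior point, so the derivative at the initial time is
    two-sided. *)
Lemma continuous_primitive (f : R -> R) : continuous f ->
  exists2 g : R -> R, g 0 = 0 & forall t : R, -1 < t -> is_derive t (1 : R) g (f t).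
Proof.
move=> cf.
pose F t := (\int[@lebesgue_measure R]_(s in `[(-1)%R, t]) f s)%R.
exists (fun t => F t - F 0); first by rewrite subrr.
move=> t t1.
have intf : (@lebesgue_measure R).-integrable `[-1, t + 1] (EFin \o f).
  apply: continuous_compact_integrable; first exact: segment_compact.
  exact: continuous_subspaceT.
have [|dF F't] := @continuous_FTC1_closed R f (-1) t (t + 1) _ intf t1 (cf t).
  by rewrite ltrDl.
have dFt : is_derive t (1 : R) F (f t) by split; [exact: dF|rewrite -derive1E].
rewrite -[f t]subr0.
by have := is_deriveB dFt (is_derive_cst (F 0) t (1 : R)).
Qed.

End Primitive.

Section Picard.
Variables (R : realType) (J : Type) (F : (J -> R) -> J -> R) (L B : R) (y0 : J -> R).
Implicit Types (t s e m : R).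
Hypothesis L0 : 0 < L.
Hypothesis lipF : forall p q m, (forall j, `|p j - q j| <= m) ->
  forall i, `|F p i - F q i| <= L * m.
Hypothesis bndF : forall p i, `|F p i| <= B.
Hypothesis contF : forall p : R -> J -> R,
  (forall j, continuous (fun t => p t j)) -> forall i, continuous (fun t => F (p t) i).

(** Freezing the iterates at negative times makes the integrands continuous on the whole line, as
    [continuous_primitive] requires. *)
Let pos (t : R) : R := Num.max 0 t.

Let pos_ge0 t : 0 <= pos t. Proof. by rewrite /pos le_max lexx. Qed.

Let pos_id t : 0 <= t -> pos t = t.
Proof. by move=> t0; rewrite /pos; apply/max_idPr. Qed.

Let continuous_pos : continuous pos.
Proof.
by move=> t; apply: continuous_max; [exact: cvg_cst|exact: cvg_id].
Qed.

(** A total choice of primitive, so that the iterates can be defined before their continuity is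
    proved; the value 0 on discontinuous [f] is a dummy. *)
Let prim (f : R -> R) : R -> R :=
  if pselect (continuous f) is left cf then
    sval (cid2 (continuous_primitive cf)) else fun=> 0.

Let prim0 f : continuous f -> prim f 0 = 0.
Proof.
by move=> cf; rewrite /prim; case: pselect => // {}cf; case: cid2.
Qed.

Let is_derive_prim f (t : R) : continuous f -> -1 < t -> is_derive t (1 : R) (prim f) (f t).
Proof.
by move=> cf; rewrite /prim; case: pselect => // {}cf; case: cid2 => //= g _; apply.
Qed.

Let C1in_prim f T : continuous f -> C1in T (prim f) f.
Proof.
move=> cf; apply: is_derive_C1in => t /andP[t0 _].
by apply: is_derive_prim => //; apply: lt_le_trans t0; rewrite ltrN10.
Qed.

(** Measured against the weight [expR (c * t)], integration gains a factor [1 / c] uniformly on the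
    half-line, so Picard's iteration converges globally without gluing short intervals. *)
Let prim_dist f g (m c : R) : continuous f -> continuous g -> 0 <= m -> 0 < c ->
  (forall s : R, 0 <= s -> `|f s - g s| <= m * expR (c * s)) ->
  forall t : R, 0 <= t -> `|prim f t - prim g t| <= m / c * expR (c * t).
Proof.
move=> cf cg m0 c0 fg t t0.
have CE := C1inZ (m / c) (C1in_expR t c).
have C := C1inB (C1in_prim t cf) (C1in_prim t cg).
have C' := C1inB (C1in_prim t cg) (C1in_prim t cf).
have tt : 0 <= t <= t by rewrite t0 lexx.
have E0 : 0 <= m / c * expR (c * 0).
  by rewrite mulr0 expR0 mulr1 divr_ge0// ltW.
have Es s : m / c * (c * expR (c * s)) = m * expR (c * s).
  by field; exact: lt0r_neq0.
rewrite ler_norml; apply/andP; split; last first.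
  apply: (C1in_le C CE) => //; rewrite ?prim0 ?subr0// => s /andP[s0 _].
  by rewrite Es; apply: le_trans (fg _ (ltW s0)); exact: ler_norm.
rewrite lerNl opprB.
apply: (C1in_le C' CE) => //; rewrite ?prim0 ?subr0// => s /andP[s0 _].
by rewrite Es; apply: le_trans (fg _ (ltW s0)); rewrite distrC; exact: ler_norm.
Qed.

Let Y := fix Y (n : nat) : R -> J -> R :=
  if n is n'.+1 then fun t i => y0 i + prim (fun s => F (Y n' (pos s)) i) t
  else fun=> y0.

Let continuous_Y n : forall i, continuous (fun s => Y n (pos s) i).
Proof.
elim: n => [|n ih] i s; first exact: cvg_cst.
apply: (@continuous_comp _ _ _ pos (fun t => Y n.+1 t i)); first exact: continuous_pos.
apply: cvgD; first exact: cvg_cst.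
apply/differentiable_continuous/derivable1_diffP.
have cF : continuous (fun s => F (Y n (pos s)) i) by exact: contF.
have ps : -1 < pos s by apply: lt_le_trans (pos_ge0 s); rewrite ltrN10.
by have [] := is_derive_prim cF ps.
Qed.

Let continuous_FY n i : continuous (fun s => F (Y n (pos s)) i).
Proof. by apply: contF; exact: continuous_Y. Qed.

(** With this rate each Picard step contracts by [L / c = 1 / 2]; [K] bounds the first step, since
    the field is at most [B]. *)
Let c := 2 * L.
Let K := B / c.

Let c_gt0 : 0 < c. Proof. by rewrite mulr_gt0. Qed.

Let K_ge0 (i : J) : 0 <= K.
Proof.
by rewrite divr_ge0 ?(ltW c_gt0)//; apply: le_trans (bndF y0 i); exact: normr_ge0.
Qed.

Let pow_ge0 n : 0 <= K -> 0 <= 2 * K * 2^-1 ^+ n.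
Proof. by move: K => k k0; rewrite !mulr_ge0 ?exprn_ge0 ?invr_ge0. Qed.

Let stepY n t i : 0 <= t ->
  `|Y n.+1 t i - Y n t i| <= K * 2^-1 ^+ n * expR (c * t).
Proof.
have B0 : 0 <= B by apply: le_trans (bndF y0 i); exact: normr_ge0.
elim: n t i => [|n ih] t i t0.
  have c0 : continuous (fun _ : R => 0 : R) by move=> s; exact: cvg_cst.
  have tt : 0 <= t <= t by rewrite t0 lexx.
  have E : prim (fun=> 0) t = 0.
    apply/eqP; rewrite eq_le; apply/andP; split.
      by apply: (C1in_le (C1in_prim t c0) (C1in_cst t 0)); rewrite ?prim0.
    by apply: (C1in_le (C1in_cst t 0) (C1in_prim t c0)); rewrite ?prim0.
  rewrite expr0 mulr1 /= addrC addKr -[X in `|X|]subr0 -E.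
  apply: prim_dist => // [|s s0]; first exact: (@continuous_FY 0%N i).
  rewrite subr0; apply: le_trans (bndF _ _) _; rewrite ler_peMr//.
  by rewrite -expR0 ler_expR mulr_ge0// ltW.
have -> : K * 2^-1 ^+ n.+1 = L * (K * 2^-1 ^+ n) / c.
  by rewrite exprS /c; field; rewrite lt0r_neq0.
rewrite /= opprD addrACA subrr add0r.
apply: (prim_dist (@continuous_FY n.+1 i) (@continuous_FY n i)) => //.
  by rewrite !mulr_ge0 ?invr_ge0 ?exprn_ge0// ltW.
move=> s s0; rewrite -mulrA; apply: lipF => j.
by rewrite pos_id//; exact: ih.
Qed.

Let rate n t := 2 * K * 2^-1 ^+ n * expR (c * t).

Let cauchyY (n m : nat) t i : 0 <= t -> (n <= m)%N -> `|Y m t i - Y n t i| <= rate n t.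
Proof.
move=> t0 nm.
have K0 := K_ge0 i.
apply: (@le_trans _ _ (rate n t - rate m t)); last first.
  by rewrite gerBl; apply: mulr_ge0 (expR_ge0 _); exact: pow_ge0.
elim: m nm => [|m ih]; first by rewrite leqn0 => /eqP ->; rewrite !subrr normr0.
rewrite leq_eqVlt => /predU1P[->|]; first by rewrite !subrr normr0.
rewrite ltnS => /ih {}ih.
have := stepY m i t0.
have -> : K * 2^-1 ^+ m * expR (c * t) = rate m t - rate m.+1 t.
  by rewrite /rate exprS; field.
have := ler_normD (Y m.+1 t i - Y m t i) (Y m t i - Y n t i).
rewrite addrA subrK; lra.
Qed.

Let limY t i : exists l, forall n, `|Y n (pos t) i - l| <= rate n (pos t).
Proof. by apply: cauchy_rate => n m; exact: cauchyY. Qed.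

Let Z t i := sval (cid (limY t i)).

Let ZP t i n : `|Y n (pos t) i - Z t i| <= rate n (pos t).
Proof. by rewrite /Z; case: cid. Qed.

Let rate_small t e : 0 < e -> exists n, rate n t < e.
Proof.
move=> e0; apply: contrapT => /forallNP H.
suff : e <= 0 by rewrite leNgt e0.
apply: (@geometric_squeeze _ _ (2 * K * expR (c * t)) 2^-1).
  by rewrite ger0_norm ?invr_ge0// invf_lt1// ltr1n.
by move=> n; have := H n; rewrite /rate mulrAC => /negP; rewrite -leNgt.
Qed.

Let continuous_Z i : continuous (fun t => Z t i).
Proof.
move=> t; apply/cvgrPdist_le => /= e e0.
have [n] := rate_small (pos t + 1) (divr_gt0 e0 (ltr0n _ 3 : 0 < 3)).
move=> Hn.
have K0 := K_ge0 i.
have rt s : pos s <= pos t + 1 -> rate n (pos s) <= e / 3.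
  move=> st; apply: le_trans (ltW Hn); apply: ler_wpM2l; first exact: pow_ge0.
  by rewrite ler_expR ler_wpM2l// ltW.
have e3 : 0 < e / 3 by rewrite divr_gt0.
have /cvgrPdist_le /(_ _ e3) := @continuous_Y n i t.
have /cvgrPdist_lt /(_ _ ltr01) := @continuous_pos t.
apply: filterS2 => s st Yst.
have ps : pos s <= pos t + 1 by move: st; rewrite ltr_norml; lra.
have pt : pos t <= pos t + 1 by rewrite lerDl.
have := le_trans (ZP s i n) (rt _ ps); have := le_trans (ZP t i n) (rt _ pt).
move: Yst; rewrite !ler_norml; lra.
Qed.

Let continuous_FZ i : continuous (fun s => F (Z s) i).
Proof. by apply: contF; exact: continuous_Z. Qed.

(** The limit [Z] is constant at negative times, hence possibly not differentiable at 0. Its Picard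
    image coincides with it for [0 <= t] and is a primitive on both sides of 0. *)
Let y t i := y0 i + prim (fun s => F (Z s) i) t.

Let yZ t : 0 <= t -> y t = Z t.
Proof.
move=> t0; apply/funext => i; apply/eqP; rewrite -subr_eq0 -normr_le0.
have K0 := K_ge0 i.
apply: (@geometric_squeeze _ _ (2 * K * expR (c * t)) 2^-1).
  by rewrite ger0_norm ?invr_ge0// invf_lt1// ltr1n.
move=> n.
have := ZP t i n.+1; rewrite pos_id// => H1.
have H2 : `|Y n.+1 t i - y t i| <= (2 * K * 2^-1 ^+ n * L) / c * expR (c * t).
  rewrite /= /y opprD addrACA subrr add0r.
  apply: (prim_dist (@continuous_FY n i) (@continuous_FZ i)) => //.
    by apply: mulr_ge0 (ltW L0); exact: pow_ge0.
  move=> s s0; rewrite [leRHS](_ : _ = L * rate n s); last by rewrite /rate; ring.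
  by apply: lipF => j; have := ZP s j n; rewrite pos_id.
rewrite distrC.
have -> : Z t i - y t i = (Y n.+1 t i - y t i) - (Y n.+1 t i - Z t i) by ring.
apply: le_trans (ler_normB _ _) _.
apply: le_trans (lerD H2 H1) _.
rewrite le_eqVlt; apply/orP; left; apply/eqP.
by rewrite /rate /c exprS; field; rewrite lt0r_neq0.
Qed.

Theorem picard : exists2 y : R -> J -> R, y 0 = y0 &
  forall (t : R) i, 0 <= t -> is_derive t (1 : R) (fun s => y s i) (F (y t) i).
Proof.
exists y; first by apply/funext => i; rewrite /y prim0 ?addr0.
move=> t i t0; rewrite yZ// -[F _ i]add0r.
have t1 : -1 < t by apply: lt_le_trans t0; rewrite ltrN10.
have := is_derive_prim (@continuous_FZ i) t1.
by have := is_derive_cst (y0 i) t (1 : R) => /is_deriveD /[apply].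
Qed.

End Picard.

(** * The quartic normal form of the energy *)

Section FiniteSums.
Variable R : realType.

Lemma is_derive_bigsum (I : Type) (s : seq I) (F : I -> R -> R) (G : I -> R) (t : R) :
  (forall i, is_derive t (1 : R) (F i) (G i)) ->
  is_derive t (1 : R) (fun x => \sum_(i <- s) F i x) (\sum_(i <- s) G i).
Proof.
move=> FG; elim: s => [|i s ih].
  under eq_fun do rewrite big_nil.
  by rewrite big_nil; exact: is_derive_cst.
under eq_fun do rewrite big_cons.
by rewrite big_cons; have := is_deriveD (FG i) ih.
Qed.

Lemma cauchy_schwarz (I : Type) (s : seq I) (f g : I -> R) :
  (\sum_(i <- s) f i * g i) ^+ 2 <=
  (\sum_(i <- s) f i ^+ 2) * (\sum_(i <- s) g i ^+ 2).
Proof.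
elim: s => [|i s ih]; first by rewrite !big_nil expr2 mul0r.
rewrite !big_cons.
set A := \sum_(_ <- s) _ in ih *; set P := \sum_(_ <- s) _ ^+ 2 in ih *.
set Q := \sum_(_ <- s) g _ ^+ 2 in ih *; set a := f i; set b := g i.
have P0 : 0 <= P by apply: sumr_ge0 => ? _; exact: sqr_ge0.
have Q0 : 0 <= Q by apply: sumr_ge0 => ? _; exact: sqr_ge0.
have a0 := sqr_ge0 a; have b0 := sqr_ge0 b.
(* The cross term of the expanded square; its square is compared using the induction hypothesis
   [A ^+ 2 <= P * Q] and the arithmetic-geometric mean inequality. *)
suff : 2 * (A * (a * b)) <= P * b ^+ 2 + Q * a ^+ 2 by nra.
set u := A * (a * b); set v := P * b ^+ 2 + Q * a ^+ 2.
have v0 : 0 <= v by apply: addr_ge0; exact: mulr_ge0.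
have uv : (2 * u) ^+ 2 <= v ^+ 2.
  have := ler_wpM2r (mulr_ge0 a0 b0) ih.
  have := sqr_ge0 (P * b ^+ 2 - Q * a ^+ 2).
  by rewrite /u /v; nra.
by rewrite leNgt; apply/negP => vu; nra.
Qed.

Lemma big_norm_le (I : Type) (s : seq I) (f g : I -> R) :
  (forall i, `|f i| <= g i) -> `|\sum_(i <- s) f i| <= \sum_(i <- s) g i.
Proof.
by move=> fg; apply: le_trans (ler_norm_sum _ _ _) _; apply: ler_sum => i _.
Qed.

Lemma sum_prod (I J : Type) (s : seq I) (s' : seq J) (f : I -> R) (g : J -> R) :
  \sum_(i <- s) \sum_(j <- s') f i * g j =
  (\sum_(i <- s) f i) * (\sum_(j <- s') g j).
Proof. by rewrite mulr_suml; apply: eq_bigr => i _; rewrite mulr_sumr. Qed.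

End FiniteSums.

(* A mode of frequency [o] is x'' = - o^2 l^2 x, where l^2 = 1 + int |grad u|^2
   depends on time.  [mode_en], [mode_dif] and [mode_cross] are |z|^2, Re z^2
   and Im z^2 for z = (l o)^(1/2) x + i (l o)^(-1/2) x'. *)
Section ModeQuantities.
Variable R : realType.
Implicit Types (l o x y h : R).

Definition mode_en l o x y := l * o * x ^+ 2 + y ^+ 2 / (l * o).
Definition mode_dif l o x y := l * o * x ^+ 2 - y ^+ 2 / (l * o).
Definition mode_cross x y := 2 * (x * y).

Lemma mode_en_ge0 l o x y : 0 < l -> 0 < o -> 0 <= mode_en l o x y.
Proof.
move=> l0 o0; have lo := mulr_gt0 l0 o0.
have lo0 := ltW lo; apply: addr_ge0; first by apply: mulr_ge0 lo0 (sqr_ge0 _).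
by apply: divr_ge0 (sqr_ge0 _) lo0.
Qed.

Lemma mode_dif_le l o x y : 0 < l -> 0 < o ->
  `|mode_dif l o x y| <= mode_en l o x y.
Proof.
move=> l0 o0; rewrite /mode_dif /mode_en; have lo := mulr_gt0 l0 o0.
have : 0 <= l * o * x ^+ 2 by apply: mulr_ge0 (ltW lo) (sqr_ge0 _).
have : 0 <= y ^+ 2 / (l * o) by apply: divr_ge0 (sqr_ge0 _) (ltW lo).
by rewrite ler_norml; lra.
Qed.

Lemma mode_cross_le l o x y : 0 < l -> 0 < o ->
  `|mode_cross x y| <= mode_en l o x y.
Proof.
move=> l0 o0; rewrite /mode_cross /mode_en; have lo := mulr_gt0 l0 o0.
pose r := y / (l * o).
have yE : y = l * o * r.
  by rewrite /r; field; rewrite (lt0r_neq0 l0) (lt0r_neq0 o0).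
have -> : y ^+ 2 / (l * o) = l * o * r ^+ 2.
  by rewrite /r; field; rewrite (lt0r_neq0 l0) (lt0r_neq0 o0).
have := mulr_ge0 (ltW lo) (sqr_ge0 (x - r)).
have := mulr_ge0 (ltW lo) (sqr_ge0 (x + r)).
by rewrite yE ler_norml; nra.
Qed.

Variables (X Y L : R -> R) (o h t : R).
Hypothesis dX : is_derive t (1 : R) X (Y t).
Hypothesis dY : is_derive t (1 : R) Y (- (o ^+ 2 * L t ^+ 2 * X t)).
Hypothesis dL : is_derive t (1 : R) L (h * L t).
Hypotheses (L0 : 0 < L t) (o0 : 0 < o).

Let Lo0 : L t * o != 0. Proof. by rewrite lt0r_neq0 ?mulr_gt0. Qed.

Let dkin : is_derive t (1 : R) (fun s => Y s ^+ 2 / (L s * o))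
  (- (L t * o * mode_cross (X t) (Y t)) - h * (Y t ^+ 2 / (L t * o))).
Proof.
have dLo : is_derive t (1 : R) (fun s => L s * o) (h * L t * o).
  by apply: is_derive_eq; rewrite /GRing.scale/=; ring.
have dLoV := @is_deriveV _ (fun s => L s * o) t _ 1 Lo0 dLo.
have dY2 : is_derive t (1 : R) (fun s => Y s ^+ 2) (2 * (Y t * - (o ^+ 2 * L t ^+ 2 * X t))).
  by apply: is_derive_eq; rewrite /GRing.scale/=; ring.
apply: is_derive_eq; rewrite /GRing.scale/= /mode_cross.
by field; rewrite (lt0r_neq0 L0) (lt0r_neq0 o0).
Qed.

Let dpot : is_derive t (1 : R) (fun s => L s * o * X s ^+ 2)
  (L t * o * mode_cross (X t) (Y t) + h * (L t * o * X t ^+ 2)).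
Proof.
apply: is_derive_eq; rewrite /GRing.scale/= /mode_cross; ring.
Qed.

Lemma is_derive_mode_en : is_derive t (1 : R) (fun s => mode_en (L s) o (X s) (Y s))
  (h * mode_dif (L t) o (X t) (Y t)).
Proof.
rewrite /mode_en; apply: (is_derive_eq (is_deriveD dpot dkin)).
by rewrite /mode_dif; ring.
Qed.

Lemma is_derive_mode_dif : is_derive t (1 : R) (fun s => mode_dif (L s) o (X s) (Y s))
  (2 * L t * o * mode_cross (X t) (Y t) + h * mode_en (L t) o (X t) (Y t)).
Proof.
rewrite /mode_dif; apply: (is_derive_eq (is_deriveB dpot dkin)).
by rewrite /mode_en; ring.
Qed.

Lemma is_derive_mode_cross : is_derive t (1 : R) (fun s => mode_cross (X s) (Y s))
  (- (2 * o * L t * mode_dif (L t) o (X t) (Y t))).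
Proof.
apply: is_derive_eq; rewrite /GRing.scale/= /mode_dif.
by field; rewrite (lt0r_neq0 L0) (lt0r_neq0 o0).
Qed.

End ModeQuantities.

(* Small-divisor conditions: [wt] is the weight of the norm in which the
   solution must be small, [om k ^+ 2 - om j ^+ 2] the divisor created by the
   interaction of the modes k and j. *)
Definition admissible (R : realType) (I : Type) (om wt : I -> R) : Prop :=
  [/\ forall i, 1 <= om i, forall i, om i ^+ 2 <= wt i,
      forall k j, om k = om j -> wt k = wt j,
      forall k j, om k != om j -> om k ^+ 3 <= 2 * wt k * `|om k ^+ 2 - om j ^+ 2| &
      forall k j, om k != om j -> om k ^+ 2 * om j <= 2 * wt k * `|om k ^+ 2 - om j ^+ 2|].

(** * The correction term and its small divisors *)

Section Correction.
Variables (R : realType) (I : Type) (S : seq I) (om wt rho : I -> R).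
Hypothesis adm : admissible om wt.
Hypothesis rho0 : forall i, 0 <= rho i.
Hypothesis rho_om : forall k j, om k = om j -> rho k = rho j.
Implicit Types (e B G : I -> R) (l h : R).

Let om1 i : 1 <= om i. Proof. by case: adm. Qed.
Let om_gt0 i : 0 < om i. Proof. exact: lt_le_trans (om1 i). Qed.
Let wt2 i : om i ^+ 2 <= wt i. Proof. by case: adm. Qed.
Let wt_ge1 i : 1 <= wt i.
Proof. by apply: le_trans (wt2 i); rewrite exprn_ege1. Qed.

(* These coefficients are chosen so that the derivative of [correction], divided by
   [2 l ^+ 3], cancels the quartic part [h * \sum_j rho j * B j] of the derivative of
   the energy [\sum_j rho j * e j]; see [correction_derivative]. *)
Definition cdif k j : R :=
  if om k == om j then 0
  else rho j * om k ^+ 3 / (2 * (om k ^+ 2 - om j ^+ 2)).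

(** At equal frequencies only the symmetric part of [G k * B j] is a derivative:
    [(B k * G j + G k * B j) / 2] is that of [G k * G j] times [- 1 / (4 * l * om k)]. The
    antisymmetric part cancels in the double sum. *)
Definition ccross k j : R :=
  if om k == om j then - (rho j * om k / 4)
  else rho j * om k ^+ 2 * om j / (2 * (om k ^+ 2 - om j ^+ 2)).

Definition correction B G : R :=
  \sum_(k <- S) \sum_(j <- S) (cdif k j * (B k * B j) + ccross k j * (G k * G j)).

(** The sextic terms come from the summand [h * e i] in the derivative of [B i]. The derivative of
    [G i] has no such summand, so [ccross] does not appear. *)
Definition correction_rem e B : R :=
  \sum_(k <- S) \sum_(j <- S) cdif k j * (e k * B j + B k * e j).

Let div_neq0 k j : om k != om j -> om k ^+ 2 - om j ^+ 2 != 0.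
Proof.
move=> kj; rewrite subr_sqr mulf_neq0// ?subr_eq0//.
by rewrite lt0r_neq0// addr_gt0.
Qed.

(** The divisor is absorbed by [wt k] alone, and [rho j] is left untouched: the bounds on the
    correction are therefore linear in the energy of weight [rho], with constants that do not see
    [rho]. *)
Let le_div_bound a k j : 0 <= a -> om k != om j ->
  a <= 2 * wt k * `|om k ^+ 2 - om j ^+ 2| ->
  `|rho j * a / (2 * (om k ^+ 2 - om j ^+ 2))| <= wt k * rho j.
Proof.
move=> a0 kj H; have D0 := div_neq0 kj.
have D0' : 0 < `|om k ^+ 2 - om j ^+ 2| by rewrite normr_gt0.
rewrite !normrM normfV normrM (ger0_norm (rho0 j)) (ger0_norm a0) (ger0_norm (ler0n _ 2)).
rewrite ler_pdivrMr ?mulr_gt0//.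
by have := ler_wpM2l (rho0 j) H; lra.
Qed.

Lemma cdif_le k j : `|cdif k j| <= wt k * rho j.
Proof.
rewrite /cdif; case: ifPn => [_|kj].
  by rewrite normr0 mulr_ge0// (le_trans ler01).
by apply: le_div_bound => //; [rewrite exprn_ge0// ltW|case: adm => _ _ _ + _; apply].
Qed.

Lemma ccross_le k j : `|ccross k j| <= wt k * rho j.
Proof.
rewrite /ccross; case: ifPn => [_|kj].
  have ow : om k <= wt k.
    by apply: le_trans (wt2 k); rewrite expr2 ler_peMl// ltW.
  have := ler_wpM2l (rho0 j) ow; have := mulr_ge0 (rho0 j) (ltW (om_gt0 k)).
  by rewrite ler_norml; lra.
rewrite -(mulrA (rho j)); apply: le_div_bound => //.
  by rewrite mulr_ge0 ?exprn_ge0// ltW.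
by case: adm => _ _ _ _; apply.
Qed.

Let norm_prod_le (a b c d : R) : `|a| <= c -> `|b| <= d -> `|a * b| <= c * d.
Proof. by move=> ac bd; rewrite normrM ler_pM. Qed.

Let two_sum (f : I -> R) (g : I -> R) :
  \sum_(k <- S) \sum_(j <- S) 2 * (f k * g j) =
  2 * (\sum_(k <- S) f k) * (\sum_(j <- S) g j).
Proof.
rewrite -mulrA -sum_prod mulr_sumr; apply: eq_bigr => k _.
by rewrite mulr_sumr.
Qed.

Lemma correction_le e B G : (forall i, `|B i| <= e i) -> (forall i, `|G i| <= e i) ->
  `|correction B G| <= 2 * (\sum_(k <- S) wt k * e k) * (\sum_(j <- S) rho j * e j).
Proof.
move=> Be Ge; rewrite -two_sum.
apply: big_norm_le => k; apply: big_norm_le => j.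
apply: le_trans (ler_normD _ _) _.
have := norm_prod_le (cdif_le k j) (norm_prod_le (Be k) (Be j)).
have := norm_prod_le (ccross_le k j) (norm_prod_le (Ge k) (Ge j)).
lra.
Qed.

Lemma correction_rem_le e B : (forall i, `|B i| <= e i) ->
  `|correction_rem e B| <= 2 * (\sum_(k <- S) wt k * e k) * (\sum_(j <- S) rho j * e j).
Proof.
move=> Be; rewrite -two_sum.
apply: big_norm_le => k; apply: big_norm_le => j.
have e0 i : `|e i| <= e i.
  by rewrite ger0_norm// (le_trans _ (Be i)).
rewrite mulrDr; apply: le_trans (ler_normD _ _) _.
have := norm_prod_le (cdif_le k j) (norm_prod_le (e0 k) (Be j)).
have := norm_prod_le (cdif_le k j) (norm_prod_le (Be k) (e0 j)).
lra.
Qed.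

(* Interactions of modes of equal frequency cancel by antisymmetry. *)
Let resonant l B G k j : R :=
  if om k == om j then l * (rho j * om k ^+ 2) / 2 * (B k * G j - G k * B j) else 0.

Let sum_resonant l B G : \sum_(k <- S) \sum_(j <- S) resonant l B G k j = 0.
Proof.
set s := LHS; suff : s = - s by move=> ?; lra.
rewrite {1}/s exchange_big -sumrN; apply: eq_bigr => k _.
rewrite -sumrN; apply: eq_bigr => j _; rewrite /resonant eq_sym.
by case: ifPn => [/eqP kj|_]; rewrite ?oppr0// kj (rho_om kj); ring.
Qed.

Lemma correction_derivative l h e B G (dB dG : I -> R) :
  (forall i, dB i = 2 * l * om i * G i + h * e i) ->
  (forall i, dG i = - (2 * om i * l * B i)) ->
  \sum_(k <- S) \sum_(j <- S) (cdif k j * (dB k * B j + B k * dB j)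
    + ccross k j * (dG k * G j + G k * dG j)) =
  l * (\sum_(k <- S) om k ^+ 2 * G k) * (\sum_(j <- S) rho j * B j)
  + h * correction_rem e B.
Proof.
move=> dBE dGE; set rhs := RHS.
(* Adding this vanishing double sum makes the identity hold term by term in [k] and [j]. *)
have -> : rhs = rhs + \sum_(k <- S) \sum_(j <- S) resonant l B G k j.
  by rewrite sum_resonant addr0.
rewrite /rhs /correction_rem -(mulrA l) -sum_prod !mulr_sumr -!big_split; apply: eq_bigr => k _ /=.
rewrite !mulr_sumr -!big_split; apply: eq_bigr => j _ /=.
rewrite !dBE !dGE /cdif /ccross /resonant; case: ifPn => [/eqP kj|kj].
  by rewrite kj; field.
by field; rewrite div_neq0.
Qed.

End Correction.

(** * Energy estimates for finitely many modes *)

Section Energy.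
Variables (R : realType) (I : Type) (S : seq I) (om wt : I -> R).
Hypothesis adm : admissible om wt.
Variables (X Y : I -> R -> R).
Implicit Types (rho : I -> R) (t s : R).

Definition stiffness (t : R) : R := 1 + \sum_(i <- S) om i ^+ 2 * X i t ^+ 2.
Definition speed (t : R) : R := Num.sqrt (stiffness t).
Definition en i t := mode_en (speed t) (om i) (X i t) (Y i t).
Definition dif i t := mode_dif (speed t) (om i) (X i t) (Y i t).
Definition cross i t := mode_cross (X i t) (Y i t).
Definition stiffness' t := \sum_(i <- S) om i ^+ 2 * cross i t.
Definition lograte t := stiffness' t / (2 * stiffness t).
Definition energy rho t := \sum_(i <- S) rho i * en i t.
Definition modified rho t := energy rho t -
  correction S om rho (dif ^~ t) (cross ^~ t) / (2 * speed t ^+ 3).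

Let om1 i : 1 <= om i. Proof. by case: adm. Qed.
Let om_gt0 i : 0 < om i. Proof. exact: lt_le_trans (om1 i). Qed.
Let wt2 i : om i ^+ 2 <= wt i. Proof. by case: adm. Qed.
Let wt_ge1 i : 1 <= wt i.
Proof. by apply: le_trans (wt2 i); rewrite exprn_ege1. Qed.

Lemma stiffness_ge1 t : 1 <= stiffness t.
Proof. by rewrite lerDl sumr_ge0// => i _; rewrite mulr_ge0 ?sqr_ge0. Qed.

Let stiffness_gt0 t : 0 < stiffness t.
Proof. exact: lt_le_trans (stiffness_ge1 t). Qed.

Lemma speed_ge1 t : 1 <= speed t.
Proof. by rewrite -sqrtr1 ler_wsqrtr// stiffness_ge1. Qed.

Let speed_gt0 t : 0 < speed t.
Proof. exact: lt_le_trans (speed_ge1 t). Qed.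

Lemma speed_sqr t : speed t ^+ 2 = stiffness t.
Proof. by rewrite sqr_sqrtr// ltW. Qed.

Lemma en_ge0 i t : 0 <= en i t. Proof. exact: mode_en_ge0. Qed.

Lemma dif_le i t : `|dif i t| <= en i t. Proof. exact: mode_dif_le. Qed.

Lemma cross_le i t : `|cross i t| <= en i t. Proof. exact: mode_cross_le. Qed.

Lemma energy_ge0 rho t : (forall i, 0 <= rho i) -> 0 <= energy rho t.
Proof. by move=> rho0; apply: sumr_ge0 => i _; rewrite mulr_ge0// en_ge0. Qed.

Let wt_ge0 i : 0 <= wt i. Proof. exact: le_trans (wt_ge1 i). Qed.

Lemma stiffness'_le t : `|stiffness' t| <= energy wt t.
Proof.
apply: big_norm_le => i; rewrite normrM ger0_norm ?sqr_ge0//.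
by apply: ler_pM => //; [exact: sqr_ge0|exact: cross_le].
Qed.

Lemma lograte_le t : `|lograte t| <= energy wt t / 2.
Proof.
rewrite /lograte normrM normfV (ger0_norm (ltW (mulr_gt0 _ (stiffness_gt0 t))))//.
apply: ler_pM (stiffness'_le t) _ => //; first by rewrite invr_ge0 mulr_ge0// ltW.
by rewrite lef_pV2 ?posrE ?mulr_gt0// ler_peMr// stiffness_ge1.
Qed.

Lemma stiffness_le t : stiffness t <= 1 + energy wt t.
Proof.
rewrite lerD2l; apply: ler_sum => i _.
have l1 := speed_ge1 t.
have H1 : om i * (speed t * X i t ^+ 2 * om i) <= wt i * en i t.
  apply: ler_pM => //.
  - exact: ltW.
  - by apply: mulr_ge0 (ltW (om_gt0 i)); apply: mulr_ge0 (sqr_ge0 _); exact: ltW.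
  - by apply: le_trans (wt2 i); rewrite expr2 ler_peMl// ltW.
  - rewrite /en /mode_en mulrAC lerDl.
    by rewrite divr_ge0 ?sqr_ge0// mulr_ge0// ltW.
apply: le_trans H1.
have : 0 <= om i ^+ 2 * X i t ^+ 2 by rewrite mulr_ge0 ?sqr_ge0.
nra.
Qed.

Section Derivatives.
Variable t : R.
Hypothesis dX : forall i, is_derive t (1 : R) (X i) (Y i t).
Hypothesis dY : forall i, is_derive t (1 : R) (Y i) (- (om i ^+ 2 * stiffness t * X i t)).

Lemma is_derive_stiffness : is_derive t (1 : R) stiffness (stiffness' t).
Proof.
rewrite -[stiffness' t]add0r.
apply: (is_deriveD (is_derive_cst (1 : R) t (1 : R))).
apply: is_derive_bigsum => i; apply: is_derive_eq.
by rewrite /GRing.scale/= /cross /mode_cross; ring.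
Qed.

Lemma is_derive_speed : is_derive t (1 : R) speed (lograte t * speed t).
Proof.
have := is_derive1_sqrt (stiffness_gt0 t) => ds.
apply: (is_derive_eq (is_derive1_comp ds is_derive_stiffness)).
rewrite -/(speed t) /lograte -speed_sqr.
by field; rewrite lt0r_neq0.
Qed.

Let dY' i : is_derive t (1 : R) (Y i) (- (om i ^+ 2 * speed t ^+ 2 * X i t)).
Proof. by rewrite speed_sqr. Qed.

Lemma is_derive_en i : is_derive t (1 : R) (en i) (lograte t * dif i t).
Proof. exact: is_derive_mode_en (dX i) (dY' i) is_derive_speed (speed_gt0 t) (om_gt0 i). Qed.

Let ddif i : is_derive t (1 : R) (dif i)
  (2 * speed t * om i * cross i t + lograte t * en i t).
Proof. exact: is_derive_mode_dif (dX i) (dY' i) is_derive_speed (speed_gt0 t) (om_gt0 i). Qed.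

Let dcross i : is_derive t (1 : R) (cross i) (- (2 * om i * speed t * dif i t)).
Proof. exact: is_derive_mode_cross (dX i) (dY' i) (speed_gt0 t) (om_gt0 i). Qed.

Variable rho : I -> R.
Hypothesis rho0 : forall i, 0 <= rho i.
Hypothesis rho_om : forall k j, om k = om j -> rho k = rho j.

Let is_derive_energy : is_derive t (1 : R) (energy rho)
  (lograte t * \sum_(i <- S) rho i * dif i t).
Proof.
rewrite mulr_sumr; apply: is_derive_bigsum => i.
have := is_derive_en i => den.
by apply: is_derive_eq; rewrite /GRing.scale/=; ring.
Qed.

Let is_derive_correction :
  is_derive t (1 : R) (fun s => correction S om rho (dif ^~ s) (cross ^~ s))
    (2 * speed t ^+ 3 * lograte t * (\sum_(i <- S) rho i * dif i t)
     + lograte t * correction_rem S om rho (en ^~ t) (dif ^~ t)).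
Proof.
have -> : 2 * speed t ^+ 3 * lograte t = speed t * stiffness' t.
  by rewrite /lograte -speed_sqr; field; rewrite lt0r_neq0.
rewrite -(@correction_derivative _ _ S _ _ _ adm rho_om (speed t) (lograte t)
  (en ^~ t) (dif ^~ t) (cross ^~ t) _ _ (fun i => erefl) (fun i => erefl)).
apply: is_derive_bigsum => k; apply: is_derive_bigsum => j.
have := ddif k => dk; have := ddif j => dj.
have := dcross k => ck; have := dcross j => cj.
by apply: is_derive_eq; rewrite /GRing.scale/=; ring.
Qed.

(** The quartic terms have cancelled. Of what is left, [3 * correction] comes from differentiating
    the factor [speed ^- 3], and [correction_rem] from the derivative of the correction. *)
Lemma is_derive_modified : is_derive t (1 : R) (modified rho)
  (lograte t * (3 * correction S om rho (dif ^~ t) (cross ^~ t)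
     - correction_rem S om rho (en ^~ t) (dif ^~ t)) / (2 * speed t ^+ 3)).
Proof.
have ds := is_derive_speed.
have ds3 : is_derive t (1 : R) (fun s => 2 * speed s ^+ 3) (6 * lograte t * speed t ^+ 3).
  by apply: is_derive_eq; rewrite /GRing.scale/=; ring.
have s3 : 2 * speed t ^+ 3 != 0 by rewrite lt0r_neq0// mulr_gt0// exprn_gt0.
have dV := @is_deriveV _ (fun s => 2 * speed s ^+ 3) t _ 1 s3 ds3.
have dE := is_derive_energy; have dQ := is_derive_correction.
apply: is_derive_eq; rewrite /GRing.scale/=.
by field; rewrite lt0r_neq0.
Qed.

End Derivatives.

Section EnergyEstimate.
Variable rho : I -> R.
Hypothesis rho0 : forall i, 0 <= rho i.
Hypothesis rho_om : forall k j, om k = om j -> rho k = rho j.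

Let speed3 t : 0 <= (2 * speed t ^+ 3)^-1 <= 2^-1.
Proof.
have s3 : 1 <= speed t ^+ 3 by rewrite exprn_ege1// speed_ge1.
have s0 : 0 < 2 * speed t ^+ 3 by rewrite mulr_gt0// (lt_le_trans _ s3).
rewrite invr_ge0 (ltW s0)/= lef_pV2 ?posrE//.
by rewrite ler_peMr.
Qed.

Lemma modified_dist t : `|modified rho t - energy rho t| <= energy wt t * energy rho t.
Proof.
rewrite /modified addrC addKr normrN normrM.
have /andP[v0 v1] := speed3 t; rewrite (ger0_norm v0).
have := correction_le S adm rho0 (dif_le ^~ t) (cross_le ^~ t).
rewrite -/(energy wt t) -/(energy rho t) => H.
have := ler_pM (normr_ge0 _) v0 H v1.
lra.
Qed.

Lemma modified_derivative_le t :
  `|lograte t * (3 * correction S om rho (dif ^~ t) (cross ^~ t)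
     - correction_rem S om rho (en ^~ t) (dif ^~ t)) / (2 * speed t ^+ 3)| <=
  2 * energy wt t ^+ 2 * energy rho t.
Proof.
rewrite normrM (normrM (lograte t)); have /andP[v0 v1] := speed3 t; rewrite (ger0_norm v0).
have := correction_le S adm rho0 (dif_le ^~ t) (cross_le ^~ t).
have := correction_rem_le S adm rho0 (dif_le ^~ t).
rewrite -/(energy wt t) -/(energy rho t).
set Q := correction _ _ _ _ _; set Q' := correction_rem _ _ _ _ _ => HQ' HQ.
have H : `|3 * Q - Q'| <= 8 * energy wt t * energy rho t.
  by move: HQ HQ'; rewrite !ler_norml; lra.
have := ler_pM (normr_ge0 _) (normr_ge0 _) (lograte_le t) H => H2.
have := ler_pM (mulr_ge0 (normr_ge0 _) (normr_ge0 _)) v0 H2 v1.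
by move=> /le_trans; apply; rewrite le_eqVlt; apply/orP; left; apply/eqP; field.
Qed.

End EnergyEstimate.

Lemma expR_half_le2 (x : R) : x <= 2^-1 -> expR x <= 2.
Proof.
move=> x2; apply: (@le_trans _ _ (expR (2^-1))); first by rewrite ler_expR.
rewrite -[2^-1]opprK expRN -[leRHS]invrK lef_pV2 ?posrE ?invr_gt0 ?expR_gt0//.
by apply: le_trans (expR_ge1Dx _); lra.
Qed.

Variables (T d : R).
Hypothesis dX : forall i t, 0 <= t <= T -> is_derive t (1 : R) (X i) (Y i t).
Hypothesis dY : forall i t, 0 <= t <= T ->
  is_derive t (1 : R) (Y i) (- (om i ^+ 2 * stiffness t * X i t)).
Hypothesis small : forall t, 0 <= t <= T -> energy wt t <= 4 * d.
Hypothesis d_small : 4 * d <= 4^-1.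

Let energy_wt_ge0 t : 0 <= energy wt t. Proof. exact: energy_ge0. Qed.

(** As [energy wt] is at most 1/4, the modified energy lies between 3/4 and 5/4 of the energy. With
    [energy wt <= 4 * d], the derivative bound is [32 * d ^+ 2] times the energy, hence at most
    [128 / 3 <= 43] times [d ^+ 2] times the modified energy. Gronwall's factor is at most 2, and 2
    (5/4) / (3/4) = 10/3. *)
Lemma energy_growth (rho : I -> R) : (forall i, 0 <= rho i) ->
  (forall k j, om k = om j -> rho k = rho j) -> 43 * d ^+ 2 * T <= 2^-1 ->
  forall t, 0 <= t <= T -> energy rho t <= 10 / 3 * energy rho 0.
Proof.
move=> rho0 rho_om dT t tT; have /andP[t0 tT'] := tT.
have CM : C1in T (modified rho) (fun s => lograte s *
    (3 * correction S om rho (dif ^~ s) (cross ^~ s)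
     - correction_rem S om rho (en ^~ s) (dif ^~ s)) / (2 * speed s ^+ 3)).
  apply: is_derive_C1in => s sT.
  by apply: is_derive_modified => // i; [exact: dX|exact: dY].
have equiv s : 0 <= s <= T ->
    3 / 4 * energy rho s <= modified rho s <= 5 / 4 * energy rho s.
  move=> sT; have := modified_dist rho0 s.
  have := ler_wpM2r (energy_ge0 s rho0) (le_trans (small sT) d_small).
  by rewrite ler_norml; lra.
have := gronwall (c := 43 * d ^+ 2) CM _ tT.
have T00 : 0 <= (0 : R) <= T by rewrite lexx (le_trans t0 tT').
have /andP[+ _] := equiv t tT; have /andP[_ +] := equiv 0 T00.
have E0 := energy_ge0 0 rho0; have Et := energy_ge0 t rho0.
have e2 : expR (43 * d ^+ 2 * t) <= 2.
  apply: expR_half_le2; apply: le_trans dT; rewrite ler_wpM2l//.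
  by rewrite mulr_ge0 ?sqr_ge0.
have e0 := expR_ge0 (43 * d ^+ 2 * t).
move=> H1 H2 H3.
have {H3} : modified rho t <= expR (43 * d ^+ 2 * t) * modified rho 0.
  apply: H3 => s /andP[/ltW s0 /ltW sT].
  have sI : 0 <= s <= T by rewrite s0.
  have := modified_derivative_le rho0 s.
  have /andP[+ _] := equiv _ sI.
  have := small sI; have := energy_wt_ge0 s.
  have := energy_ge0 s rho0.
  set W := energy wt s; set E := energy rho s; set M := modified rho s.
  move=> E0' W0 Wd EM /(le_trans (ler_norm _)) /le_trans; apply.
  have W2 : W ^+ 2 <= 16 * d ^+ 2 by nra.
  have : 2 * W ^+ 2 * E <= 32 * d ^+ 2 * E by nra.
  have := mulr_ge0 (sqr_ge0 d) E0'.
  have := ler_wpM2l (sqr_ge0 d) EM.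
  nra.
nra.
Qed.

(** A crude bound, exponential in time, but valid mode by mode where [energy_growth] controls only
    sums. It provides the majorants for tails and for dominated convergence, whose size does not
    matter. *)
Lemma en_growth i t : 0 <= t <= T -> en i t <= expR t * en i 0.
Proof.
move=> tT.
have C : C1in T (en i) (fun s => lograte s * dif i s).
  apply: is_derive_C1in => s sT.
  by apply: is_derive_en => // j; [exact: dX|exact: dY].
have := gronwall (c := 1) C _ tT; rewrite mul1r; apply.
move=> s /andP[/ltW s0 /ltW sT]; have sI : 0 <= s <= T by rewrite s0.
apply: le_trans (ler_norm _) _; rewrite normrM mul1r -[leRHS]mul1r.
apply: ler_pM => //; last exact: dif_le.
by apply: le_trans (lograte_le s) _; have := small sI; move: d_small; lra.
Qed.

End Energy.

(** * Continuity arguments *)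

Section Bootstrap.
Variable R : realType.
Implicit Types (T t s : R).

(** Real induction: the supremum of the times where [P] holds belongs to them by the limit clause,
    and the step clause prevents it from being less than [T]. *)
Lemma interval_induction (P : R -> Prop) T : 0 <= T -> P 0 ->
  (forall s t, s <= t -> P t -> P s) ->
  (forall t, 0 < t <= T -> (forall s, s < t -> P s) -> P t) ->
  (forall t, 0 <= t < T -> P t -> exists2 t', t < t' & P t') -> P T.
Proof.
move=> T0 P0 Pdown Plim Pstep.
pose E := [set t | 0 <= t <= T /\ P t].
have E0 : E 0 by split => //; rewrite lexx.
have supE : has_sup E by split; [exists 0|exists T => t [/andP[]]].
have m0 : 0 <= sup E by apply: ub_le_sup => //; case: supE.
have mT : sup E <= T by apply: ge_sup; [exists 0|move=> t [/andP[]]].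
have Pm : P (sup E).
  move: m0; rewrite le_eqVlt => /predU1P[<-//|m0].
  apply: Plim => [|s sm]; first by rewrite m0.
  have [e [_ Pe] se] := sup_gt (ex_intro _ 0 E0) sm.
  by apply: Pdown Pe; exact: ltW.
have := mT; rewrite le_eqVlt => /predU1P[<-//|mltT].
have [|t' mt' Pt'] := Pstep _ _ Pm; first by rewrite m0.
have : E (Num.min t' T).
  split; last by apply: Pdown Pt'; rewrite ge_min lexx.
  by rewrite ge_min lexx orbT le_min T0 (le_trans m0 (ltW mt')).
move=> /(ub_le_sup (proj2 supE)).
by rewrite ge_min leNgt mt' leNgt mltT.
Qed.

(** The gap between [b'] and [b] is what continuity uses up to carry the bound [b] a little further
    in time. *)
Lemma bootstrap (f : R -> R) (T b b' : R) : b' < b -> f 0 <= b ->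
  (forall t, 0 <= t <= T -> {for t, continuous f}) ->
  (forall t, 0 <= t <= T -> (forall s, 0 <= s <= t -> f s <= b) -> f t <= b') ->
  forall t, 0 <= t <= T -> f t <= b.
Proof.
move=> b'b f0 cf boot t /andP[t0 tT].
suff : forall s, 0 <= s <= T -> f s <= b by apply; rewrite t0.
have T0 := le_trans t0 tT.
suff H : forall s, 0 <= s <= T -> s <= T -> f s <= b.
  by move=> s sT; apply: H => //; case/andP: sT.
move=> s + _.
pose P r := forall s, 0 <= s <= T -> s <= r -> f s <= b.
suff PT : P T by move=> sT; apply: PT => //; case/andP: sT.
apply: interval_induction => //.
- by move=> r /andP[r0 _] r0'; have -> : r = 0 by apply/eqP; rewrite eq_le r0 r0'.
- by move=> r r' rr' Pr' q qT qr; apply: Pr' => //; exact: le_trans rr'.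
- move=> r /andP[r0 rT] Pr q qT; rewrite le_eqVlt => /predU1P[->{q qT}|qr]; last exact: (Pr q).
  rewrite leNgt; apply/negP => fr.
  have rI : 0 <= r <= T by rewrite ltW.
  have /cvgrPdist_lt := cf _ rI; rewrite -subr_gt0 in fr => /(_ _ fr) [e /= e0 He].
  pose q := Num.max 0 (r - e / 2).
  have qr : q < r by rewrite gt_max r0 ltrBlDr ltrDl divr_gt0.
  have q0 : 0 <= q by rewrite le_max lexx.
  have := He q; rewrite /ball_/= ger0_norm ?subr_ge0 ?(ltW qr)//.
  have qe : r - e / 2 <= q by rewrite le_max lexx orbT.
  have -> : (r - q < e) = true by apply/idP; lra.
  move=> /(_ isT).
  have := Pr q qr q; rewrite q0 lexx (le_trans (ltW qr) rT) => /(_ isT isT).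
  by rewrite ltr_norml; lra.
- move=> r /andP[r0 rT] Pr.
  have rI : 0 <= r <= T by rewrite r0 ltW.
  have fr : f r <= b'.
    apply: boot => // s' /andP[s0 s'r]; apply: Pr => //.
    by rewrite s0 (le_trans s'r)// ltW.
  have bf : 0 < b - b' by rewrite subr_gt0.
  have /cvgrPdist_lt /(_ _ bf) [e /= e0 He] := cf _ rI.
  exists (r + e / 2); first by rewrite ltrDl divr_gt0.
  move=> q qT qre; have [qr|rq] := leP q r; first exact: Pr.
  have := He q; rewrite /ball_/= distrC ger0_norm ?subr_ge0 ?(ltW rq)//.
  have -> : (q - r < e) = true by apply/idP; lra.
  by move=> /(_ isT); rewrite ltr_norml; lra.
Qed.

(** Compactness of [[0, T]] for a function that need not be continuous; it is meant for the Sobolev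
    norms of an arbitrary solution. *)
Lemma locally_bounded (f : R -> R) T :
  (forall t, 0 <= t <= T -> exists M e, 0 < e /\
     forall s, 0 <= s <= T -> `|s - t| < e -> f s <= M) ->
  exists M, forall t, 0 <= t <= T -> f t <= M.
Proof.
move=> loc; have [T0|T0] := leP 0 T; last first.
  by exists 0 => t /andP[t0 /(le_trans t0)]; rewrite leNgt T0.
suff [M HM] : exists M, forall s, 0 <= s <= T -> s <= T -> f s <= M.
  by exists M => t tT; apply: HM => //; case/andP: tT.
pose P r := exists M, forall s, 0 <= s <= T -> s <= r -> f s <= M.
change (P T); apply: interval_induction => //.
- exists (f 0) => r /andP[r0 _] r0'.
  by have -> : r = 0 by apply/eqP; rewrite eq_le r0 r0'.
- by move=> r r' rr' [M HM]; exists M => q qT qr; apply: HM => //; exact: le_trans rr'.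
- move=> r /andP[r0 rT] Pr.
  have rI : 0 <= r <= T by rewrite ltW.
  have [M [e [e0 HM]]] := loc r rI.
  have [|M' HM'] := Pr (r - e / 2); first by rewrite ltrBlDr ltrDl divr_gt0.
  exists (Num.max M M') => q qT qr; rewrite le_max.
  have [qe|qe] := leP q (r - e / 2); first by rewrite HM' ?orbT.
  by rewrite HM// distrC ger0_norm ?subr_ge0//; lra.
- move=> r /andP[r0 rT] [M' HM'].
  have rI : 0 <= r <= T by rewrite r0 ltW.
  have [M [e [e0 HM]]] := loc r rI.
  exists (r + e / 2); first by rewrite ltrDl divr_gt0.
  exists (Num.max M M') => q qT qre; rewrite le_max.
  have [qr|qr] := leP q r; first by rewrite HM' ?orbT.
  by rewrite HM// ger0_norm ?subr_ge0 ?ltW//; lra.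
Qed.

End Bootstrap.

Section Clamp.
Variable R : realType.
Implicit Types (x y m : R).

Definition clamp x : R := Num.max (-1) (Num.min 1 x).

Lemma clamp_id x : `|x| <= 1 -> clamp x = x.
Proof.
by rewrite ler_norml => /andP[x1 x2]; rewrite /clamp (min_idPr x2) (max_idPr x1).
Qed.

Lemma clamp_le1 x : `|clamp x| <= 1.
Proof.
rewrite ler_norml /clamp le_max lexx/= ge_max ge_min lexx/= andbT; lra.
Qed.

Lemma clamp_lip x y : `|clamp x - clamp y| <= `|x - y|.
Proof.
rewrite /clamp ler_norml !(minEle, maxEle).
have := ler_norm (x - y); have := ler_norm (y - x); rewrite [`|y - x|]distrC.
by do !case: ifPn; rewrite -?ltNge; lra.
Qed.

Lemma continuous_clamp : continuous clamp.
Proof.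
move=> x; apply: (@continuous_max R _ (fun=> -1) (fun y => Num.min 1 y)).
  exact: cvg_cst.
by apply: (@continuous_min R _ (fun=> 1) id); [exact: cvg_cst|exact: cvg_id].
Qed.

End Clamp.

(** * Galerkin approximations *)

Lemma cvg_bigsum (R : realType) (T : Type) (F : set_system T) (FF : Filter F)
    (I : Type) (s : seq I) (f : I -> T -> R) (l : I -> R) :
  (forall i, f i x @[x --> F] --> l i) ->
  (\sum_(i <- s) f i x) @[x --> F] --> \sum_(i <- s) l i.
Proof.
move=> fl; elim: s => [|i s ih].
  under eq_fun do rewrite big_nil.
  by rewrite big_nil; exact: cvg_cst.
under eq_fun do rewrite big_cons.
by rewrite big_cons; apply: cvgD.
Qed.

Lemma le_bigsum_mem (R : realType) (I : eqType) (s : seq I) (f : I -> R) (i : I) :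
  (forall i, 0 <= f i) -> i \in s -> f i <= \sum_(j <- s) f j.
Proof.
move=> f0; elim: s => // j s ih; rewrite in_cons big_cons => /predU1P[->|/ih].
  by rewrite lerDl sumr_ge0.
by move=> fi; rewrite -[f i]add0r lerD.
Qed.

Section Galerkin.
Variables (R : realType) (I : eqType) (S : seq I) (om wt : I -> R).
Hypothesis adm : admissible om wt.
Implicit Types (t s m : R) (p q : I * bool -> R).

Let om1 i : 1 <= om i. Proof. by case: adm. Qed.
Let om_gt0 i : 0 < om i. Proof. exact: lt_le_trans (om1 i). Qed.
Let wt2 i : om i ^+ 2 <= wt i. Proof. by case: adm. Qed.
Let om_wt i : om i <= wt i.
Proof. by apply: le_trans (wt2 i); rewrite expr2 ler_peMl// ltW. Qed.
Let wt_ge1 i : 1 <= wt i. Proof. exact: le_trans (om1 i) (om_wt i). Qed.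

Let A := \sum_(k <- S) om k ^+ 2.

Let A0 : 0 <= A. Proof. by apply: sumr_ge0 => i _; exact: sqr_ge0. Qed.

Let om_A i : i \in S -> om i ^+ 2 <= A.
Proof. by apply: (le_bigsum_mem (f := fun i => om i ^+ 2)) => j; exact: sqr_ge0. Qed.

Let P p := \sum_(k <- S) om k ^+ 2 * clamp (p (k, false)) ^+ 2.

(* Clamping all coordinates makes the field bounded and globally Lipschitz; the
   bootstrap below shows that the clamps are inactive on [0, T]. *)
Let field p (j : I * bool) : R :=
  if j.1 \in S then
    if j.2 then - (om j.1 ^+ 2 * (1 + P p) * clamp (p (j.1, false)))
    else clamp (p (j.1, true))
  else 0.

Let clamp_sqr_le x : 0 <= @clamp R x ^+ 2 <= 1.
Proof.
rewrite sqr_ge0/=; have := clamp_le1 x; rewrite ler_norml; nra.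
Qed.

Let P_bound p : 0 <= P p <= A.
Proof.
apply/andP; split; first by apply: sumr_ge0 => i _; rewrite mulr_ge0 ?sqr_ge0.
by apply: ler_sum => i _; rewrite ler_piMr ?sqr_ge0//; case/andP: (clamp_sqr_le (p (i, false))).
Qed.

Let P_lip p q m : (forall j, `|p j - q j| <= m) -> `|P p - P q| <= 2 * A * m.
Proof.
move=> pq; rewrite /P /A -sumrB -mulrA mulrCA mulr_suml; apply: big_norm_le => k.
rewrite -mulrBr normrM ger0_norm ?sqr_ge0//; apply: ler_wpM2l; first exact: sqr_ge0.
have := le_trans (clamp_lip _ _) (pq (k, false)).
have := clamp_le1 (p (k, false)); have := clamp_le1 (q (k, false)).
rewrite subr_sqr normrM mulrC => c1 c2 c3.
apply: ler_pM => //; apply: le_trans (ler_normD _ _) _; lra.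
Qed.

Let field_lip p q m : (forall j, `|p j - q j| <= m) ->
  forall j, `|field p j - field q j| <= (1 + A * (1 + 3 * A)) * m.
Proof.
move=> pq [i b]; have m0 : 0 <= m := le_trans (normr_ge0 _) (pq (i, b)).
have AA : 0 <= A * (1 + 3 * A) by rewrite mulr_ge0// addr_ge0// mulr_ge0.
have L0 : 0 <= (1 + A * (1 + 3 * A)) * m by rewrite mulr_ge0// addr_ge0.
rewrite /field/=; case: ifPn => iS; last by rewrite subrr normr0.
case: b; last first.
  apply: le_trans (le_trans (clamp_lip _ _) (pq _)) _.
  by rewrite ler_peMl// lerDl.
set c := clamp (p _); set c' := clamp (q _).
have cc : `|c - c'| <= m by apply: le_trans (clamp_lip _ _) (pq _).
have c'1 : `|c'| <= 1 by exact: clamp_le1.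
have oA := om_A iS; move: (om i ^+ 2) (sqr_ge0 (om i)) oA => o o0 oA.
rewrite -opprD normrN -!mulrA -mulrN -mulrDr normrM (ger0_norm o0).
have -> : (1 + P p) * c - (1 + P q) * c' = (1 + P p) * (c - c') + (P p - P q) * c' by ring.
have H : `|(1 + P p) * (c - c') + (P p - P q) * c'| <= (1 + 3 * A) * m.
  have /andP[p0 pA] := P_bound p.
  have H1 : `|(1 + P p) * (c - c')| <= (1 + A) * m.
    by rewrite normrM; apply: ler_pM => //; rewrite ger0_norm ?lerD2l// addr_ge0.
  have H2 : `|(P p - P q) * c'| <= 2 * A * m * 1.
    by rewrite normrM; apply: ler_pM => //; exact: P_lip.
  apply: le_trans (ler_normD _ _) _; lra.
have := ler_pM o0 (normr_ge0 _) oA H.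
move=> /le_trans; apply; lra.
Qed.

Let field_bound p j : `|field p j| <= 1 + A * (1 + A).
Proof.
have AA : 0 <= A * (1 + A) by rewrite mulr_ge0// addr_ge0.
case: j => i b; rewrite /field/=; case: ifPn => iS; last by rewrite normr0 addr_ge0.
case: b; last by apply: le_trans (clamp_le1 _) _; rewrite lerDl.
have /andP[p0 pA] := P_bound p.
have oA := om_A iS; move: (om i ^+ 2) (sqr_ge0 (om i)) oA => o o0 oA.
rewrite normrN 2!normrM (ger0_norm o0) (ger0_norm (addr_ge0 _ p0))//.
have H : o * (1 + P p) <= A * (1 + A).
  by apply: ler_pM; rewrite ?lerD2l ?addr_ge0.
have := ler_pM (mulr_ge0 o0 (addr_ge0 ler01 p0)) (normr_ge0 _) H (clamp_le1 (p (i, false))).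
lra.
Qed.

Let field_cont (p : R -> I * bool -> R) : (forall j, continuous (fun t => p t j)) ->
  forall j, continuous (fun t => field (p t) j).
Proof.
move=> cp [i b] t; rewrite /field/=.
case: (i \in S); last exact: cvg_cst.
have cc k b' : clamp (p s (k, b')) @[s --> t] --> clamp (p t (k, b')).
  apply: (@continuous_comp _ _ _ (fun s => p s (k, b')) (@clamp R)); first exact: cp.
  exact: continuous_clamp.
case: b; last exact: cc.
apply: cvgN; apply: cvgM; last exact: cc.
apply: cvgM; first exact: cvg_cst.
apply: cvgD; first exact: cvg_cst.
apply: cvg_bigsum => k; apply: cvgM; first exact: cvg_cst.
by rewrite expr2; under eq_fun do rewrite expr2; apply: cvgM; exact: cc.
Qed.

Variables (X0 Y0 : I -> R) (d T : R).
Hypotheses (d0 : 0 < d) (d_small : 4 * d <= 4^-1) (dT : 43 * d ^+ 2 * T <= 2^-1).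
Hypothesis initial : \sum_(i <- S) wt i *
  mode_en (Num.sqrt (1 + \sum_(k <- S) om k ^+ 2 * X0 k ^+ 2)) (om i) (X0 i) (Y0 i) <= d.

Lemma galerkin : exists X Y : I -> R -> R,
  [/\ forall i, i \in S -> X i 0 = X0 i /\ Y i 0 = Y0 i,
      forall i t, i \notin S -> X i t = 0 /\ Y i t = 0,
      forall i t, 0 <= t <= T -> is_derive t (1 : R) (X i) (Y i t),
      forall i t, 0 <= t <= T -> is_derive t (1 : R) (Y i)
        (- (om i ^+ 2 * stiffness S om X t * X i t)) &
      forall t, 0 <= t <= T -> energy S om X Y wt t <= 4 * d].
Proof.
have L0 : 0 < 1 + A * (1 + 3 * A).
  by rewrite ltr_pwDl// mulr_ge0// addr_ge0// mulr_ge0.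
have [Z Z0 dZ] := picard (fun j => if j.2 then Y0 j.1 else X0 j.1) L0 field_lip field_bound field_cont.
pose X i t := if i \in S then Z t (i, false) else 0.
pose Y i t := if i \in S then Z t (i, true) else 0.
have dX i t : 0 <= t -> is_derive t (1 : R) (X i) (if i \in S then clamp (Y i t) else 0).
  move=> t0; rewrite /X /Y; case: ifPn => iS; last exact: is_derive_cst.
  by have := dZ t (i, false) t0; rewrite /field/= iS.
have dY i t : 0 <= t -> is_derive t (1 : R) (Y i) (if i \in S then
    - (om i ^+ 2 * (1 + P (Z t)) * clamp (X i t)) else 0).
  move=> t0; rewrite /X /Y; case: ifPn => iS; last exact: is_derive_cst.
  by have := dZ t (i, true) t0; rewrite /field/= iS.
(* At a time where the weighted energy is at most 1/4, all coordinates are at most 1 in absolute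
   value, because [1 <= om i <= wt i] and the speed lies between 1 and 5/4. The clamps then act as
   the identity and the true equation holds at that time. *)
have ode tau : 0 <= tau -> energy S om X Y wt tau <= 4 * d ->
    (forall i, is_derive tau (1 : R) (X i) (Y i tau)) /\
    (forall i, is_derive tau (1 : R) (Y i) (- (om i ^+ 2 * stiffness S om X tau * X i tau))).
  move=> tau0 small.
  have W4 := le_trans small d_small.
  have l1 := speed_ge1 S om X tau; have l2 := speed_sqr S om X tau.
  have a2 := le_trans (stiffness_le S adm X Y tau) (lerD (lexx 1) W4).
  have l0 : 0 < speed S om X tau by exact: lt_le_trans l1.
  have ent i : i \in S -> wt i * en S om X Y i tau <= 4^-1.
    move=> iS; apply: le_trans W4.
    apply: (le_bigsum_mem (f := fun i => wt i * en S om X Y i tau)) iS => j.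
    by rewrite mulr_ge0 ?(le_trans ler01 (wt_ge1 _))//; exact: (en_ge0 S adm).
  have pot0 i : 0 <= speed S om X tau * om i * X i tau ^+ 2.
    by rewrite mulr_ge0 ?sqr_ge0// mulr_ge0// ltW.
  have kin0 i : 0 <= Y i tau ^+ 2 / (speed S om X tau * om i).
    by rewrite divr_ge0 ?sqr_ge0// mulr_ge0// ltW.
  have X1 i : i \in S -> `|X i tau| <= 1.
    move=> iS; have E := ent i iS.
    have : X i tau ^+ 2 <= 1.
      apply: (@le_trans _ _ (wt i * en S om X Y i tau)); last by lra.
      apply: (@le_trans _ _ (en S om X Y i tau)); last first.
        by rewrite ler_peMl//; exact: (en_ge0 S adm).
      apply: (@le_trans _ _ (speed S om X tau * om i * X i tau ^+ 2)); last by rewrite lerDl.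
      by rewrite ler_peMl ?sqr_ge0// mulr_ege1.
    by rewrite ler_norml; nra.
  have Y1 i : i \in S -> `|Y i tau| <= 1.
    move=> iS; have E := ent i iS.
    have H : wt i * (Y i tau ^+ 2 / (speed S om X tau * om i)) <= 4^-1.
      apply: le_trans E; rewrite ler_wpM2l ?(le_trans ler01 (wt_ge1 _))//.
      by rewrite lerDr.
    have H2 : om i * (Y i tau ^+ 2 / (speed S om X tau * om i)) <= 4^-1.
      by apply: le_trans H; rewrite ler_wpM2r.
    have H3 : om i * (Y i tau ^+ 2 / (speed S om X tau * om i)) * speed S om X tau = Y i tau ^+ 2.
      by field; rewrite !lt0r_neq0.
    have : Y i tau ^+ 2 <= 1 by rewrite -H3; nra.
    by rewrite ler_norml; nra.
  have PE : 1 + P (Z tau) = stiffness S om X tau.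
    congr (1 + _); rewrite /P big_seq [RHS]big_seq; apply: eq_bigr => k kS.
    by have := X1 k kS; rewrite /X kS => /clamp_id ->.
  split=> i.
    have := dX i tau tau0; case: ifPn => iS; first by rewrite clamp_id ?Y1.
    by rewrite /Y (negbTE iS).
  have := dY i tau tau0; case: ifPn => iS; first by rewrite PE clamp_id ?X1.
  by rewrite /X (negbTE iS) mulr0 oppr0.
have X00 i : i \in S -> X i 0 = X0 i by move=> iS; rewrite /X iS Z0.
have Y00 i : i \in S -> Y i 0 = Y0 i by move=> iS; rewrite /Y iS Z0.
have E0 : energy S om X Y wt 0 <= d.
  apply: le_trans initial; rewrite le_eqVlt; apply/orP; left; apply/eqP.
  rewrite /energy big_seq [RHS]big_seq; apply: eq_bigr => i iS.
  rewrite /en X00// Y00//; do 2 f_equal; rewrite /speed /stiffness; do 2 f_equal.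
  by rewrite big_seq [RHS]big_seq; apply: eq_bigr => k kS; rewrite X00.
(* The bootstrap closes because [energy_growth], with [rho := wt], improves the assumed factor 4 to
   10/3. *)
have small : forall t, 0 <= t <= T -> energy S om X Y wt t <= 4 * d.
  apply: (@bootstrap _ (energy S om X Y wt) T (4 * d) (10 / 3 * d)).
  - by rewrite ltr_pM2r//; lra.
  - by move: d0 E0; lra.
  - move=> t /andP[t0 _].
    have cX i : X i s @[s --> t] --> X i t.
      by apply/differentiable_continuous/derivable1_diffP; have [] := dX i t t0.
    have cY i : Y i s @[s --> t] --> Y i t.
      by apply/differentiable_continuous/derivable1_diffP; have [] := dY i t t0.
    have csq (f : R -> R) : f s @[s --> t] --> f t -> f s ^+ 2 @[s --> t] --> f t ^+ 2.
      by move=> cf; rewrite expr2; under eq_fun do rewrite expr2; exact: cvgM.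
    have cs : speed S om X s @[s --> t] --> speed S om X t.
      apply: (@continuous_comp _ _ _ (stiffness S om X) Num.sqrt); last exact: sqrt_continuous.
      apply: cvgD; first exact: cvg_cst.
      by apply: cvg_bigsum => k; apply: cvgM; [exact: cvg_cst|exact/csq/cX].
    apply: cvg_bigsum => k; apply: cvgM; first exact: cvg_cst.
    have cso : speed S om X s * om k @[s --> t] --> speed S om X t * om k.
      by apply: cvgM => //; exact: cvg_cst.
    apply: cvgD; first by apply: cvgM; [exact: cso|exact/csq/cX].
    apply: cvgM; first exact/csq/cY.
    apply: cvgV => //.
    by rewrite lt0r_neq0// mulr_gt0// (lt_le_trans ltr01 (speed_ge1 _ _ _ _)).
  - move=> t /andP[t0 tT] Wt.
    have dT' : 43 * d ^+ 2 * t <= 2^-1.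
      by apply: le_trans dT; rewrite ler_wpM2l// mulr_ge0 ?sqr_ge0.
    apply: le_trans (energy_growth adm _ _ Wt d_small _ _ dT' _) _.
    + by move=> i s sI; case: (ode s _ (Wt s sI)) => //; case/andP: sI.
    + by move=> i s sI; case: (ode s _ (Wt s sI)) => //; case/andP: sI.
    + by move=> i; exact: le_trans ler01 (wt_ge1 i).
    + by case: adm.
    + by rewrite t0 lexx.
    + by rewrite ler_wpM2l// divr_ge0.
exists X, Y; split => //.
- by move=> i iS; rewrite X00// Y00.
- by move=> i t iS; rewrite /X /Y (negbTE iS).
- move=> i t tT; have /andP[t0 _] := tT.
  by case: (ode t t0 (small t tT)).
- move=> i t tT; have /andP[t0 _] := tT.
  by case: (ode t t0 (small t tT)).
Qed.

End Galerkin.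

(** * Stability *)

Section UnorderedSums.
Variables (R : realType) (I : eqType).
Implicit Types (f g : I -> R) (l : R) (S : seq I).

(** For a nonnegative family this is the real counterpart of [esum]: [l] is the supremum of the sums
    over duplicate-free lists. *)
Definition is_sum f l : Prop :=
  (forall S, uniq S -> \sum_(i <- S) f i <= l) /\
  (forall e : R, 0 < e -> exists2 S, uniq S & l - e <= \sum_(i <- S) f i).

Lemma uniq_sum_le S S' f : uniq S -> {subset S <= S'} -> (forall i, 0 <= f i) ->
  \sum_(i <- S) f i <= \sum_(i <- S') f i.
Proof.
move=> + + f0; elim: S S' => [|x S ih] S' /=; first by rewrite big_nil sumr_ge0.
move=> /andP[xS uS] sub; have xS' : x \in S' by apply: sub; rewrite mem_head.
rewrite big_cons (big_rem x xS')/= lerD2l; apply: ih => // y yS.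
apply: rem_mem; first by apply: contraNneq xS => <-.
by apply: sub; rewrite in_cons yS orbT.
Qed.

Lemma sum_le_support S S' f : uniq S -> (forall i, 0 <= f i) ->
  (forall i, i \notin S' -> f i = 0) -> \sum_(i <- S) f i <= \sum_(i <- S') f i.
Proof.
move=> uS f0 fS'; have -> : \sum_(i <- S) f i = \sum_(i <- [seq x <- S | x \in S']) f i.
  rewrite big_filter [RHS]big_mkcond; apply: eq_bigr => i _.
  by case: ifPn => // /fS' ->.
apply: uniq_sum_le => //; first exact: filter_uniq.
by move=> i; rewrite mem_filter => /andP[].
Qed.

Lemma sum_eq_support S S' f : uniq S -> uniq S' -> {subset S' <= S} ->
  (forall i, 0 <= f i) -> (forall i, i \notin S' -> f i = 0) ->
  \sum_(i <- S) f i = \sum_(i <- S') f i.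
Proof.
move=> uS uS' S'S f0 fS'; apply/eqP; rewrite eq_le.
by rewrite sum_le_support//= uniq_sum_le.
Qed.

End UnorderedSums.

Definition galerkin_sol (R : realType) (I : eqType) (S : seq I) (om wt : I -> R)
    (T : R) (X Y : I -> R -> R) : Prop :=
  [/\ uniq S, forall i t, i \notin S -> X i t = 0 /\ Y i t = 0,
      forall i t, 0 <= t <= T -> is_derive t (1 : R) (X i) (Y i t),
      forall i t, 0 <= t <= T -> is_derive t (1 : R) (Y i)
        (- (om i ^+ 2 * stiffness S om X t * X i t)) &
      forall t, 0 <= t <= T -> energy S om X Y wt t <= 4^-1].

(** * A truncation compared with another solution, one derivative lower *)

Section Stability.
Variables (R : realType) (I : eqType) (S0 : seq I) (om wt : I -> R).
Hypothesis adm : admissible om wt.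
Variables (T : R) (X Y : I -> R -> R).
Hypothesis gal : galerkin_sol S0 om wt T X Y.
Variables (X' Y' : I -> R -> R) (a' : R -> R).
Implicit Types (t s : R) (S : seq I).
Hypothesis dX' : forall i, C1in T (X' i) (Y' i).
Hypothesis dY' : forall i, C1in T (Y' i) (fun t => - (om i ^+ 2 * a' t * X' i t)).
Hypothesis sum_a' : forall t, 0 <= t <= T ->
  is_sum (fun i => om i ^+ 2 * X' i t ^+ 2) (a' t - 1).
Variables (M th : R).
Hypothesis M1 : 1 <= M.
Hypothesis bound' : forall t S, 0 <= t <= T -> uniq S ->
  \sum_(i <- S) (om i ^+ 3 * X' i t ^+ 2 + Y' i t ^+ 2 / om i) <= M.

Let a := stiffness S0 om X.
(** With the factor [a t] in the potential part, the products of [X' - X] and [Y' - Y] cancel in the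
    derivative, up to the source that contains [a' - a]. *)
Let D S t := \sum_(i <- S) (om i * a t * (X' i t - X i t) ^+ 2
                            + (Y' i t - Y i t) ^+ 2 / om i).
Hypothesis D0 : forall S, uniq S -> D S 0 <= th.

Let om1 i : 1 <= om i. Proof. by case: adm. Qed.
Let om_gt0 i : 0 < om i. Proof. exact: lt_le_trans (om1 i). Qed.
Let wt2 i : om i ^+ 2 <= wt i. Proof. by case: adm. Qed.
Let wt_ge1 i : 1 <= wt i.
Proof. by apply: le_trans (wt2 i); rewrite exprn_ege1. Qed.
Let E := en S0 om X Y.
Let a1 t : 1 <= a t. Proof. exact: stiffness_ge1. Qed.
Let a0 t : 0 < a t. Proof. exact: lt_le_trans (a1 t). Qed.

Let small t : 0 <= t <= T -> energy S0 om X Y wt t <= 4^-1.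
Proof. by case: gal => _ _ _ _; apply. Qed.

Lemma galerkin_stiffness_le t : 0 <= t <= T -> stiffness S0 om X t <= 5 / 4.
Proof. by move=> tT; apply: le_trans (stiffness_le S0 adm X Y t) _; have := small tT; lra. Qed.

Let term_ge0 i t : 0 <= om i ^+ 3 * X i t ^+ 2 + Y i t ^+ 2 / om i.
Proof.
by rewrite addr_ge0 ?divr_ge0 ?sqr_ge0 ?(ltW (om_gt0 i))// mulr_ge0 ?sqr_ge0 ?exprn_ge0 ?(ltW (om_gt0 i)).
Qed.

(** This is the hypothesis [bound'] with [M = 1], which lets a truncation also play the part of the
    other solution. *)
Lemma galerkin_bound t S : 0 <= t <= T -> uniq S ->
  \sum_(i <- S) (om i ^+ 3 * X i t ^+ 2 + Y i t ^+ 2 / om i) <= 1.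
Proof.
move=> tT uS; apply: (@le_trans _ _ (\sum_(i <- S0) (om i ^+ 3 * X i t ^+ 2 + Y i t ^+ 2 / om i))).
  apply: sum_le_support => // i iS; have [_ + _ _ _] := gal.
  by move=> /(_ i t iS) [-> ->]; rewrite expr0n/= !mulr0 mul0r addr0.
suff H i : om i ^+ 3 * X i t ^+ 2 + Y i t ^+ 2 / om i <= 5 / 4 * (wt i * E i t).
  apply: le_trans (ler_sum _ (fun i _ => H i)) _.
  by rewrite -mulr_sumr; have := small tT; rewrite /energy -/E; lra.
have s1 := speed_ge1 S0 om X t; have s2 := speed_sqr S0 om X t; have s54 := galerkin_stiffness_le tT.
set sp := speed S0 om X t in s1 s2 *.
have sp0 : 0 < sp by exact: lt_le_trans s1.
have sp54 : sp <= 5 / 4 by rewrite -s2 in s54; nra.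
set q := Y i t ^+ 2 / om i; have q0 : 0 <= q by rewrite divr_ge0 ?sqr_ge0 ?ltW.
set p := om i * X i t ^+ 2; have p0 : 0 <= p by rewrite mulr_ge0 ?sqr_ge0 ?ltW.
have enE : E i t = sp * p + q / sp.
  by rewrite /E /en /mode_en -/sp /p /q; field; rewrite !lt0r_neq0.
have qsp : q <= 5 / 4 * (q / sp).
  rewrite mulrA ler_pdivlMr//; nra.
have -> : om i ^+ 3 * X i t ^+ 2 = om i ^+ 2 * p by rewrite /p; ring.
rewrite enE; have wi := wt_ge1 i; have w2 := wt2 i.
have H1 : om i ^+ 2 * p <= wt i * (sp * p).
  apply: ler_pM => //; first exact: sqr_ge0.
  by rewrite ler_peMl.
have H2 : 5 / 4 * (q / sp) <= wt i * (5 / 4 * (q / sp)).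
  by rewrite ler_peMl// (le_trans q0).
have := mulr_ge0 (le_trans ler01 wi) (mulr_ge0 (ltW sp0) p0).
lra.
Qed.

Let b t := a' t - a t.
Let da t := stiffness' S0 om X Y t.

Let da_le t : 0 <= t <= T -> `|da t| <= 4^-1.
Proof. by move=> tT; apply: le_trans (small tT); exact: (stiffness'_le S0 adm). Qed.

Let dX i t : 0 <= t <= T -> is_derive t (1 : R) (X i) (Y i t).
Proof. by case: gal => _ _ + _ _; apply. Qed.

Let dY i t : 0 <= t <= T -> is_derive t (1 : R) (Y i) (- (om i ^+ 2 * a t * X i t)).
Proof. by case: gal => _ _ _ + _; apply. Qed.

Let C1in_D S : C1in T (D S) (fun t => \sum_(i <- S)
  (om i * da t * (X' i t - X i t) ^+ 2
   - 2 * (b t * (om i * X' i t * (Y' i t - Y i t))))).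
Proof.
apply: C1in_sum => i.
have Ca : C1in T a da.
  by apply: is_derive_C1in => t tT; apply: is_derive_stiffness => j; exact: dX.
have Cw := C1inB (dX' i) (is_derive_C1in (fun t => @dX i t)).
have Cz := C1inB (dY' i) (is_derive_C1in (fun t => @dY i t)).
have C1 := C1inM (C1inZ (om i) Ca) (C1inM Cw Cw).
have C2 := C1inZ (om i)^-1 (C1inM Cz Cz).
apply: eq_C1in (C1inD C1 C2) => [t|t _] /=; first by rewrite !expr2; ring.
by rewrite /b; field; rewrite lt0r_neq0.
Qed.

Let pot_le t S m : 0 <= t <= T -> D S t <= m -> \sum_(i <- S) om i * (X' i t - X i t) ^+ 2 <= m.
Proof.
move=> tT; apply: le_trans; apply: ler_sum => i _.
have z0 : 0 <= (Y' i t - Y i t) ^+ 2 / om i by rewrite divr_ge0 ?sqr_ge0 ?ltW.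
have := mulr_ge0 (mulr_ge0 (ltW (om_gt0 i)) (sqr_ge0 (X' i t - X i t))) (ltW (a0 t)).
have := ler_wpM2l (mulr_ge0 (ltW (om_gt0 i)) (sqr_ge0 (X' i t - X i t))) (a1 t).
nra.
Qed.

Let kin_le t S m : 0 <= t <= T -> D S t <= m -> \sum_(i <- S) (Y' i t - Y i t) ^+ 2 / om i <= m.
Proof.
move=> tT; apply: le_trans; apply: ler_sum => i _.
by rewrite lerDr mulr_ge0 ?sqr_ge0// mulr_ge0// ltW.
Qed.

Let om_pow i : Num.sqrt (om i) ^+ 2 = om i. Proof. by rewrite sqr_sqrtr// ltW. Qed.

Let sqrt_om_gt0 i : 0 < Num.sqrt (om i). Proof. by rewrite sqrtr_gt0. Qed.

Let bound3' t S : 0 <= t <= T -> uniq S -> \sum_(i <- S) om i ^+ 3 * X' i t ^+ 2 <= M.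
Proof.
move=> tT uS; apply: le_trans (bound' tT uS); apply: ler_sum => i _.
by rewrite lerDl divr_ge0 ?sqr_ge0 ?ltW.
Qed.

Let bound3 t S : 0 <= t <= T -> uniq S -> \sum_(i <- S) om i ^+ 3 * X i t ^+ 2 <= 1.
Proof.
move=> tT uS; apply: le_trans (galerkin_bound tT uS); apply: ler_sum => i _.
by rewrite lerDl divr_ge0 ?sqr_ge0 ?ltW.
Qed.

(* The stiffness gap [b] is an infinite sum, so it is controlled by the supremum of
   [D S] over all finite [S], not by [D S] itself; [stability] therefore iterates
   this bound instead of applying Gronwall's lemma to a single [D S]. *)
Let stiffness_dist t m : 0 <= t <= T -> 0 <= m ->
  (forall S, uniq S -> D S t <= m) -> b t ^+ 2 <= 4 * M * m.
Proof.
move=> tT m0 Dm; have K0 : 0 <= 4 * M * m by rewrite mulr_ge0// mulr_ge0// (le_trans ler01).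
suff H e : 0 < e -> `|b t| <= Num.sqrt (4 * M * m) + e.
  have : `|b t| <= Num.sqrt (4 * M * m) by apply/ler_addgt0Pr.
  rewrite -(@ler_pXn2r _ 2) ?nnegrE ?sqrtr_ge0// sqr_sqrtr//.
  by rewrite real_normK ?num_real.
move=> e0; have [sle sge] := sum_a' tT; have [S1 uS1 S1ge] := sge e e0.
(* This list carries the whole stiffness of the truncation and all but [e] of the other one. *)
pose S := undup (S1 ++ S0); have uS : uniq S by exact: undup_uniq.
have uS0 : uniq S0 by case: gal.
have [_ X0 _ _ _] := gal.
have sumX : \sum_(i <- S) om i ^+ 2 * X i t ^+ 2 = a t - 1.
  rewrite /a /stiffness addrC addKr; apply: sum_eq_support => //.
  - by move=> i iS; rewrite mem_undup mem_cat iS orbT.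
  - by move=> i; rewrite mulr_ge0 ?sqr_ge0.
  - by move=> i /(X0 i t)[-> _]; rewrite expr0n mulr0.
have le1 : \sum_(i <- S) om i ^+ 2 * X' i t ^+ 2 <= a' t - 1 by exact: sle.
have le2 : a' t - 1 - e <= \sum_(i <- S) om i ^+ 2 * X' i t ^+ 2.
  apply: le_trans S1ge _; apply: uniq_sum_le => // i.
    by rewrite mem_undup mem_cat => ->.
  by rewrite mulr_ge0 ?sqr_ge0.
set B := \sum_(i <- S) (om i ^+ 2 * (X' i t - X i t) * (X' i t + X i t)).
have BE : B = \sum_(i <- S) om i ^+ 2 * X' i t ^+ 2 - (a t - 1).
  by rewrite -sumX -sumrB; apply: eq_bigr => i _; ring.
have B2 : B ^+ 2 <= 4 * M * m.
  (* Of the factor [om i ^+ 2], the power 1/2 goes to the difference, which [D] controls, and the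
     power 3/2 to the sum, which the bounds [M] and 1 control. *)
  have BE2 : B = \sum_(i <- S) (Num.sqrt (om i) * (X' i t - X i t)) *
     (om i * Num.sqrt (om i) * (X' i t + X i t)).
    apply: eq_bigr => i _; rewrite [RHS](_ : _ =
      Num.sqrt (om i) ^+ 2 * om i * (X' i t - X i t) * (X' i t + X i t)); last by ring.
    by rewrite om_pow; ring.
  rewrite BE2; apply: le_trans (cauchy_schwarz _ _ _) _.
  rewrite mulrC; apply: ler_pM.
  - by apply: sumr_ge0 => i _; exact: sqr_ge0.
  - by apply: sumr_ge0 => i _; exact: sqr_ge0.
  - have H i : (om i * Num.sqrt (om i) * (X' i t + X i t)) ^+ 2 <=
        2 * (om i ^+ 3 * X' i t ^+ 2) + 2 * (om i ^+ 3 * X i t ^+ 2).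
      have -> : (om i * Num.sqrt (om i) * (X' i t + X i t)) ^+ 2 =
          om i ^+ 3 * (X' i t + X i t) ^+ 2.
        by rewrite !exprMn om_pow; ring.
      have := mulr_ge0 (exprn_ge0 3 (ltW (om_gt0 i))) (sqr_ge0 (X' i t - X i t)).
      lra.
    apply: le_trans (ler_sum _ (fun i _ => H i)) _.
    rewrite big_split/= -!mulr_sumr.
    by have := bound3' tT uS; have := bound3 tT uS; move: M1; lra.
  - rewrite (eq_bigr (fun i => om i * (X' i t - X i t) ^+ 2)); last first.
      by move=> i _; rewrite exprMn om_pow.
    by apply: pot_le => //; exact: Dm.
have Bs : `|B| <= Num.sqrt (4 * M * m).
  by rewrite -sqrtr_sqr; apply: ler_wsqrtr.
move: Bs; rewrite /b BE !ler_norml; lra.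
Qed.

(** The source is split by Cauchy-Schwarz into [om^(3/2) X'], bounded through [M], and
    [om^(-1/2) (Y' - Y)], bounded through [D]: here the extra derivative of the solutions is spent.
    The constant is 1/4 + 4 M + M, at most 6 M. *)
Let D_step (t : R) (S : seq I) m : 0 <= t <= T -> uniq S -> (forall S, uniq S -> D S t <= m) ->
  \sum_(i <- S) (om i * da t * (X' i t - X i t) ^+ 2
     - 2 * (b t * (om i * X' i t * (Y' i t - Y i t)))) <= 6 * M * m.
Proof.
move=> tT uS Dm; have DS := Dm _ uS.
have m0 : 0 <= m by apply: le_trans (Dm [::] isT); rewrite /D big_nil.
rewrite sumrB -!mulr_sumr; set s := \sum_(i <- S) (om i * X' i t * _).
have s2 : s ^+ 2 <= M * m.
  have -> : s = \sum_(i <- S) (om i * Num.sqrt (om i) * X' i t) *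
     ((Y' i t - Y i t) / Num.sqrt (om i)).
    by apply: eq_bigr => i _; field; rewrite lt0r_neq0.
  apply: le_trans (cauchy_schwarz _ _ _) _.
  apply: ler_pM.
  - by apply: sumr_ge0 => i _; exact: sqr_ge0.
  - by apply: sumr_ge0 => i _; exact: sqr_ge0.
  - apply: le_trans (bound3' tT uS); apply: ler_sum => i _.
    by rewrite !exprMn om_pow le_eqVlt; apply/orP; left; apply/eqP; ring.
  - apply: le_trans (kin_le tT DS); apply: ler_sum => i _.
    by rewrite exprMn exprVn om_pow.
have b2 := stiffness_dist tT m0 Dm.
have p0 : 0 <= \sum_(i <- S) om i * (X' i t - X i t) ^+ 2.
  by apply: sumr_ge0 => i _; rewrite mulr_ge0 ?sqr_ge0// ltW.
have pm := pot_le tT DS.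
have -> : \sum_(i <- S) om i * da t * (X' i t - X i t) ^+ 2 =
    da t * \sum_(i <- S) om i * (X' i t - X i t) ^+ 2.
  by rewrite mulr_sumr; apply: eq_bigr => i _; ring.
have : da t * (\sum_(i <- S) om i * (X' i t - X i t) ^+ 2) <= 4^-1 * m.
  apply: le_trans (ler_norm _) _; rewrite normrM; apply: ler_pM => //; first exact: da_le.
  by rewrite ger0_norm.
have := sqr_ge0 (b t + s); have := mulr_ge0 (le_trans ler01 M1) m0.
have : m <= M * m by rewrite ler_peMl.
nra.
Qed.

(** Starts the iteration of [stability]: it uses the size of the two solutions and nothing about
    their closeness. *)
Let D_apriori t S : 0 <= t <= T -> uniq S -> D S t <= 6 * M.
Proof.
move=> tT uS; have /= b1 := bound' tT uS; have b2 := galerkin_bound tT uS.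
suff H i : om i * a t * (X' i t - X i t) ^+ 2 + (Y' i t - Y i t) ^+ 2 / om i <=
    3 * (om i ^+ 3 * X' i t ^+ 2 + Y' i t ^+ 2 / om i) +
    3 * (om i ^+ 3 * X i t ^+ 2 + Y i t ^+ 2 / om i).
  apply: le_trans (ler_sum _ (fun i _ => H i)) _.
  by rewrite big_split/= -!mulr_sumr; move: M1; lra.
have o1 := om1 i; have aa := galerkin_stiffness_le tT; have v0 : 0 <= (om i)^-1 by rewrite invr_ge0 ltW.
have H1 : (Y' i t - Y i t) ^+ 2 / om i <= 2 * (Y' i t ^+ 2 / om i) + 2 * (Y i t ^+ 2 / om i).
  by have := mulr_ge0 v0 (sqr_ge0 (Y' i t + Y i t)); nra.
have y0 x : 0 <= x ^+ 2 / om i by rewrite divr_ge0 ?sqr_ge0 ?ltW.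
have H2 : om i * a t * (X' i t - X i t) ^+ 2 <= 5 / 4 * (om i ^+ 3 * (X' i t - X i t) ^+ 2).
  rewrite [leRHS]mulrA; apply: ler_wpM2r; first exact: sqr_ge0.
  rewrite mulrC; apply: ler_pM => //; [exact: ltW|exact: ltW|].
  by rewrite ler_eXnr.
have := mulr_ge0 (exprn_ge0 3 (ltW (om_gt0 i))) (sqr_ge0 (X' i t + X i t)).
have o3 x : 0 <= om i ^+ 3 * x ^+ 2 by rewrite mulr_ge0 ?sqr_ge0 ?exprn_ge0 ?(ltW (om_gt0 i)).
have := y0 (Y' i t); have := y0 (Y i t); have := o3 (X i t); have := o3 (X' i t).
lra.
Qed.

Lemma stability t S : 0 <= t <= T -> uniq S -> D S t <= 2 * th * expR (12 * M * t).
Proof.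
have th0 : 0 <= th by apply: le_trans (@D0 [::] isT); rewrite /D big_nil.
have M0 : 0 < M by exact: lt_le_trans M1.
(* Integrating [6 * M] against the exponential of rate [12 * M] gains 1/2, so each pass halves the
   excess [6 * M], while [2 * th] covers the initial value. *)
have iter n : forall S t, uniq S -> 0 <= t <= T ->
    D S t <= (2 * th + 6 * M * 2^-1 ^+ n) * expR (12 * M * t).
  elim: n => [|n ih] {}S {}t uS tT; have /andP[t0 _] := tT.
    apply: le_trans (D_apriori tT uS) _; rewrite expr0 mulr1.
    have e1 : 1 <= expR (12 * M * t).
      by rewrite -expR0 ler_expR mulr_ge0// mulr_ge0// ltW.
    have M6 : 0 <= 6 * M by rewrite mulr_ge0// ltW.
    by rewrite -[leLHS]mulr1; apply: ler_pM => //; lra.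
  set c := 12 * M; set A := 2 * th + _.
  apply: (C1in_le (C1in_D S) (C1inZ A (C1in_expR T c)) _ _ tT).
    rewrite mulr0 expR0 mulr1; apply: le_trans (D0 uS) _.
    have : 0 <= 6 * M * 2^-1 ^+ n.+1.
      by rewrite mulr_ge0 ?exprn_ge0 ?invr_ge0// mulr_ge0// ltW.
    rewrite /A; lra.
  move=> s /andP[/ltW s0 /ltW sT]; have sI : 0 <= s <= T by rewrite s0.
  have := D_step sI uS (fun S' uS' => ih S' s uS' sI).
  move=> /le_trans; apply; rewrite mulrA [leRHS]mulrA.
  apply: ler_wpM2r; first exact: expR_ge0.
  have := mulr_ge0 (ltW M0) th0.
  by rewrite /A /c exprS; lra.
move=> tT uS; rewrite -subr_le0.
apply: (@geometric_squeeze _ _ (6 * M * expR (12 * M * t)) 2^-1).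
  by rewrite ger0_norm ?invr_ge0// invf_lt1// ltr1n.
by move=> n; have := iter n S t uS tT; lra.
Qed.

Lemma stability_mode i t : 0 <= t <= T ->
  (X' i t - X i t) ^+ 2 <= 2 * th * expR (12 * M * t) /\
  (Y' i t - Y i t) ^+ 2 <= om i * (2 * th * expR (12 * M * t)).
Proof.
move=> tT; have H := stability tT (isT : uniq [:: i]); split.
  have := pot_le tT H; rewrite big_seq1; apply: le_trans.
  by rewrite ler_peMl ?sqr_ge0.
by have := kin_le tT H; rewrite big_seq1 ler_pdivrMr// mulrC.
Qed.

Lemma stability_stiffness t : 0 <= t <= T ->
  (a' t - a t) ^+ 2 <= 4 * M * (2 * th * expR (12 * M * t)).
Proof.
move=> tT; apply: stiffness_dist => //; last by move=> S; exact: stability.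
by have := stability tT (isT : uniq [::]); rewrite /D big_nil.
Qed.

End Stability.

(** * The infinite system of modes *)

Section LimitOfDerivatives.
Variable R : realType.
Implicit Types (T t s e : R).

(** Nothing is known of [f] outside [[0, T]]. The extension [F] integrates [g] frozen beyond the
    endpoints, so its derivatives at 0 and [T] are two-sided; it agrees with [f] because [fN n - F]
    has derivative at most [r n]. *)
Lemma limit_is_derive T (fN gN : nat -> R -> R) (f g : R -> R) (r : nat -> R) :
  0 <= T ->
  (forall n t, 0 <= t <= T -> is_derive t (1 : R) (fN n) (gN n t)) ->
  (forall n t, 0 <= t <= T -> {for t, continuous (gN n)}) ->
  (forall n t, 0 <= t <= T -> `|fN n t - f t| <= r n) ->
  (forall n t, 0 <= t <= T -> `|gN n t - g t| <= r n) ->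
  (forall e, 0 < e -> exists n, r n <= e) ->
  exists F : R -> R, forall t, 0 <= t <= T -> F t = f t /\ is_derive t (1 : R) F (g t).
Proof.
move=> T0 dfN cgN rf rg r0.
pose pt s := Num.max 0 (Num.min T s).
have ptI s : 0 <= pt s <= T by rewrite /pt le_max lexx/= ge_max T0 ge_min lexx.
have ptid s : 0 <= s <= T -> pt s = s.
  by move=> /andP[s0 sT]; rewrite /pt (min_idPr sT) (max_idPr s0).
have cpt : continuous pt.
  move=> s; apply: (@continuous_max R _ (fun=> 0) (fun y => Num.min T y)).
    exact: cvg_cst.
  by apply: (@continuous_min R _ (fun=> T) id); [exact: cvg_cst|exact: cvg_id].
have cg : continuous (fun s => g (pt s)).
  move=> t; apply/cvgrPdist_le => /= e e0.
  have e3 : 0 < e / 3 by rewrite divr_gt0.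
  have [n rn] := r0 _ e3.
  have /cvgrPdist_le /(_ _ e3) : gN n (pt s) @[s --> t] --> gN n (pt t).
    by apply: (@continuous_comp _ _ _ pt (gN n)); [exact: cpt|exact: cgN].
  apply: filterS => s.
  have := le_trans (rg n _ (ptI s)) rn; have := le_trans (rg n _ (ptI t)) rn.
  by rewrite !ler_norml; lra.
have [G G0 dG] := continuous_primitive cg.
have dG' t : 0 <= t <= T -> is_derive t (1 : R) G (g t).
  move=> tT; rewrite -{2}(ptid t tT); apply: dG.
  by case/andP: tT => t0 _; apply: lt_le_trans t0; rewrite ltrN10.
exists (fun s => f 0 + G s) => t tT; have /andP[t0 tT'] := tT; split; last first.
  have dc := is_derive_cst (f 0) t (1 : R).
  by have := is_deriveD dc (dG' t tT); rewrite add0r.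
apply/eqP; rewrite -subr_eq0 -normr_le0; apply/ler_addgt0Pr => e e0; rewrite add0r.
have T2 : 0 < 2 + T by rewrite ltr_pwDl.
have [n rn] := r0 _ (divr_gt0 e0 T2).
have rn0 : 0 <= r n by apply: le_trans (rf n t tT).
have rnT : r n * t <= r n * T by rewrite ler_wpM2l.
have z0 : 0 <= (0 : R) <= T by rewrite lexx T0.
have C1 := C1inB (is_derive_C1in (fun s => @dfN n s)) (is_derive_C1in (fun s => @dG' s)).
have C2 : C1in T (fun s => r n * s) (fun=> r n).
  by apply: is_derive_C1in => s _; apply: is_derive_eq; rewrite /GRing.scale/= mulr1.
have C3 := C1inD C2 (C1in_cst T (fN n 0)).
have C4 := C1inB (C1in_cst T (fN n 0)) C2.
have u1 : fN n t - G t <= r n * t + fN n 0.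
  apply: (C1in_le C1 C3) => //; first by rewrite G0 mulr0 subr0 add0r.
  move=> s /andP[/ltW s0 /ltW sT]; rewrite addr0; apply: le_trans (rg n s _); first exact: ler_norm.
  by rewrite s0.
have u2 : fN n 0 - r n * t <= fN n t - G t.
  apply: (C1in_le C4 C1) => //; first by rewrite G0 mulr0.
  move=> s /andP[/ltW s0 /ltW sT]; rewrite sub0r lerNl; apply: le_trans (rg n s _).
    by rewrite -normrN ler_norm.
  by rewrite s0.
have := rf n t tT; have := rf n 0 z0.
have rne : r n * (2 + T) <= e by rewrite -ler_pdivlMr.
by move: u1 u2; rewrite !ler_norml; lra.
Qed.

End LimitOfDerivatives.

Section Existence.
Variables (R : realType) (I : countType) (om wt : I -> R).
Hypothesis adm : admissible om wt.
Variables (X0 Y0 : I -> R) (T eta : R).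
Hypotheses (T0 : 0 <= T) (eta0 : 0 < eta) (eta_small : 8 * eta <= 4^-1)
  (etaT : 172 * eta ^+ 2 * T <= 2^-1).
Implicit Types (t s e M : R) (S : seq I) (rho : I -> R).

Let om1 i : 1 <= om i. Proof. by case: adm. Qed.
Let om_gt0 i : 0 < om i. Proof. exact: lt_le_trans (om1 i). Qed.
Let wt2 i : om i ^+ 2 <= wt i. Proof. by case: adm. Qed.
Let wt_ge1 i : 1 <= wt i.
Proof. by apply: le_trans (wt2 i); rewrite exprn_ege1. Qed.
Let om_wt i : om i <= wt i.
Proof. by apply: le_trans (wt2 i); rewrite expr2 ler_peMl// ltW. Qed.

(** This is [mode_en] at speed 1, a norm independent of time; while the speed lies between 1 and 5/4
    the two differ by a factor of at most 5/4. *)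
Definition mode_sq (X Y : I -> R) i := om i * X i ^+ 2 + Y i ^+ 2 / om i.

Let mode_sq_ge0 X Y i : 0 <= mode_sq X Y i.
Proof.
by apply: addr_ge0; [rewrite mulr_ge0 ?sqr_ge0// ltW|rewrite divr_ge0 ?sqr_ge0// ltW].
Qed.

Let g i := wt i * mode_sq X0 Y0 i.
Hypothesis data_le : forall S, uniq S -> \sum_(i <- S) g i <= eta.

Let g_ge0 i : 0 <= g i.
Proof. by rewrite mulr_ge0// (le_trans ler01). Qed.

Let SN n : seq I := undup (pmap unpickle (iota 0 n)).

Let uniq_SN n : uniq (SN n). Proof. exact: undup_uniq. Qed.

Let mem_SN i n : (pickle i < n)%N -> i \in SN n.
Proof.
move=> ni; rewrite mem_undup mem_pmap -[X in X \in _](pickleK i).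
by apply: map_f; rewrite mem_iota.
Qed.

Let SN_mono n m : (n <= m)%N -> {subset SN n <= SN m}.
Proof.
move=> nm i; rewrite !mem_undup !mem_pmap => /mapP[k].
rewrite mem_iota add0n => /= kn ->; apply: map_f.
by rewrite mem_iota add0n/= (leq_trans kn).
Qed.

Let SN_exhaust S : exists N, forall n, (N <= n)%N -> {subset S <= SN n}.
Proof.
elim: S => [|i S [N HN]]; first by exists 0%N.
exists (maxn N (pickle i).+1) => n; rewrite geq_max => /andP[Nn ni] j.
by rewrite in_cons => /predU1P[->|]; [exact: mem_SN|exact: HN].
Qed.

Let total := sup [set r | exists2 S, uniq S & r = \sum_(i <- S) g i].

Let has_sup_total : has_sup [set r | exists2 S, uniq S & r = \sum_(i <- S) g i].
Proof.
split; first by exists (\sum_(i <- [::]) g i), [::].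
by exists eta => _ [S uS ->]; exact: data_le.
Qed.

Let total_ge S : uniq S -> \sum_(i <- S) g i <= total.
Proof. by move=> uS; apply: ub_le_sup; [case: has_sup_total|exists S]. Qed.

(** Weighted size of the data outside the n-th truncation. It bounds the initial distance in
    [stability], hence governs all convergence rates. *)
Let tail n := total - \sum_(i <- SN n) g i.

Let tail_ge n S : uniq S -> \sum_(i <- S | i \notin SN n) g i <= tail n.
Proof.
move=> uS; rewrite -big_filter lerBrDr -big_cat; apply: total_ge.
rewrite cat_uniq filter_uniq// uniq_SN andbT; apply/hasPn => i iS.
by rewrite mem_filter iS.
Qed.

Let tail_ge0 n : 0 <= tail n.
Proof. by rewrite subr_ge0 total_ge. Qed.

Let tail_small e : 0 < e -> exists N, forall n, (N <= n)%N -> tail n <= e.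
Proof.
move=> e0; have [_ [S uS ->] H] := sup_adherent e0 has_sup_total.
have [N HN] := SN_exhaust S; exists N => n Nn.
have := uniq_sum_le uS (HN n Nn) g_ge0; rewrite /tail; move: H; rewrite -/total; lra.
Qed.

Let lam0 S := Num.sqrt (1 + \sum_(k <- S) om k ^+ 2 * X0 k ^+ 2).

Let lam0_bounds S : uniq S -> 1 <= lam0 S <= 5 / 4.
Proof.
move=> uS; have p0 : 0 <= \sum_(k <- S) om k ^+ 2 * X0 k ^+ 2.
  by apply: sumr_ge0 => i _; rewrite mulr_ge0 ?sqr_ge0.
have : \sum_(k <- S) om k ^+ 2 * X0 k ^+ 2 <= eta.
  apply: le_trans (data_le uS); apply: ler_sum => i _.
  rewrite expr2 -mulrA; apply: ler_pM => //; rewrite ?(ltW (om_gt0 i))//.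
    by rewrite mulr_ge0 ?sqr_ge0// ltW.
  by rewrite lerDl divr_ge0 ?sqr_ge0// ltW.
move=> p1; rewrite -{1}sqrtr1 ler_wsqrtr ?lerDl//=.
have -> : 5 / 4 = Num.sqrt ((5 / 4) ^+ 2) :> R by rewrite sqrtr_sqr ger0_norm.
by apply: ler_wsqrtr; move: eta_small; lra.
Qed.

Let mode_en_le l x y i : 1 <= l <= 5 / 4 ->
  mode_en l (om i) x y <= 5 / 4 * (om i * x ^+ 2 + y ^+ 2 / om i).
Proof.
move=> /andP[l1 l2]; have l0 : 0 < l by exact: lt_le_trans l1.
have q0 : 0 <= y ^+ 2 / om i by rewrite divr_ge0 ?sqr_ge0// ltW.
have p0 : 0 <= om i * x ^+ 2 by rewrite mulr_ge0 ?sqr_ge0// ltW.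
have -> : mode_en l (om i) x y = l * (om i * x ^+ 2) + y ^+ 2 / om i / l.
  by rewrite /mode_en; field; rewrite !lt0r_neq0.
have : y ^+ 2 / om i / l <= y ^+ 2 / om i by rewrite ler_pdivrMr// ler_peMr.
nra.
Qed.

Let mode_en_ge l x y i : 1 <= l <= 5 / 4 ->
  om i * x ^+ 2 + y ^+ 2 / om i <= 5 / 4 * mode_en l (om i) x y.
Proof.
move=> /andP[l1 l2]; have l0 : 0 < l by exact: lt_le_trans l1.
have q0 : 0 <= y ^+ 2 / om i by rewrite divr_ge0 ?sqr_ge0// ltW.
have p0 : 0 <= om i * x ^+ 2 by rewrite mulr_ge0 ?sqr_ge0// ltW.
have -> : mode_en l (om i) x y = l * (om i * x ^+ 2) + y ^+ 2 / om i / l.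
  by rewrite /mode_en; field; rewrite !lt0r_neq0.
have : y ^+ 2 / om i <= 5 / 4 * (y ^+ 2 / om i / l).
  by rewrite mulrA ler_pdivlMr// mulrC ler_wpM2r.
nra.
Qed.

(** The truncations are built with [d := 2 * eta], which absorbs the factor 5/4 between [mode_sq]
    and [mode_en]; then 43 (2 eta)^2 = 172 eta^2. *)
Let d_small : 4 * (2 * eta) <= 4^-1. Proof. by move: eta_small; lra. Qed.

Let dT : 43 * (2 * eta) ^+ 2 * T <= 2^-1. Proof. by move: etaT; lra. Qed.

Let galN n : exists XY : (I -> R -> R) * (I -> R -> R),
  galerkin_sol (SN n) om wt T XY.1 XY.2 /\
  (forall i, XY.1 i 0 = (if i \in SN n then X0 i else 0) /\
             XY.2 i 0 = (if i \in SN n then Y0 i else 0)) /\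
  (forall t, 0 <= t <= T -> energy (SN n) om XY.1 XY.2 wt t <= 4 * (2 * eta)).
Proof.
have [||X [Y [XY0 XYS dX dY small]]] := @galerkin R I (SN n) om wt adm X0 Y0 (2 * eta) T _ d_small dT.
- by rewrite mulr_gt0.
- apply: (@le_trans _ _ (5 / 4 * \sum_(i <- SN n) g i)); last first.
    by have := data_le (uniq_SN n); move: eta0; lra.
  rewrite mulr_sumr; apply: ler_sum => i _; rewrite /g mulrCA ler_wpM2l//.
    exact: le_trans (wt_ge1 i).
  by apply: mode_en_le; exact: lam0_bounds.
exists (X, Y); split => /=; first by split => // t tT; exact: le_trans (small t tT) d_small.
split => // i; case: ifPn => iS; first exact: XY0.
exact: XYS.
Qed.

Let XN n := (sval (cid (galN n))).1.
Let YN n := (sval (cid (galN n))).2.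

Let galXY n : galerkin_sol (SN n) om wt T (XN n) (YN n).
Proof. by rewrite /XN /YN; case: cid => ? [? []]. Qed.

Let initXY n i : XN n i 0 = (if i \in SN n then X0 i else 0) /\
                 YN n i 0 = (if i \in SN n then Y0 i else 0).
Proof. by rewrite /XN /YN; case: cid => ? [? [+ ?]]; exact. Qed.

Let smallXY n t : 0 <= t <= T -> energy (SN n) om (XN n) (YN n) wt t <= 4 * (2 * eta).
Proof. by rewrite /XN /YN; case: cid => ? [? [? +]]; exact. Qed.

Let dXN n i t : 0 <= t <= T -> is_derive t (1 : R) (XN n i) (YN n i t).
Proof. by case: (galXY n) => _ _ + _ _; apply. Qed.

Let aN n t := stiffness (SN n) om (XN n) t.

Let dYN n i t : 0 <= t <= T -> is_derive t (1 : R) (YN n i) (- (om i ^+ 2 * aN n t * XN n i t)).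
Proof. by case: (galXY n) => _ _ _ + _; apply. Qed.

Let outXY n i t : i \notin SN n -> XN n i t = 0 /\ YN n i t = 0.
Proof. by case: (galXY n) => _ + _ _ _; apply. Qed.

Let aN_le n t : 0 <= t <= T -> aN n t <= 5 / 4.
Proof. exact: galerkin_stiffness_le (galXY n) t. Qed.

Let speedN n t : 0 <= t <= T -> 1 <= speed (SN n) om (XN n) t <= 5 / 4.
Proof.
move=> tT; rewrite speed_ge1/=; have := speed_sqr (SN n) om (XN n) t.
have := speed_ge1 (SN n) om (XN n) t; have := aN_le n tT; rewrite /aN; nra.
Qed.

(** From [stability] with [M = 1] and [th = 5 / 4 * tail n], the factor 5/2 being rounded up to
    3. *)
Let rate n := Num.sqrt (3 * expR (12 * T) * tail n).

Section Compare.
Variables (X' Y' : I -> R -> R) (a' : R -> R) (M : R).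
Hypothesis dX' : forall i, C1in T (X' i) (Y' i).
Hypothesis dY' : forall i, C1in T (Y' i) (fun t => - (om i ^+ 2 * a' t * X' i t)).
Hypothesis sum_a' : forall t, 0 <= t <= T ->
  is_sum (fun i => om i ^+ 2 * X' i t ^+ 2) (a' t - 1).
Hypothesis M1 : 1 <= M.
Hypothesis bound' : forall t S, 0 <= t <= T -> uniq S ->
  \sum_(i <- S) (om i ^+ 3 * X' i t ^+ 2 + Y' i t ^+ 2 / om i) <= M.
Variable n : nat.
Hypothesis init' : forall i,
  (X' i 0 - XN n i 0) ^+ 2 <= (if i \in SN n then 0 else X0 i ^+ 2) /\
  (Y' i 0 - YN n i 0) ^+ 2 <= (if i \in SN n then 0 else Y0 i ^+ 2).

Let D0 S : uniq S -> \sum_(i <- S) (om i * stiffness (SN n) om (XN n) 0 * (X' i 0 - XN n i 0) ^+ 2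
    + (Y' i 0 - YN n i 0) ^+ 2 / om i) <= 5 / 4 * tail n.
Proof.
move=> uS; have z0 : 0 <= (0 : R) <= T by rewrite lexx T0.
apply: (@le_trans _ _ (5 / 4 * \sum_(i <- S | i \notin SN n) g i)); last first.
  by rewrite ler_wpM2l ?tail_ge.
rewrite mulr_sumr [leRHS]big_mkcond; apply: ler_sum => i _.
have [x0 y0] := init' i.
have v0 : 0 <= (om i)^-1 by rewrite invr_ge0 ltW.
have H1 := ler_wpM2r v0 y0.
have a0 : 0 <= om i * aN n 0.
  by rewrite mulr_ge0 ?(ltW (om_gt0 i))// (le_trans ler01 (stiffness_ge1 _ _ _ _)).
have H2 := ler_wpM2l a0 x0.
apply: le_trans (lerD H2 H1) _; case: ifPn => iS /=; first by rewrite mulr0 mul0r addr0.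
rewrite /g /mode_sq.
have w1 := wt_ge1 i; have a2 := aN_le n z0.
have p0 : 0 <= om i * X0 i ^+ 2 by rewrite mulr_ge0 ?sqr_ge0// ltW.
have q0 : 0 <= Y0 i ^+ 2 / om i by rewrite divr_ge0 ?sqr_ge0// ltW.
have := ler_wpM2r p0 w1; have := ler_wpM2r q0 w1; have := ler_wpM2r p0 a2.
rewrite mulrAC; lra.
Qed.

(** Used twice: with a larger truncation, for the Cauchy property, and with any solution having the
    full data, for uniqueness. The hypothesis [init'] covers both. *)
Lemma compare_mode i t : 0 <= t <= T ->
  (X' i t - XN n i t) ^+ 2 <= 3 * expR (12 * M * T) * tail n /\
  (Y' i t - YN n i t) ^+ 2 <= om i * (3 * expR (12 * M * T) * tail n).
Proof.
move=> tT.
have [H1 H2] := stability_mode adm (galXY n) dX' dY' sum_a' M1 bound' D0 i tT.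
have /andP[t0 tT'] := tT.
have HE : 2 * (5 / 4 * tail n) * expR (12 * M * t) <= 3 * expR (12 * M * T) * tail n.
  have et : expR (12 * M * t) <= expR (12 * M * T).
    by rewrite ler_expR ler_wpM2l// mulr_ge0// (le_trans ler01).
  have := ler_wpM2l (tail_ge0 n) et; have := mulr_ge0 (tail_ge0 n) (expR_ge0 (12 * M * T)).
  lra.
split; first exact: le_trans H1 HE.
by apply: le_trans H2 _; rewrite ler_wpM2l// ltW.
Qed.

Lemma compare_stiffness t : 0 <= t <= T ->
  (a' t - aN n t) ^+ 2 <= 4 * M * (3 * expR (12 * M * T) * tail n).
Proof.
move=> tT.
have := stability_stiffness adm (galXY n) dX' dY' sum_a' M1 bound' D0 tT.
have /andP[t0 tT'] := tT.
have HE : 2 * (5 / 4 * tail n) * expR (12 * M * t) <= 3 * expR (12 * M * T) * tail n.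
  have et : expR (12 * M * t) <= expR (12 * M * T).
    by rewrite ler_expR ler_wpM2l// mulr_ge0// (le_trans ler01).
  have := ler_wpM2l (tail_ge0 n) et; have := mulr_ge0 (tail_ge0 n) (expR_ge0 (12 * M * T)).
  lra.
by move=> /le_trans; apply; rewrite ler_wpM2l// mulr_ge0// (le_trans ler01).
Qed.

End Compare.

Let norm_le_sqrt (x K : R) : x ^+ 2 <= K -> `|x| <= Num.sqrt K.
Proof. by move=> xK; rewrite -sqrtr_sqr; apply: ler_wsqrtr. Qed.

Let rate_ge0 n : 0 <= rate n. Proof. exact: sqrtr_ge0. Qed.

Let rate_sqr n : rate n ^+ 2 = 3 * expR (12 * T) * tail n.
Proof. by rewrite sqr_sqrtr// !mulr_ge0 ?expR_ge0. Qed.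

Let rate_small e : 0 < e -> exists N, forall n, (N <= n)%N -> rate n <= e.
Proof.
move=> e0; have E0 : 0 < 3 * expR (12 * T) by rewrite mulr_gt0 ?expR_gt0.
have [|N HN] := @tail_small (e ^+ 2 / (3 * expR (12 * T))).
  by rewrite divr_gt0 ?exprn_gt0.
exists N => n /HN; rewrite ler_pdivlMr// => H.
have -> : e = Num.sqrt (e ^+ 2) by rewrite sqrtr_sqr gtr0_norm.
by apply: ler_wsqrtr; rewrite mulrC.
Qed.

Let cauchyN n m : (n <= m)%N -> forall t, 0 <= t <= T ->
  (forall i, `|XN m i t - XN n i t| <= rate n /\
             `|YN m i t - YN n i t| <= om i * rate n) /\
  `|aN m t - aN n t| <= 2 * rate n.
Proof.
move=> nm t tT.
have dX' i : C1in T (XN m i) (YN m i) by apply: is_derive_C1in => s; exact: dXN.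
have dY' i : C1in T (YN m i) (fun t => - (om i ^+ 2 * aN m t * XN m i t)).
  by apply: is_derive_C1in => s; exact: dYN.
have sum_a' s : 0 <= s <= T -> is_sum (fun i => om i ^+ 2 * XN m i s ^+ 2) (aN m s - 1).
  move=> sT; have sE : \sum_(i <- SN m) om i ^+ 2 * XN m i s ^+ 2 = aN m s - 1.
    by rewrite /aN /stiffness addrC addKr.
  split => [S uS|e e0]; last by exists (SN m) => //; rewrite sE gerBl ltW.
  rewrite -sE; apply: sum_le_support => // i; first by rewrite mulr_ge0 ?sqr_ge0.
  by move=> /(@outXY m i s)[-> _]; rewrite expr0n mulr0.
have bound' s S : 0 <= s <= T -> uniq S ->
  \sum_(i <- S) (om i ^+ 3 * XN m i s ^+ 2 + YN m i s ^+ 2 / om i) <= 1.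
  exact: (galerkin_bound adm (galXY m)).
have init' i : (XN m i 0 - XN n i 0) ^+ 2 <= (if i \in SN n then 0 else X0 i ^+ 2) /\
    (YN m i 0 - YN n i 0) ^+ 2 <= (if i \in SN n then 0 else Y0 i ^+ 2).
  have [-> ->] := initXY m i; have [-> ->] := initXY n i.
  have [iS|iS] := boolP (i \in SN n); first by rewrite (SN_mono nm iS) !subrr expr0n.
  by rewrite !subr0; case: ifPn => _; rewrite ?expr0n ?sqr_ge0.
have C i := compare_mode dX' dY' sum_a' (lexx 1) bound' init' i tT.
have Ca := compare_stiffness dX' dY' sum_a' (lexx 1) bound' init' tT.
rewrite mulr1 in Ca.
split => [i|].
  have [] := C i; rewrite mulr1 => C1 C2; split; first exact: norm_le_sqrt.
  apply: le_trans (norm_le_sqrt C2) _.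
  rewrite -[leRHS]ger0_norm ?mulr_ge0 ?rate_ge0 ?(ltW (om_gt0 i))// -sqrtr_sqr.
  apply: ler_wsqrtr; rewrite exprMn rate_sqr ler_wpM2r//.
    by rewrite !mulr_ge0 ?expR_ge0.
  by rewrite expr2 ler_peMl// ltW.
apply: le_trans (norm_le_sqrt Ca) _.
rewrite -[leRHS]ger0_norm ?mulr_ge0 ?rate_ge0// -sqrtr_sqr.
by apply: ler_wsqrtr; rewrite exprMn rate_sqr mulr1; lra.
Qed.

Let limX i t : exists l : R, 0 <= t <= T -> forall n, `|XN n i t - l| <= rate n.
Proof.
have [tT|] := boolP (0 <= t <= T); last by exists 0.
have [n m nm|l Hl] := @cauchy_rate R (fun n => XN n i t) rate; last by exists l.
by have [/(_ i)[]] := cauchyN nm tT.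
Qed.

Let limY i t : exists l : R, 0 <= t <= T -> forall n, `|YN n i t - l| <= om i * rate n.
Proof.
have [tT|] := boolP (0 <= t <= T); last by exists 0.
have [n m nm|l Hl] := @cauchy_rate R (fun n => YN n i t) (fun n => om i * rate n); last by exists l.
by have [/(_ i)[]] := cauchyN nm tT.
Qed.

Let limA t : exists l : R, 0 <= t <= T -> forall n, `|aN n t - l| <= 2 * rate n.
Proof.
have [tT|] := boolP (0 <= t <= T); last by exists 0.
have [n m nm|l Hl] := @cauchy_rate R (fun n => aN n t) (fun n => 2 * rate n); last by exists l.
by have [] := cauchyN nm tT.
Qed.

Let x i t := sval (cid (limX i t)).
Let y i t := sval (cid (limY i t)).
Let a t := sval (cid (limA t)).

Let xP i t n : 0 <= t <= T -> `|XN n i t - x i t| <= rate n.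
Proof. by move=> tT; rewrite /x; case: cid => l /= /(_ tT). Qed.

Let yP i t n : 0 <= t <= T -> `|YN n i t - y i t| <= om i * rate n.
Proof. by move=> tT; rewrite /y; case: cid => l /= /(_ tT). Qed.

Let aP t n : 0 <= t <= T -> `|aN n t - a t| <= 2 * rate n.
Proof. by move=> tT; rewrite /a; case: cid => l /= /(_ tT). Qed.

Let cvg_rate (u : nat -> R) (l c : R) : 0 < c ->
  (forall n, `|u n - l| <= c * rate n) -> u n @[n --> \oo] --> l.
Proof.
move=> c0 H; apply/cvgrPdist_le => /= e e0.
have [N HN] := rate_small (divr_gt0 e0 c0).
exists N => // n /= /HN; rewrite ler_pdivlMr// mulrC => rn.
by rewrite distrC; apply: le_trans rn.
Qed.

Let cvgx i t : 0 <= t <= T -> XN n i t @[n --> \oo] --> x i t.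
Proof.
by move=> tT; apply: (@cvg_rate _ _ 1) => // n; rewrite mul1r; exact: xP.
Qed.

Let cvgy i t : 0 <= t <= T -> YN n i t @[n --> \oo] --> y i t.
Proof. by move=> tT; apply: (@cvg_rate _ _ (om i)) => // n; exact: yP. Qed.

Let cvga t : 0 <= t <= T -> aN n t @[n --> \oo] --> a t.
Proof. by move=> tT; apply: (@cvg_rate _ _ 2) => // n; exact: aP. Qed.

Let le_lim (u : nat -> R) (l c : R) N : u n @[n --> \oo] --> l ->
  (forall n, (N <= n)%N -> u n <= c) -> l <= c.
Proof.
by move=> ul H; apply: (ler_cvg_to ul (cvg_cst c)); exists N => // n /=; exact: H.
Qed.

Let ge_lim (u : nat -> R) (l c : R) N : u n @[n --> \oo] --> l ->
  (forall n, (N <= n)%N -> c <= u n) -> c <= l.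
Proof.
by move=> ul H; apply: (ler_cvg_to (cvg_cst c) ul); exists N => // n /=; exact: H.
Qed.

Let a_bounds t : 0 <= t <= T -> 1 <= a t <= 5 / 4.
Proof.
move=> tT; apply/andP; split.
  by apply: (ge_lim (N := 0) (cvga tT)) => n _; exact: stiffness_ge1.
by apply: (le_lim (N := 0) (cvga tT)) => n _; exact: aN_le.
Qed.

Let XN_le1 n i t : 0 <= t <= T -> `|XN n i t| <= 1.
Proof.
move=> tT; have := galerkin_bound adm (galXY n) tT (isT : uniq [:: i]).
rewrite big_seq1 => H.
have q0 : 0 <= YN n i t ^+ 2 / om i by rewrite divr_ge0 ?sqr_ge0// ltW.
have o3 : 1 <= om i ^+ 3 by rewrite exprn_ege1.
have := ler_wpM2r (sqr_ge0 (XN n i t)) o3; rewrite ler_norml; nra.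
Qed.

Let cvgsq (u : nat -> R) (l : R) : u n @[n --> \oo] --> l -> u n ^+ 2 @[n --> \oo] --> l ^+ 2.
Proof. by move=> ul; rewrite expr2; under eq_fun do rewrite expr2; exact: cvgM. Qed.

Let cvg_pot t S : 0 <= t <= T ->
  (\sum_(i <- S) om i ^+ 2 * XN n i t ^+ 2) @[n --> \oo] --> \sum_(i <- S) om i ^+ 2 * x i t ^+ 2.
Proof.
move=> tT; apply: cvg_bigsum => i; apply: cvgM; first exact: cvg_cst.
by apply: cvgsq; exact: cvgx.
Qed.

Let cvg_mode_sq t S rho : 0 <= t <= T ->
  (\sum_(i <- S) rho i * mode_sq (XN n ^~ t) (YN n ^~ t) i) @[n --> \oo] -->
  \sum_(i <- S) rho i * mode_sq (x ^~ t) (y ^~ t) i.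
Proof.
move=> tT; apply: cvg_bigsum => i; apply: cvgM; first exact: cvg_cst.
apply: cvgD; first by apply: cvgM; [exact: cvg_cst|exact/cvgsq/cvgx].
by apply: cvgM; [exact/cvgsq/cvgy|exact: cvg_cst].
Qed.

(** The majorant does not depend on [n]; the constant is (5/4)^2 rounded up to 2. *)
Let growthN n i t : 0 <= t <= T ->
  mode_sq (XN n ^~ t) (YN n ^~ t) i <= 2 * expR T * mode_sq X0 Y0 i.
Proof.
move=> tT; have /andP[t0 tT'] := tT.
have [iS|iS] := boolP (i \in SN n); last first.
  rewrite /mode_sq; have [-> ->] := outXY t iS.
  by rewrite expr0n/= mulr0 mul0r addr0 !mulr_ge0 ?expR_ge0// mode_sq_ge0.
have z0 : 0 <= (0 : R) <= T by rewrite lexx T0.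
apply: le_trans (mode_en_ge _ _ i (speedN n tT)) _.
have := en_growth adm (fun i t => @dXN n i t) (fun i t => @dYN n i t) (@smallXY n) d_small i tT.
have := mode_en_le (XN n i 0) (YN n i 0) i (speedN n z0).
have [+ +] := initXY n i; rewrite iS => -> ->.
rewrite -/(mode_sq X0 Y0 i).
have et : expR t <= expR T by rewrite ler_expR.
have m0 := mode_sq_ge0 X0 Y0 i.
have eT := expR_gt0 T; have et0 := expR_gt0 t.
move: (en_ge0 (SN n) adm (XN n) (YN n) i 0); rewrite /en.
set e0 := mode_en _ _ (XN n i 0) _; set e1 := mode_en _ _ (XN n i t) _ => e00.
have [E1 E2] := initXY n i; rewrite iS in E1 E2.
rewrite -E1 -E2 -/e0 => h1 h2.
have : expR t * e0 <= expR T * (5 / 4 * mode_sq X0 Y0 i).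
  by apply: ler_pM => //; exact: ltW.
have := mulr_ge0 (ltW eT) m0.
move: h2; lra.
Qed.

(** Modewise limits alone would make [a t - 1] only an upper bound. Nothing escapes to high
    frequencies because [growthN] bounds the part outside [SN N] by [2 * expR T * tail N], uniformly
    in [n]. *)
Let sum_limit t : 0 <= t <= T -> is_sum (fun i => om i ^+ 2 * x i t ^+ 2) (a t - 1).
Proof.
move=> tT; have p0 n i : 0 <= om i ^+ 2 * XN n i t ^+ 2 by rewrite mulr_ge0 ?sqr_ge0.
have aE n : aN n t - 1 = \sum_(i <- SN n) om i ^+ 2 * XN n i t ^+ 2.
  by rewrite /aN /stiffness addrC addKr.
have cva : aN n t - 1 @[n --> \oo] --> a t - 1 by apply: cvgB; [exact: cvga|exact: cvg_cst].
split => [S uS|e e0].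
  have [N HN] := SN_exhaust S.
  apply: (ler_cvg_to (@cvg_pot t S tT) cva); exists N => // n /= Nn.
  by rewrite aE; apply: uniq_sum_le => //; exact: HN.
have E0 : 0 < 2 * expR T by rewrite mulr_gt0 ?expR_gt0.
have [N HN] := tail_small (divr_gt0 e0 E0).
exists (SN N); first exact: uniq_SN.
have cv2 : (aN n t - 1 - e) @[n --> \oo] --> a t - 1 - e.
  by apply: cvgB => //; exact: cvg_cst.
apply: (ler_cvg_to cv2 (@cvg_pot t (SN N) tT)); exists N => // n /= Nn.
rewrite aE lerBlDr (bigID (mem (SN N)))/=; apply: lerD.
  rewrite -big_filter; apply: uniq_sum_le => //; first by rewrite filter_uniq// uniq_SN.
  by move=> i; rewrite mem_filter => /andP[].
have := HN N (leqnn N); rewrite ler_pdivlMr// => He; apply: le_trans He.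
have := tail_ge N (uniq_SN n) => /(ler_wpM2r (ltW E0)); apply: le_trans.
rewrite mulr_suml; apply: ler_sum => i _.
have := growthN n i tT; rewrite {1}/mode_sq => H.
have q0 : 0 <= YN n i t ^+ 2 / om i by rewrite divr_ge0 ?sqr_ge0// ltW.
have H2 : om i * XN n i t ^+ 2 <= 2 * expR T * mode_sq X0 Y0 i by lra.
have H3 : om i ^+ 2 * XN n i t ^+ 2 <= wt i * (2 * expR T * mode_sq X0 Y0 i).
  rewrite expr2 -mulrA; apply: ler_pM => //; first exact: ltW.
  by rewrite mulr_ge0 ?sqr_ge0// ltW.
by rewrite [leRHS](_ : _ = wt i * (2 * expR T * mode_sq X0 Y0 i))// /g; ring.
Qed.

(** The factor is 10/3 from [energy_growth] and twice 5/4 for passing between [mode_sq] and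
    [mode_en]: 125/24, rounded up to 6. It depends neither on [T] nor on [rho]. *)
Let energy_limit rho K : (forall i, 0 <= rho i) ->
  (forall k j, om k = om j -> rho k = rho j) ->
  (forall S, uniq S -> \sum_(i <- S) rho i * mode_sq X0 Y0 i <= K) ->
  forall t S, 0 <= t <= T -> uniq S -> \sum_(i <- S) rho i * mode_sq (x ^~ t) (y ^~ t) i <= 6 * K.
Proof.
move=> rho0 rho_om HK t S tT uS; have [N HN] := SN_exhaust S.
have z0 : 0 <= (0 : R) <= T by rewrite lexx T0.
have K0 : 0 <= K by have := HK [::] isT; rewrite big_nil.
apply: (le_lim (N := N) (@cvg_mode_sq t S rho tT)) => n Nn.
apply: (@le_trans _ _ (\sum_(i <- SN n) rho i * mode_sq (XN n ^~ t) (YN n ^~ t) i)).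
  by apply: uniq_sum_le => //; [exact: HN|move=> i; rewrite mulr_ge0].
apply: (@le_trans _ _ (5 / 4 * energy (SN n) om (XN n) (YN n) rho t)).
  rewrite /energy mulr_sumr; apply: ler_sum => i _; rewrite mulrCA ler_wpM2l//.
  by apply: mode_en_ge; exact: speedN.
have := energy_growth adm (fun i t => @dXN n i t) (fun i t => @dYN n i t) (@smallXY n) d_small rho0 rho_om dT tT.
suff : energy (SN n) om (XN n) (YN n) rho 0 <= 5 / 4 * K by move: K0; lra.
apply: (@le_trans _ _ (5 / 4 * \sum_(i <- SN n) rho i * mode_sq X0 Y0 i)); last first.
  by rewrite ler_wpM2l// HK// uniq_SN.
rewrite /energy mulr_sumr big_seq [leRHS]big_seq; apply: ler_sum => i iS.
rewrite mulrCA ler_wpM2l// /en.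
have [-> ->] := initXY n i; rewrite iS.
by apply: mode_en_le; exact: speedN.
Qed.

Let mode_limit i t : 0 <= t <= T ->
  mode_sq (x ^~ t) (y ^~ t) i <= 2 * expR T * mode_sq X0 Y0 i.
Proof.
move=> tT; have := @cvg_mode_sq t [:: i] (fun=> 1) tT.
rewrite big_seq1 mul1r => /(le_lim (N := 0)); apply => n _.
by rewrite big_seq1 mul1r; exact: growthN.
Qed.

Let continuous_der (f : R -> R) l t : is_derive t (1 : R) f l -> {for t, continuous f}.
Proof. by case=> df _; exact/differentiable_continuous/derivable1_diffP. Qed.

Let x_regular i : exists F : R -> R, forall t, 0 <= t <= T ->
  F t = x i t /\ is_derive t (1 : R) F (y i t).
Proof.
apply: (@limit_is_derive R T (fun n => XN n i) (fun n => YN n i) _ _ (fun n => om i * rate n)) => //.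
- by move=> n t; exact: dXN.
- by move=> n t tT; exact: continuous_der (dYN n i tT).
- by move=> n t tT; apply: le_trans (xP i n tT) _; rewrite ler_peMl.
- by move=> n t tT; exact: yP.
- move=> e e0; have [N HN] := rate_small (divr_gt0 e0 (om_gt0 i)).
  by exists N; have := HN N (leqnn N); rewrite ler_pdivlMr// mulrC.
Qed.

Let y_regular i : exists F : R -> R, forall t, 0 <= t <= T ->
  F t = y i t /\ is_derive t (1 : R) F (- (om i ^+ 2 * a t * x i t)).
Proof.
have o2 : 0 < om i ^+ 2 by rewrite exprn_gt0.
apply: (@limit_is_derive R T (fun n => YN n i)
  (fun n t => - (om i ^+ 2 * aN n t * XN n i t)) _ _ (fun n => 4 * om i ^+ 2 * rate n)) => //.
- by move=> n t; exact: dYN.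
- move=> n t tT; apply: cvgN; apply: cvgM; last exact: continuous_der (dXN n i tT).
  apply: cvgM; first exact: cvg_cst.
  have da := is_derive_stiffness (SN n) om (fun j => dXN n j tT).
  exact: continuous_der da.
- move=> n t tT; apply: le_trans (yP i n tT) _; rewrite ler_wpM2r//.
  by have := om1 i; nra.
- move=> n t tT.
  have -> : - (om i ^+ 2 * aN n t * XN n i t) - - (om i ^+ 2 * a t * x i t) =
      om i ^+ 2 * - (aN n t * XN n i t - a t * x i t) by ring.
  have -> : 4 * om i ^+ 2 * rate n = om i ^+ 2 * (4 * rate n) by ring.
  rewrite normrM (gtr0_norm o2) normrN ler_wpM2l ?(ltW o2)//.
  have -> : aN n t * XN n i t - a t * x i t =
    (aN n t - a t) * XN n i t + a t * (XN n i t - x i t) by ring.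
  have /andP[a1 a2] := a_bounds tT.
  have h1 : `|(aN n t - a t) * XN n i t| <= 2 * rate n * 1.
    by rewrite normrM; apply: ler_pM => //; [exact: aP|exact: XN_le1].
  have h2 : `|a t * (XN n i t - x i t)| <= 5 / 4 * rate n.
    rewrite normrM; apply: ler_pM => //; last exact: xP.
    by rewrite ger0_norm// (le_trans ler01).
  by apply: le_trans (ler_normD _ _) _; have := rate_ge0 n; lra.
- move=> e e0; have o4 : 0 < 4 * om i ^+ 2 by rewrite mulr_gt0.
  have [N HN] := rate_small (divr_gt0 e0 o4).
  by exists N; have := HN N (leqnn N); rewrite ler_pdivlMr// mulrC.
Qed.

Let init_limit i : x i 0 = X0 i /\ y i 0 = Y0 i.
Proof.
have z0 : 0 <= (0 : R) <= T by rewrite lexx T0.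
have E n : (pickle i < n)%N -> XN n i 0 = X0 i /\ YN n i 0 = Y0 i.
  by move=> /mem_SN iS; have := initXY n i; rewrite iS.
split; apply/eqP; rewrite eq_le; apply/andP; split.
- by apply: (le_lim (N := (pickle i).+1) (@cvgx i 0 z0)) => n /E[-> _].
- by apply: (ge_lim (N := (pickle i).+1) (@cvgx i 0 z0)) => n /E[-> _].
- by apply: (le_lim (N := (pickle i).+1) (@cvgy i 0 z0)) => n /E[_ ->].
- by apply: (ge_lim (N := (pickle i).+1) (@cvgy i 0 z0)) => n /E[_ ->].
Qed.

(** Two solutions are never compared directly: each is the limit of the same truncations. Only these
    have to be small, so the competitor may have any bound [M]; it merely slows the convergence. *)
Let unique_limit (X' Y' : I -> R -> R) (a' : R -> R) (M : R) :
  (forall i, C1in T (X' i) (Y' i)) ->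
  (forall i, C1in T (Y' i) (fun t => - (om i ^+ 2 * a' t * X' i t))) ->
  (forall t, 0 <= t <= T -> is_sum (fun i => om i ^+ 2 * X' i t ^+ 2) (a' t - 1)) ->
  (forall t S, 0 <= t <= T -> uniq S ->
    \sum_(i <- S) (om i ^+ 3 * X' i t ^+ 2 + Y' i t ^+ 2 / om i) <= M) ->
  (forall i, X' i 0 = X0 i /\ Y' i 0 = Y0 i) ->
  forall i t, 0 <= t <= T -> X' i t = x i t.
Proof.
move=> dX' dY' sa' bound' init' i t tT.
pose M' := Num.max 1 M.
have M1 : 1 <= M' by rewrite le_max lexx.
have bound'' s S : 0 <= s <= T -> uniq S ->
    \sum_(i <- S) (om i ^+ 3 * X' i s ^+ 2 + Y' i s ^+ 2 / om i) <= M'.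
  by move=> sT uS; apply: le_trans (bound' s S sT uS) _; rewrite le_max lexx orbT.
have in' n j : (X' j 0 - XN n j 0) ^+ 2 <= (if j \in SN n then 0 else X0 j ^+ 2) /\
    (Y' j 0 - YN n j 0) ^+ 2 <= (if j \in SN n then 0 else Y0 j ^+ 2).
  have [-> ->] := init' j; have [-> ->] := initXY n j.
  by case: ifP => _; rewrite ?subrr ?subr0 ?expr0n.
have C n := (compare_mode dX' dY' sa' M1 bound'' (in' n) i tT).1.
suff : (X' i t - x i t) ^+ 2 <= 0.
  by rewrite real_exprn_even_le0 ?num_real// subr_eq0 => /eqP.
apply/ler_addgt0Pr => e e0; rewrite add0r.
have E0 : 0 < 3 * expR (12 * M' * T) by rewrite mulr_gt0 ?expR_gt0.
have [N HN] := tail_small (divr_gt0 e0 E0).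
have cv : (X' i t - XN n i t) ^+ 2 @[n --> \oo] --> (X' i t - x i t) ^+ 2.
  by apply: cvgsq; apply: cvgB; [exact: cvg_cst|exact: cvgx].
apply: (le_lim (N := N) cv) => n /HN; rewrite ler_pdivlMr// mulrC => H.
exact: le_trans (C n) H.
Qed.

Theorem modes_solution : exists (x y : I -> R -> R) (a : R -> R),
  [/\ (forall i, x i 0 = X0 i /\ y i 0 = Y0 i),
      (forall i t, 0 <= t <= T -> is_derive t (1 : R) (x i) (y i t) /\
         is_derive t (1 : R) (y i) (- (om i ^+ 2 * a t * x i t))),
      (forall t, 0 <= t <= T -> 1 <= a t <= 5 / 4 /\
         is_sum (fun i => om i ^+ 2 * x i t ^+ 2) (a t - 1)),
      (forall i t, 0 <= t <= T ->
         mode_sq (x ^~ t) (y ^~ t) i <= 2 * expR T * mode_sq X0 Y0 i) /\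
      (forall rho K, (forall i, 0 <= rho i) ->
         (forall k j, om k = om j -> rho k = rho j) ->
         (forall S, uniq S -> \sum_(i <- S) rho i * mode_sq X0 Y0 i <= K) ->
         forall t S, 0 <= t <= T -> uniq S ->
         \sum_(i <- S) rho i * mode_sq (x ^~ t) (y ^~ t) i <= 6 * K) &
      forall (X' Y' : I -> R -> R) (a' : R -> R) (M : R),
        (forall i, C1in T (X' i) (Y' i)) ->
        (forall i, C1in T (Y' i) (fun t => - (om i ^+ 2 * a' t * X' i t))) ->
        (forall t, 0 <= t <= T -> is_sum (fun i => om i ^+ 2 * X' i t ^+ 2) (a' t - 1)) ->
        (forall t S, 0 <= t <= T -> uniq S ->
          \sum_(i <- S) (om i ^+ 3 * X' i t ^+ 2 + Y' i t ^+ 2 / om i) <= M) ->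
        (forall i, X' i 0 = X0 i /\ Y' i 0 = Y0 i) ->
        forall i t, 0 <= t <= T -> X' i t = x i t].
Proof.
have z0 : 0 <= (0 : R) <= T by rewrite lexx T0.
(* The limits are meaningful on [[0, T]] only; the two-sided derivatives at the endpoints belong to
   these extensions. *)
pose fx i := sval (cid (x_regular i)); pose fy i := sval (cid (y_regular i)).
have fxP i t : 0 <= t <= T -> fx i t = x i t /\ is_derive t (1 : R) (fx i) (y i t).
  by rewrite /fx; case: cid => F /= /(_ t).
have fyP i t : 0 <= t <= T ->
    fy i t = y i t /\ is_derive t (1 : R) (fy i) (- (om i ^+ 2 * a t * x i t)).
  by rewrite /fy; case: cid => F /= /(_ t).
have Ex i t : 0 <= t <= T -> fx i t = x i t by move=> /(fxP i)[].
have Ey i t : 0 <= t <= T -> fy i t = y i t by move=> /(fyP i)[].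
have Em t i : 0 <= t <= T -> mode_sq (fx ^~ t) (fy ^~ t) i = mode_sq (x ^~ t) (y ^~ t) i.
  by move=> tT; rewrite /mode_sq Ex// Ey.
exists fx, fy, a; split.
- by move=> i; rewrite Ex// Ey//; exact: init_limit.
- by move=> i t tT; rewrite Ey// Ex//; split; [case: (fxP i t tT)|case: (fyP i t tT)].
- move=> t tT; split; first exact: a_bounds.
  by under eq_fun => i do rewrite Ex//; exact: sum_limit.
- split=> [i t tT|rho K rho0 rho_om HK t S tT uS]; first by rewrite Em//; exact: mode_limit.
  under eq_bigr => i _ do rewrite Em//.
  exact: energy_limit.
- move=> X' Y' a' M dX' dY' sa' bound' init' i t tT; rewrite Ex//.
  exact: (unique_limit dX' dY' sa' bound').
Qed.

End Existence.

(** * Unordered sums and Sobolev norms *)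

Section UnorderedSumsTheory.
Variable R : realType.

Lemma is_sum_unique (I : eqType) (f : I -> R) (l l' : R) :
  is_sum f l -> is_sum f l' -> l = l'.
Proof.
move=> [ub ap] [ub' ap']; apply/eqP; rewrite eq_le; apply/andP; split;
  apply/ler_addgt0Pr => e e0; [have [S uS] := ap e e0|have [S uS] := ap' e e0].
  by have := ub' S uS; lra.
by have := ub S uS; lra.
Qed.

Lemma is_sumD_le (I : eqType) (f g : I -> R) (l m K : R) :
  (forall i, 0 <= f i) -> (forall i, 0 <= g i) -> is_sum f l -> is_sum g m ->
  (forall S, uniq S -> \sum_(i <- S) (f i + g i) <= K) -> l + m <= K.
Proof.
move=> f0 g0 [_ apf] [_ apg] fgK; apply/ler_addgt0Pr => e e0.
have e2 : 0 < e / 2 by rewrite divr_gt0.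
have [S uS Sf] := apf _ e2; have [S' uS' Sg] := apg _ e2.
have uU : uniq (undup (S ++ S')) by exact: undup_uniq.
have := fgK _ uU; rewrite big_split/=.
have sub1 : {subset S <= undup (S ++ S')} by move=> i iS; rewrite mem_undup mem_cat iS.
have sub2 : {subset S' <= undup (S ++ S')}.
  by move=> i iS; rewrite mem_undup mem_cat iS orbT.
have := uniq_sum_le uS sub1 f0; have := uniq_sum_le uS' sub2 g0; lra.
Qed.

Lemma is_sum_tail (I : eqType) (f : I -> R) (K e : R) :
  (forall i, 0 <= f i) -> (forall S, uniq S -> \sum_(i <- S) f i <= K) -> 0 < e ->
  exists2 S0, uniq S0 &
    forall S, uniq S -> \sum_(i <- S | i \notin S0) f i <= e.
Proof.
move=> f0 fK e0.
have hs : has_sup [set r | exists2 S, uniq S & r = \sum_(i <- S) f i].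
  split; first by exists (\sum_(i <- [::]) f i), [::].
  by exists K => _ [S uS ->]; exact: fK.
have [_ [S0 uS0 ->] S0e] := sup_adherent e0 hs; exists S0 => // S uS.
have : \sum_(i <- [seq i <- S | i \notin S0] ++ S0) f i <=
    sup [set r | exists2 S, uniq S & r = \sum_(i <- S) f i].
  apply: ub_le_sup; first by case: hs.
  eexists; last reflexivity.
  rewrite cat_uniq filter_uniq// uS0 andbT; apply/hasPn => i iS.
  by rewrite mem_filter iS.
by rewrite big_cat/= big_filter; move: S0e; lra.
Qed.

Lemma esum_le_bound (J : choiceType) (D : set J) (f : J -> R) (K : R) :
  (forall S, uniq S -> \sum_(j <- S) f j <= K) -> (\esum_(j in D) (f j)%:E <= K%:E)%E.
Proof.
move=> fK; apply: ge_ereal_sup => _ [X [finX XD] <-].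
by rewrite fsbig_finite// sumEFin lee_fin; apply: fK; exact: finmap.fset_uniq.
Qed.

Lemma esum_is_sum (J : choiceType) (D : set J) (f : J -> R) :
  (forall j, 0 <= f j) -> (forall j, ~ D j -> f j = 0) ->
  (\esum_(j in D) (f j)%:E < +oo)%E -> is_sum f (fine (\esum_(j in D) (f j)%:E)).
Proof.
move=> f0 fD fin.
have fn : (\esum_(j in D) (f j)%:E \is a fin_num)%E.
  by rewrite ge0_fin_numE// esum_ge0// => j _; rewrite lee_fin.
split => [S uS|e e0].
  rewrite -lee_fin fineK//.
  have -> : \sum_(i <- S) f i = \sum_(i <- [seq i <- S | `[< D i >]]) f i.
    rewrite big_filter [RHS]big_mkcond; apply: eq_bigr => i _.
    by case: asboolP => // /fD.
  apply: esum_ge; exists [set` [seq i <- S | `[< D i >]]].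
    by split=> // i /=; rewrite mem_filter => /andP[/asboolP].
  by rewrite -fsbig_seq ?filter_uniq// sumEFin.
have := ub_ereal_sup_adherent e0 fn.
move=> [_ [X [finX XD] <-]]; rewrite fsbig_finite// sumEFin => H.
exists (finmap.enum_fset (fset_set X)); first exact: finmap.fset_uniq.
rewrite -lee_fin; apply: ltW; apply: le_lt_trans H.
by rewrite EFinB fineK.
Qed.

(** Passes between sums over Fourier indices and sums over real modes, two per index. *)
Lemma is_sum_pair (J : eqType) (F : J * bool -> R) (l : R) : (forall i, 0 <= F i) ->
  is_sum (fun j => F (j, false) + F (j, true)) l <-> is_sum F l.
Proof.
move=> F0.
pose pr S : seq (J * bool) := [seq (j, false) | j <- S] ++ [seq (j, true) | j <- S].
have upr S : uniq S -> uniq (pr S).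
  move=> uS; rewrite cat_uniq !map_inj_uniq ?uS//=; [|by move=> ? ? []..].
  by rewrite andbT; apply/hasPn => _ /mapP[j jS ->]; apply/mapP => -[].
have spr S : \sum_(i <- pr S) F i = \sum_(j <- S) (F (j, false) + F (j, true)).
  by rewrite big_cat/= !big_map big_split.
have F0' j : 0 <= F (j, false) + F (j, true) by rewrite addr_ge0.
have sub S : {subset S <= pr (undup [seq i.1 | i <- S])}.
  move=> [j b] jS; rewrite mem_cat; apply/orP.
  have jS' : j \in undup [seq i.1 | i <- S].
    by rewrite mem_undup; apply/mapP; exists (j, b).
  by case: b jS => jS; [right|left]; apply: map_f.
split=> -[ub ap]; split.
- move=> S uS; apply: le_trans (uniq_sum_le uS (@sub S) F0) _.
  by rewrite spr; apply: ub; exact: undup_uniq.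
- by move=> e /ap[S uS]; rewrite -spr => H; exists (pr S) => //; exact: upr.
- by move=> S uS; rewrite -spr; apply: ub; exact: upr.
- move=> e /ap[S uS] H; exists (undup [seq i.1 | i <- S]); first exact: undup_uniq.
  by apply: le_trans H _; rewrite -spr; apply: uniq_sum_le.
Qed.

Lemma sum_pair_le (J : eqType) (F : J * bool -> R) (K : R) : (forall i, 0 <= F i) ->
  (forall S, uniq S -> \sum_(i <- S) F i <= K) ->
  forall S, uniq S -> \sum_(j <- S) (F (j, false) + F (j, true)) <= K.
Proof.
move=> F0 FK S uS.
have : uniq ([seq (j, false) | j <- S] ++ [seq (j, true) | j <- S]).
  rewrite cat_uniq !map_inj_uniq ?uS//=; [|by move=> ? ? []..].
  by rewrite andbT; apply/hasPn => _ /mapP[j jS ->]; apply/mapP => -[].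
by move=> /FK; rewrite big_cat/= !big_map big_split.
Qed.

End UnorderedSumsTheory.

(** * Fourier coefficients as real modes *)

Section RealModes.
Variables (R : realType) (d : nat).
Notation J := 'rV[int]_d.
Implicit Types (w : fourier R d) (i : J * bool) (j : J).

(** The modes of [j] and [- j] are kept as independent unknowns; that the solution is real-valued is
    recovered afterwards, in [mode_opp]. *)
Definition fmode w i : R := if i.2 then complex.Im (w i.1) else complex.Re (w i.1).

(* The zero mode, always zero, gets the harmless frequency 1. *)
Definition freq i : R := if i.1 == 0 then 1 else euclid_norm R i.1.

Definition norm_sq j : int := \sum_(k < d) j ord0 k ^+ 2.

Lemma Rcomplex_norm_sq (z : Rcomplex R) :
  `|z| ^+ 2 = complex.Re z ^+ 2 + complex.Im z ^+ 2.
Proof. by case: z => a b; rewrite sqr_sqrtr// addr_ge0 ?sqr_ge0. Qed.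

Lemma fmodeB w w' i : fmode (w - w') i = fmode w i - fmode w' i.
Proof. by rewrite /fmode; case: i.2; rewrite /= raddfB. Qed.

Lemma fmodeZ c w i : fmode (c *: w) i = c * fmode w i.
Proof. by rewrite /fmode; case: i.2; rewrite /= linearZ. Qed.

Lemma fmode_inj w w' : (forall i, fmode w i = fmode w' i) -> w = w'.
Proof.
move=> H; apply/funext => j; have := H (j, false); have := H (j, true).
by rewrite /fmode/=; case: (w j) => a b; case: (w' j) => a' b' /= -> ->.
Qed.

Lemma norm_sq_ge1 j : j != 0 -> 1 <= norm_sq j.
Proof.
move=> j0; rewrite -gtz0_ge1 lt0r sumr_ge0 ?andbT => [|k _]; last exact: sqr_ge0.
apply: contra j0 => /eqP /psumr_eq0P H; apply/eqP/rowP => k; rewrite mxE.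
by apply/eqP; rewrite -sqrf_eq0 H// => l _; exact: sqr_ge0.
Qed.

Lemma euclid_norm_sqr j : euclid_norm R j ^+ 2 = (norm_sq j)%:~R.
Proof.
rewrite sqr_sqrtr; last by apply: sumr_ge0 => k _; exact: sqr_ge0.
by rewrite /norm_sq rmorph_sum/=; apply: eq_bigr => k _; rewrite rmorphXn.
Qed.

Let freq_int i : exists2 n : int, 1 <= n & freq i ^+ 2 = n%:~R.
Proof.
rewrite /freq; case: ifPn => i0; first by exists 1 => //; rewrite expr1n.
by exists (norm_sq i.1); [exact: norm_sq_ge1|exact: euclid_norm_sqr].
Qed.

Lemma freq_ge0 i : 0 <= freq i.
Proof. by rewrite /freq; case: ifP => // _; exact: sqrtr_ge0. Qed.

Lemma freq_ge1 i : 1 <= freq i.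
Proof.
rewrite -(@ler_pXn2r _ 2) ?nnegrE ?freq_ge0// expr1n.
by have [n n1 ->] := freq_int i; rewrite -[1]/(1%:~R) ler_int.
Qed.

Let freq_gt0 i : 0 < freq i. Proof. exact: lt_le_trans (freq_ge1 i). Qed.

Lemma freq_divisor i k : freq i != freq k -> 1 <= `|freq i ^+ 2 - freq k ^+ 2|.
Proof.
move=> ik; have : freq i ^+ 2 != freq k ^+ 2.
  by rewrite eqrXn2// freq_ge0.
have [n _ ->] := freq_int i; have [m _ ->] := freq_int k.
rewrite eqr_int => nm; rewrite -rmorphB/= -intr_norm -[1]/(1%:~R) ler_int.
by rewrite -gtz0_ge1 normr_gt0 subr_eq0.
Qed.

Let freq_int1 i : d = 1%N -> exists n : int, freq i = n%:~R.
Proof.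
move=> d1; rewrite /freq; case: ifPn => i0; first by exists 1.
case: i i0 => j b /= j0; rewrite /euclid_norm; move: j j0; rewrite d1 => j j0.
by exists `|j ord0 ord0|; rewrite big_ord1 sqrtr_sqr intr_norm.
Qed.

(** The exponent is twice [m0]. *)
Definition weight i : R := freq i ^+ (if d == 1%N then 2 else 3).

Let norm_gap i k : d = 1%N -> freq i != freq k -> 1 <= `|freq i - freq k|.
Proof.
move=> d1; have [n ->] := freq_int1 i d1; have [m ->] := freq_int1 k d1.
rewrite eqr_int => nm; rewrite -rmorphB/= -intr_norm -[1]/(1%:~R) ler_int.
by rewrite -gtz0_ge1 normr_gt0 subr_eq0.
Qed.

(** In dimension one the frequencies are integers, so the divisor is at least [freq k + freq j] and
    a weight of exponent 2 is enough. Otherwise the divisor is only known to be at least 1, and the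
    exponent 3 pays for the rest. *)
Lemma admissible_freq : (1 <= d)%N -> admissible freq weight.
Proof.
move=> d1; split.
- exact: freq_ge1.
- by move=> i; rewrite /weight; case: ifP => // _; apply: ler_weXn2l => //; exact: freq_ge1.
- by move=> k j; rewrite /weight => ->.
- move=> k j kj; have D1 := freq_divisor kj; have k1 := freq_ge1 k; have j1 := freq_ge1 j.
  rewrite /weight; case: ifPn => [/eqP d1'|_]; last first.
    have : 0 <= freq k ^+ 3 by rewrite exprn_ge0// freq_ge0.
    nra.
  have := norm_gap d1' kj; rewrite subr_sqr normrM (ger0_norm (addr_ge0 (freq_ge0 k) (freq_ge0 j))).
  set g := `|_| => gap.
  rewrite exprSr -[leRHS]mulrA mulrCA ler_wpM2l ?sqr_ge0//.
  by have := ler_wpM2r (addr_ge0 (freq_ge0 k) (freq_ge0 j)) gap; lra.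
- move=> k j kj; have D1 := freq_divisor kj; have k1 := freq_ge1 k; have j1 := freq_ge1 j.
  rewrite /weight; case: ifPn => [/eqP d1'|_]; last first.
    move: D1; set D := `|_| => D1.
    have -> : 2 * freq k ^+ 3 * D = freq k ^+ 2 * (2 * (freq k * D)) by ring.
    have D0 : 0 <= 2 * (freq k * D).
      by rewrite mulr_ge0// mulr_ge0 ?freq_ge0// (le_trans ler01).
    rewrite ler_wpM2l ?sqr_ge0// -(@ler_pXn2r _ 2) ?nnegrE ?freq_ge0//.
    (* If [freq j] is much larger than [freq k], then so is the divisor: this gives
       [freq j <= 2 * freq k * D]. *)
    have jk : freq j ^+ 2 <= freq k ^+ 2 + D.
      have := ler_norm (freq j ^+ 2 - freq k ^+ 2); rewrite distrC -/D; lra.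
    have k2 : 1 <= freq k ^+ 2 by rewrite exprn_ege1.
    have D2 : D <= D ^+ 2 by rewrite expr2 ler_peMl// (le_trans ler01).
    have k4 : freq k ^+ 2 + D <= 2 * (freq k ^+ 2 * D) by nra.
    rewrite !exprMn; nra.
  have := norm_gap d1' kj; rewrite subr_sqr normrM (ger0_norm (addr_ge0 (freq_ge0 k) (freq_ge0 j))).
  set g := `|_| => gap.
  rewrite -[leRHS]mulrA mulrCA ler_wpM2l ?sqr_ge0//.
  by have := ler_wpM2r (addr_ge0 (freq_ge0 k) (freq_ge0 j)) gap; lra.
Qed.

End RealModes.

Section SobolevModes.
Variables (R : realType) (d : nat).
Notation J := 'rV[int]_d.
Notation Modes := (J * bool)%type.
Implicit Types (w : fourier R d) (i : Modes) (j : J) (s : R).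

Definition sob_term s w i : R := freq R i `^ (2 * s) * fmode w i ^+ 2.

Lemma sob_term_ge0 s w i : 0 <= sob_term s w i.
Proof. by rewrite mulr_ge0 ?powR_ge0 ?sqr_ge0. Qed.

Let sob_pair s w j := sob_term s w (j, false) + sob_term s w (j, true).

Let sob_pairE s w j : j != 0 ->
  sob_pair s w j = `|w j| ^+ 2 * euclid_norm R j `^ (2 * s).
Proof.
move=> j0; rewrite /sob_pair /sob_term /fmode /freq/= (negbTE j0).
by rewrite Rcomplex_norm_sq -mulrDr mulrC.
Qed.

Let sob_pair0 s w : w 0 = 0 -> sob_pair s w 0 = 0.
Proof.
by move=> w0; rewrite /sob_pair /sob_term /fmode /= w0 /= expr0n/= !mulr0 addr0.
Qed.

Let sobolev_sqE s w : sobolev_sq s w =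
  (\esum_(j in [set j : J | (j != 0)%R]) (sob_pair s w j)%:E)%E.
Proof. by apply: eq_esum => j /= j0; rewrite sob_pairE. Qed.

Let sobolev_norm_sq s w : sobolev_norm s w ^+ 2 = fine (sobolev_sq s w).
Proof.
rewrite sqr_sqrtr// fine_ge0// esum_ge0// => j _.
by rewrite lee_fin mulr_ge0 ?sqr_ge0 ?powR_ge0.
Qed.

Let sob_pair_ge0 s w j : 0 <= sob_pair s w j.
Proof. by rewrite addr_ge0 ?sob_term_ge0. Qed.

Lemma sobolev_is_sum s w : H0C s w -> is_sum (sob_term s w) (sobolev_norm s w ^+ 2).
Proof.
move=> [w0 fin]; apply/is_sum_pair; first exact: sob_term_ge0.
rewrite sobolev_norm_sq sobolev_sqE; apply: esum_is_sum => [j|j|].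
- exact: sob_pair_ge0.
- by move=> /negP; rewrite negbK => /eqP ->; exact: sob_pair0.
- by rewrite -sobolev_sqE.
Qed.

Lemma sobolev_bound s w K : w 0 = 0 ->
  (forall S, uniq S -> \sum_(i <- S) sob_term s w i <= K) ->
  H0C s w /\ sobolev_norm s w ^+ 2 <= K.
Proof.
move=> w0 wK; have H := @esum_le_bound R J [set j : J | j != 0] (sob_pair s w) K
  (sum_pair_le (sob_term_ge0 s w) wK).
rewrite -sobolev_sqE in H; split; first by split => //; exact: le_lt_trans H (ltry _).
rewrite sobolev_norm_sq -lee_fin fineK// ge0_fin_numE ?(le_lt_trans H (ltry _))//.
by rewrite sobolev_sqE esum_ge0// => j _; rewrite lee_fin.
Qed.

Lemma sob_sum_le s w S : H0C s w -> uniq S ->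
  \sum_(i <- S) sob_term s w i <= sobolev_norm s w ^+ 2.
Proof. by move=> /sobolev_is_sum[+ _]; apply. Qed.

Lemma sob_term_le s w i : H0C s w -> sob_term s w i <= sobolev_norm s w ^+ 2.
Proof. by move=> /sob_sum_le/(_ (isT : uniq [:: i])); rewrite big_seq1. Qed.

Lemma H0C_sub s w w' : H0C s w -> H0C s w' -> H0C s (w - w') /\
  sobolev_norm s (w - w') ^+ 2 <= 2 * sobolev_norm s w ^+ 2 + 2 * sobolev_norm s w' ^+ 2.
Proof.
move=> wH w'H; apply: sobolev_bound.
  by case: wH w'H => w0 _ [w'0 _]; rewrite /GRing.add/= /GRing.opp/= w0 w'0 subrr.
move=> S uS; have := sob_sum_le wH uS; have := sob_sum_le w'H uS.
suff H i : sob_term s (w - w') i <= 2 * sob_term s w i + 2 * sob_term s w' i.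
  have := ler_sum S (fun i (_ : true) => H i).
  by rewrite big_split/= -!mulr_sumr; lra.
rewrite /sob_term fmodeB; have := mulr_ge0 (powR_ge0 (freq R i) (2 * s)) (sqr_ge0 (fmode w i + fmode w' i)).
lra.
Qed.

Lemma H0C_scale s (c : R) w : H0C s w -> H0C s (c *: w) /\
  sobolev_norm s (c *: w) ^+ 2 <= c ^+ 2 * sobolev_norm s w ^+ 2.
Proof.
move=> wH; apply: sobolev_bound => [|S uS].
  by case: wH => w0 _; rewrite /GRing.scale/= w0 scaler0.
have := ler_wpM2l (sqr_ge0 c) (sob_sum_le wH uS); rewrite mulr_sumr.
apply: le_trans; apply: ler_sum => i _.
by rewrite /sob_term fmodeZ exprMn mulrCA.
Qed.

Lemma sobolev_dominated_cvg0 (F : set_system R) (FF : Filter F) s (w : R -> fourier R d)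
    (c : Modes -> R) (K : R) :
  (forall i, 0 <= c i) -> (forall S, uniq S -> \sum_(i <- S) c i <= K) ->
  (\forall t \near F, w t 0 = 0 /\ forall i, sob_term s (w t) i <= c i) ->
  (forall i, fmode (w t) i @[t --> F] --> (0 : R)) ->
  sobolev_norm s (w t) @[t --> F] --> (0 : R).
Proof.
move=> c0 cK dom cvg; apply/cvgrPdist_le => /= e e0.
have e2 : 0 < e ^+ 2 / 2 by rewrite divr_gt0 ?exprn_gt0.
have [S0 uS0 tailS] := is_sum_tail c0 cK e2.
have : (\sum_(i <- S0) sob_term s (w t) i) @[t --> F] --> \sum_(i <- S0) (freq R i `^ (2 * s) * (0 * 0)).
  apply: cvg_bigsum => i; apply: cvgM; first exact: cvg_cst.
  by under eq_fun do rewrite expr2; apply: cvgM; exact: cvg.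
rewrite big1 => [/cvgrPdist_le /(_ _ e2)|i _]; last by rewrite !mulr0.
move: dom; apply: filterS2 => t [wt0 wtc]; rewrite sub0r normrN => H.
rewrite sub0r normrN ger0_norm ?sqrtr_ge0//.
have [] := @sobolev_bound s (w t) (e ^+ 2) wt0.
  move=> S uS; rewrite (bigID (mem S0))/=.
  have H1 : \sum_(i <- S | i \in S0) sob_term s (w t) i <= e ^+ 2 / 2.
    apply: le_trans (le_trans (ler_norm _) H); rewrite -big_filter; apply: uniq_sum_le.
    - by rewrite filter_uniq.
    - by move=> i; rewrite mem_filter => /andP[].
    - exact: sob_term_ge0.
  have H2 : \sum_(i <- S | i \notin S0) sob_term s (w t) i <= e ^+ 2 / 2.
    by apply: le_trans (tailS S uS); apply: ler_sum => i _; exact: wtc.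
  lra.
by rewrite ler_pXn2r ?nnegrE ?sqrtr_ge0// ltW.
Qed.

(** The zero mode has frequency 1 where the gradient has factor 0; the two agree because
    [w 0 = 0]. *)
Lemma int_grad_is_sum w K : w 0 = 0 ->
  (forall S, uniq S -> \sum_(i <- S) freq R i ^+ 2 * fmode w i ^+ 2 <= K) ->
  is_sum (fun i => freq R i ^+ 2 * fmode w i ^+ 2) (int_grad_sq w).
Proof.
move=> w0 wK; have f0 i : 0 <= freq R i ^+ 2 * fmode w i ^+ 2.
  by rewrite mulr_ge0 ?sqr_ge0.
pose f j := freq R (j, false) ^+ 2 * fmode w (j, false) ^+ 2 +
            freq R (j, true) ^+ 2 * fmode w (j, true) ^+ 2.
have fE j : \sum_(k < d) `|partial k w j| ^+ 2 = f j.
  have -> : \sum_(k < d) `|partial k w j| ^+ 2 = (norm_sq j)%:~R * `|w j| ^+ 2.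
    rewrite /norm_sq rmorph_sum mulr_suml; apply: eq_bigr => k _.
    rewrite !Rcomplex_norm_sq /partial rmorphXn/=.
    by case: (w j) => a b /=; ring.
  rewrite Rcomplex_norm_sq /f /fmode/=; have [->|j0] := eqVneq j 0.
    by rewrite w0/= expr0n/= !mulr0 !addr0 mulr0.
  by rewrite /freq/= (negbTE j0) !euclid_norm_sqr mulrDr.
have -> : int_grad_sq w = fine (\esum_(j in [set: J]) (f j)%:E)%E.
  congr fine; rewrite /int_sq -esum_sum; last by move=> *; rewrite lee_fin sqr_ge0.
  by apply: eq_esum => j _; rewrite sumEFin fE.
apply/is_sum_pair => //; apply: esum_is_sum => [j|j /(_ I)//|].
  by rewrite addr_ge0.
apply: le_lt_trans (ltry K); apply: esum_le_bound.
exact: (sum_pair_le f0 wK).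
Qed.

End SobolevModes.

(** * The Kirchhoff equation *)

Section DifferenceQuotients.
Variable R : realType.
Implicit Types (f : R -> R) (s t l : R).

Lemma is_derive_quotient f t l : is_derive t (1 : R) f l <->
  (s - t)^-1 * (f s - f t) @[s --> t^'] --> l.
Proof.
split.
  move=> /is_derive1_caratheodory[g [fg cg <-]].
  have : g s @[s --> t^'] --> g t by apply: cvg_trans cg; apply: cvg_app; exact: cvg_within.
  apply: cvg_trans; apply: near_eq_cvg; near=> s.
  have st : s - t != 0 by rewrite subr_eq0; near: s; exact: nbhs_dnbhs_neq.
  by rewrite fg mulrC mulfK.
move=> H; apply/is_derive1_caratheodory.
exists (fun s => if s == t then l else (s - t)^-1 * (f s - f t)); split.
- move=> s; case: eqVneq => [->|st]; first by rewrite !subrr mulr0.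
  by rewrite mulrAC mulVf ?mul1r// subr_eq0.
- apply/cvgrPdist_le => /= e e0; rewrite eqxx.
  move/cvgrPdist_le : H => /(_ _ e0); rewrite near_withinE.
  apply: filterS => s /= H.
  by case: eqVneq => [_|]; [rewrite subrr normr0 ltW|exact: H].
- by rewrite eqxx.
Unshelve. all: by end_near. Qed.

(** Gronwall's lemma for [f ^+ 2 + g ^+ 2], with rate [1 + Q]. *)
Lemma linear_ode_zero T Q (f g q : R -> R) :
  (forall t, 0 <= t <= T -> is_derive t (1 : R) f (g t)) ->
  (forall t, 0 <= t <= T -> is_derive t (1 : R) g (- (q t * f t))) ->
  (forall t, 0 <= t <= T -> `|q t| <= Q) -> f 0 = 0 -> g 0 = 0 ->
  forall t, 0 <= t <= T -> f t = 0 /\ g t = 0.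
Proof.
move=> df dg qQ f0 g0 t tT.
have Cf : C1in T f g by apply: is_derive_C1in => s; exact: df.
have Cg : C1in T g (fun s => - (q s * f s)) by apply: is_derive_C1in => s; exact: dg.
have C := C1inD (C1inM Cf Cf) (C1inM Cg Cg).
have := gronwall (c := 1 + Q) C _ tT.
rewrite f0 g0 !mulr0 addr0 mulr0 => H.
have {H} : f t * f t + g t * g t <= 0.
  apply: H => s /andP[/ltW s0 /ltW sT].
  have := qQ s; rewrite s0 sT => /(_ isT); rewrite ler_norml => /andP[q1 q2].
  have H1 : 0 <= (Q - q s) * (f s - g s) ^+ 2 by rewrite mulr_ge0 ?sqr_ge0// subr_ge0.
  have H2 : 0 <= (Q + q s) * (f s + g s) ^+ 2 by rewrite mulr_ge0 ?sqr_ge0//; lra.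
  have := sqr_ge0 (f s - g s).
  lra.
move=> H; have z (r : R) : r ^+ 2 <= 0 -> r = 0.
  by rewrite real_exprn_even_le0 ?num_real//= => /eqP.
have := sqr_ge0 (f t); have := sqr_ge0 (g t).
by split; apply: z; rewrite !expr2 in H *; lra.
Qed.

End DifferenceQuotients.

Section SobolevScale.
Variables (R : realType) (d : nat).
Notation Modes := ('rV[int]_d * bool)%type.
Implicit Types (w : fourier R d) (i : Modes) (s : R).

Lemma freq_gt0 i : 0 < freq R i.
Proof. exact: lt_le_trans (freq_ge1 R i). Qed.

Lemma sob_term_half s w i : sob_term (s + 2^-1) w i = freq R i `^ (2 * s) * (freq R i * fmode w i ^+ 2).
Proof.
have f0 := freq_gt0 i.
rewrite /sob_term mulrDr mulfV// powRD; last by rewrite (gt_eqF f0) implybT.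
by rewrite powRr1 ?ltW// mulrA.
Qed.

Lemma sob_term_half' s w i : sob_term (s - 2^-1) w i = freq R i `^ (2 * s) * (fmode w i ^+ 2 / freq R i).
Proof.
have f0 := freq_gt0 i.
rewrite /sob_term mulrBr mulfV// powRD; last by rewrite (gt_eqF f0) implybT.
by rewrite powRN powRr1 ?ltW// mulrAC -mulrA.
Qed.

Lemma sob_term_mode_sq s w w' i : sob_term (s + 2^-1) w i + sob_term (s - 2^-1) w' i =
  freq R i `^ (2 * s) * mode_sq (@freq R d) (fmode w) (fmode w') i.
Proof. by rewrite sob_term_half sob_term_half' -mulrDr. Qed.

Lemma sob_term_mono s s' w i : s <= s' -> sob_term s w i <= sob_term s' w i.
Proof.
move=> ss'; apply: ler_wpM2r; first exact: sqr_ge0.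
by apply: ler_powR; [exact: freq_ge1|rewrite ler_pM2l].
Qed.

Lemma laplacianE w j : laplacian w j = - (norm_sq j)%:~R *: w j.
Proof.
have E k : partial k (partial k w) j = - ((j ord0 k)%:~R ^+ 2) *: w j.
  rewrite /partial; case: (w j) => p q.
  by congr Complex; rewrite /=; ring.
rewrite /laplacian (eq_bigr _ (fun k _ => E k)) -scaler_suml sumrN; congr (- _ *: _).
by rewrite /norm_sq rmorph_sum; apply: eq_bigr => k _; rewrite rmorphXn.
Qed.

End SobolevScale.

(** A common interface for bounded intervals and for zero data on the half-line. [Kd] may depend on
    the interval, since it only serves to dominate; the absolute factor 6 is the one that leads to
    the constant C of the theorem. *)
Definition mode_solution (R : realType) (d : nat) (I : set R) (alpha beta : fourier R d)
    (x y : 'rV[int]_d * bool -> R -> R) : Prop :=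
  exists (a : R -> R) (Kd : R),
  [/\ 0 <= Kd /\ (forall i, x i 0 = fmode alpha i /\ y i 0 = fmode beta i),
      (forall i t, I t -> is_derive t (1 : R) (x i) (y i t) /\
         is_derive t (1 : R) (y i) (- (freq R i ^+ 2 * a t * x i t))),
      (forall t, I t -> 1 <= a t <= 5 / 4 /\
         is_sum (fun i => freq R i ^+ 2 * x i t ^+ 2) (a t - 1)),
      (forall i t, I t -> mode_sq (@freq R d) (x ^~ t) (y ^~ t) i <=
         Kd * mode_sq (@freq R d) (fmode alpha) (fmode beta) i) &
      (forall rho K, (forall i, 0 <= rho i) ->
         (forall k j, freq R k = freq R j -> rho k = rho j) ->
         (forall S, uniq S ->
            \sum_(i <- S) rho i * mode_sq (@freq R d) (fmode alpha) (fmode beta) i <= K) ->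
         forall t S, I t -> uniq S ->
           \sum_(i <- S) rho i * mode_sq (@freq R d) (x ^~ t) (y ^~ t) i <= 6 * K)].

Definition assemble (R : realType) (d : nat) (z : 'rV[int]_d * bool -> R -> R) (t : R) :
    fourier R d :=
  fun j => Complex (z (j, false) t) (z (j, true) t).

(** * From the modes to a solution of the equation *)

Section Assemble.
Variables (R : realType) (d : nat) (L : \bar R) (alpha beta : fourier R d).
Notation J := 'rV[int]_d.
Notation Modes := (J * bool)%type.
Implicit Types (i : Modes) (s t : R).

Let I := time_interval L.

Variables (x y : Modes -> R -> R).
Hypothesis sol : mode_solution I alpha beta x y.

Let a : R -> R := sval (cid sol).
Let Kd : R := sval (cid (svalP (cid sol))).
Let solP := svalP (cid (svalP (cid sol))).

Let Kd0 : 0 <= Kd. Proof. by case: solP => -[]. Qed.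

Let init i : x i 0 = fmode alpha i /\ y i 0 = fmode beta i.
Proof. by case: solP => -[]. Qed.

Let ode i t : I t -> is_derive t (1 : R) (x i) (y i t) /\
  is_derive t (1 : R) (y i) (- (freq R i ^+ 2 * a t * x i t)).
Proof. by case: solP => _ + _ _ _; apply. Qed.

Let a_sum t : I t -> 1 <= a t <= 5 / 4 /\
  is_sum (fun i => freq R i ^+ 2 * x i t ^+ 2) (a t - 1).
Proof. by case: solP => _ _ + _ _; apply. Qed.

Let dom i t : I t ->
  mode_sq (@freq R d) (x ^~ t) (y ^~ t) i <=
  Kd * mode_sq (@freq R d) (fmode alpha) (fmode beta) i.
Proof. by case: solP => _ _ _ + _; apply. Qed.

Let growth rho K : (forall i, 0 <= rho i) ->
  (forall k j, freq R k = freq R j -> rho k = rho j) ->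
  (forall S, uniq S ->
     \sum_(i <- S) rho i * mode_sq (@freq R d) (fmode alpha) (fmode beta) i <= K) ->
  forall t S, I t -> uniq S ->
    \sum_(i <- S) rho i * mode_sq (@freq R d) (x ^~ t) (y ^~ t) i <= 6 * K.
Proof. by case: solP => _ _ _ _; apply. Qed.

Let u := assemble x.
Let v := assemble y.

Lemma fmode_assemble z t i : fmode (assemble z t) i = z i t.
Proof. by case: i => j []. Qed.

Let I_ge0 t : I t -> 0 <= t. Proof. by case. Qed.

Let I_le s t : I t -> 0 <= s <= t -> I s.
Proof.
by move=> [_ tL] /andP[s0 st]; split => //; apply: le_trans tL; rewrite lee_fin.
Qed.

Let freq_V i : 0 <= (freq R i)^-1. Proof. by rewrite invr_ge0 freq_ge0. Qed.

Let mode_sq_ge0 (X Y : Modes -> R) i : 0 <= mode_sq (@freq R d) X Y i.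
Proof. by apply: addr_ge0; rewrite mulr_ge0 ?sqr_ge0 ?freq_ge0. Qed.

Let x_sq i t : I t ->
  freq R i * x i t ^+ 2 <= Kd * mode_sq (@freq R d) (fmode alpha) (fmode beta) i.
Proof.
by move=> /(dom i); apply: le_trans; rewrite lerDl mulr_ge0 ?sqr_ge0.
Qed.

Let y_sq i t : I t ->
  y i t ^+ 2 / freq R i <= Kd * mode_sq (@freq R d) (fmode alpha) (fmode beta) i.
Proof.
by move=> /(dom i); apply: le_trans; rewrite lerDr mulr_ge0 ?sqr_ge0 ?freq_ge0.
Qed.

Let continuous_x i t : I t -> x i s @[s --> within I (nbhs t)] --> x i t.
Proof.
move=> It; have [[dx _] _] := ode i It.
have : {for t, continuous (x i)} by exact/differentiable_continuous/derivable1_diffP.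
by apply: cvg_trans; apply: cvg_app; exact: cvg_within.
Qed.

Let continuous_y i t : I t -> y i s @[s --> within I (nbhs t)] --> y i t.
Proof.
move=> It; have [_ [dy _]] := ode i It.
have : {for t, continuous (y i)} by exact/differentiable_continuous/derivable1_diffP.
by apply: cvg_trans; apply: cvg_app; exact: cvg_within.
Qed.

(** By the mean value theorem the difference quotient is a velocity at an intermediate time, so the
    majorant of the velocities dominates it uniformly in [s]. *)
Let quotient_sq i s t : I s -> I t -> s != t ->
  ((s - t)^-1 * (x i s - x i t) - y i t) ^+ 2 / freq R i <=
  4 * (Kd * mode_sq (@freq R d) (fmode alpha) (fmode beta) i).
Proof.
move=> Is It st.
suff [r Ir ->] : exists2 r, I r & (s - t)^-1 * (x i s - x i t) = y i r.
  have := y_sq i Ir; have := y_sq i It.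
  have := mulr_ge0 (freq_V i) (sqr_ge0 (y i r + y i t)).
  lra.
have mvt p q : I p -> I q -> p < q ->
    exists2 r, I r & (q - p)^-1 * (x i q - x i p) = y i r.
  move=> Ip Iq pq.
  have Cx : C1in q (x i) (y i).
    by apply: is_derive_C1in => r rq; case: (ode i (I_le Iq rq)).
  have [r /andP[pr rq] E] := C1in_MVT Cx (I_ge0 Ip) pq (lexx q).
  exists r; first by apply: (I_le Iq); rewrite (ltW rq) andbT (le_trans (I_ge0 Ip))// ltW.
  by rewrite E mulrC mulfK// subr_eq0 gt_eqF.
case: (ltgtP s t) st => // [st|ts] _; last exact: mvt.
have [r Ir E] := mvt s t Is It st; exists r => //.
by rewrite -E -(opprB t s) -(opprB (x i t)) invrN mulrNN.
Qed.

Let zero_mode t : I t -> alpha 0 = 0 -> beta 0 = 0 -> u t 0 = 0 /\ v t 0 = 0.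
Proof.
move=> It a0 b0.
have H b : x (0, b) t = 0 /\ y (0, b) t = 0.
  have z : Kd * mode_sq (@freq R d) (fmode alpha) (fmode beta) (0, b) = 0.
    rewrite /mode_sq /fmode /=; rewrite a0 b0 /=.
    by case: b; rewrite expr0n/= mulr0 mul0r addr0 mulr0.
  have := x_sq (0, b) It; have := y_sq (0, b) It.
  rewrite z /freq/= eqxx mul1r divr1 !real_exprn_even_le0 ?num_real//=.
  by move=> /eqP -> /eqP ->.
by rewrite /u /v /assemble; have [-> ->] := H false; have [-> ->] := H true.
Qed.

(** Once the coefficient [a] is fixed, the modes of [- j] and those of [j] with the sign [sg] solve
    the same linear equation with the same data, so their difference is zero. *)
Let mode_opp t j : I t -> real_valued alpha -> real_valued beta ->
  u t (- j) = conjc (u t j) /\ v t (- j) = conjc (v t j).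
Proof.
move=> It ra rb.
have fj b : freq R (- j, b) = freq R (j, b).
  rewrite /freq/= oppr_eq0; case: ifP => // _; rewrite /euclid_norm.
  by congr (Num.sqrt _); apply: eq_bigr => k _; rewrite mxE rmorphN/= sqrrN.
pose sg b : R := if b then -1 else 1.
have sgP w b : real_valued w -> fmode w (- j, b) = sg b * fmode w (j, b).
  move=> rw; rewrite /fmode/= rw /sg.
  by case: b; case: (w j) => p q /=; rewrite ?mulN1r ?mul1r.
have xyE b s : 0 <= s <= t ->
    x (- j, b) s - sg b * x (j, b) s = 0 /\ y (- j, b) s - sg b * y (j, b) s = 0.
  apply: (@linear_ode_zero R t (freq R (j, b) ^+ 2 * (5 / 4))
    (fun s => x (- j, b) s - sg b * x (j, b) s)
    (fun s => y (- j, b) s - sg b * y (j, b) s) (fun s => freq R (j, b) ^+ 2 * a s)).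
  - move=> r rt; have Ir := I_le It rt.
    have [dx _] := ode (- j, b) Ir; have [dx' _] := ode (j, b) Ir.
    by apply: is_derive_eq; rewrite /GRing.scale/=; ring.
  - move=> r rt; have Ir := I_le It rt.
    have [_ dy] := ode (- j, b) Ir; have [_ dy'] := ode (j, b) Ir.
    by apply: is_derive_eq; rewrite /GRing.scale/= fj; ring.
  - move=> r rt; have [/andP[a1 a2] _] := a_sum (I_le It rt).
    have ar : 0 <= a r by exact: le_trans a1.
    have q0 : 0 <= freq R (j, b) ^+ 2 * a r by apply: mulr_ge0 (sqr_ge0 _) ar.
    by rewrite ger0_norm//; apply: ler_wpM2l (sqr_ge0 _) _ _ a2.
  - by have [-> _] := init (- j, b); have [-> _] := init (j, b); rewrite sgP// subrr.
  - by have [_ ->] := init (- j, b); have [_ ->] := init (j, b); rewrite sgP// subrr.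
have tt : 0 <= t <= t by rewrite (I_ge0 It) lexx.
have xt b : x (- j, b) t = sg b * x (j, b) t.
  by apply/eqP; rewrite -subr_eq0; have [-> _] := xyE b t tt.
have yt b : y (- j, b) t = sg b * y (j, b) t.
  by apply/eqP; rewrite -subr_eq0; have [_ ->] := xyE b t tt.
by rewrite /u /v /assemble /= !xt !yt /sg !mul1r !mulN1r.
Qed.

Section Regularity.
Variable s : R.
Hypotheses (Ha : H0 (s + 2^-1) alpha) (Hb : H0 (s - 2^-1) beta).

Let Na := sobolev_norm (s + 2^-1) alpha.
Let Nb := sobolev_norm (s - 2^-1) beta.
Let K := Na ^+ 2 + Nb ^+ 2.
Let rho i := freq R i `^ (2 * s).
Let ms0 := mode_sq (@freq R d) (fmode alpha) (fmode beta).

Let rho_ge0 i : 0 <= rho i. Proof. exact: powR_ge0. Qed.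

Let rho_freq i k : freq R i = freq R k -> rho i = rho k.
Proof. by rewrite /rho => ->. Qed.

Let data_sum S : uniq S -> \sum_(i <- S) rho i * ms0 i <= K.
Proof.
move=> uS; case: Ha => Ha' _; case: Hb => Hb' _.
apply: le_trans (lerD (sob_sum_le Ha' uS) (sob_sum_le Hb' uS)).
by rewrite -big_split/=; apply: ler_sum => i _; rewrite sob_term_mode_sq.
Qed.

Let K_ge0 : 0 <= K. Proof. by rewrite addr_ge0 ?sqr_ge0. Qed.

Let term_sum t S : I t -> uniq S ->
  \sum_(i <- S) (sob_term (s + 2^-1) (u t) i + sob_term (s - 2^-1) (v t) i) <= 6 * K.
Proof.
move=> It uS; apply: le_trans (growth rho_ge0 rho_freq data_sum It uS).
apply: ler_sum => i _; rewrite sob_term_mode_sq /mode_sq.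
by rewrite !fmode_assemble.
Qed.

Let alpha0 : alpha 0 = 0. Proof. by case: Ha => -[]. Qed.
Let beta0 : beta 0 = 0. Proof. by case: Hb => -[]. Qed.

Let u_sum t S : I t -> uniq S -> \sum_(i <- S) sob_term (s + 2^-1) (u t) i <= 6 * K.
Proof.
move=> It uS; apply: le_trans (term_sum It uS); apply: ler_sum => i _.
by rewrite lerDl sob_term_ge0.
Qed.

Let v_sum t S : I t -> uniq S -> \sum_(i <- S) sob_term (s - 2^-1) (v t) i <= 6 * K.
Proof.
move=> It uS; apply: le_trans (term_sum It uS); apply: ler_sum => i _.
by rewrite lerDr sob_term_ge0.
Qed.

Let u_H0C t : I t -> H0C (s + 2^-1) (u t).
Proof.
move=> It; have [u0 _] := zero_mode It alpha0 beta0.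
by have [] := sobolev_bound u0 (fun S => @u_sum t S It).
Qed.

Let v_H0C t : I t -> H0C (s - 2^-1) (v t).
Proof.
move=> It; have [_ v0] := zero_mode It alpha0 beta0.
by have [] := sobolev_bound v0 (fun S => @v_sum t S It).
Qed.

(** With p and q the two norms on the left, (p + q)^2 <= 2 (p^2 + q^2) <= 12 (Na^2 + Nb^2) <= 16 (Na
    + Nb)^2, whatever [s] is. *)
Lemma assemble_bound t : I t ->
  sobolev_norm (s + 2^-1) (u t) + sobolev_norm (s - 2^-1) (v t) <= 4 * (Na + Nb).
Proof.
move=> It; have H := is_sumD_le (sob_term_ge0 _ _) (sob_term_ge0 _ _)
  (sobolev_is_sum (u_H0C It)) (sobolev_is_sum (v_H0C It)) (fun S => @term_sum t S It).
have n0 : 0 <= Na by exact: sqrtr_ge0.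
have n1 : 0 <= Nb by exact: sqrtr_ge0.
have N0 : 0 <= 4 * (Na + Nb) by rewrite mulr_ge0// addr_ge0.
move: H; set p := sobolev_norm _ _; set q := sobolev_norm _ _ => H.
rewrite leNgt; apply/negP => lt.
have := mulr_ge0 n0 n1; have := sqr_ge0 (p - q).
have : (4 * (Na + Nb)) ^+ 2 < (p + q) ^+ 2.
  by rewrite ltr_pXn2r ?nnegrE// (le_trans N0)// ltW.
by rewrite /K in H; have := sqr_ge0 Na; have := sqr_ge0 Nb; nra.
Qed.

(** One majorant for all the limits in [assemble_class]; the factor 4 comes from (p - q)^2 <= 2 p^2
    + 2 q^2 with each square bounded through [Kd]. *)
Let c i := 4 * Kd * (rho i * ms0 i).

Let c_ge0 i : 0 <= c i.
Proof. by rewrite /c; apply: mulr_ge0; [rewrite mulr_ge0|apply: mulr_ge0 (mode_sq_ge0 _ _ _)]. Qed.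

Let c_sum S : uniq S -> \sum_(i <- S) c i <= 4 * Kd * K.
Proof.
move=> uS; rewrite -mulr_sumr; apply: ler_wpM2l (data_sum uS).
by rewrite mulr_ge0.
Qed.

Let pot_sub i t t' : I t -> I t' ->
  sob_term (s + 2^-1) (u t' - u t) i <= c i.
Proof.
move=> It It'; rewrite sob_term_half fmodeB !fmode_assemble.
rewrite /c [leRHS](_ : _ = rho i * (4 * (Kd * ms0 i))); last by ring.
apply: ler_wpM2l (rho_ge0 i) _ _ _.
have := x_sq i It; have := x_sq i It'.
have := mulr_ge0 (freq_ge0 R i) (sqr_ge0 (x i t' + x i t)).
rewrite /ms0; lra.
Qed.

Let kin_sub i t t' : I t -> I t' ->
  sob_term (s - 2^-1) (v t' - v t) i <= c i.
Proof.
move=> It It'; rewrite sob_term_half' fmodeB !fmode_assemble.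
rewrite /c [leRHS](_ : _ = rho i * (4 * (Kd * ms0 i))); last by ring.
apply: ler_wpM2l (rho_ge0 i) _ _ _.
have := y_sq i It; have := y_sq i It'.
have := mulr_ge0 (freq_V i) (sqr_ge0 (y i t' + y i t)).
rewrite /ms0; lra.
Qed.

Let half_le : s - 2^-1 <= s + 2^-1.
Proof. by lra. Qed.

Let u_H0C' t : I t -> H0C (s - 2^-1) (u t).
Proof.
move=> It; have [u0 _] := zero_mode It alpha0 beta0.
have [|] := @sobolev_bound _ _ (s - 2^-1) _ (6 * K) u0 => // S uS.
by apply: le_trans (u_sum It uS); apply: ler_sum => i _; exact: sob_term_mono.
Qed.

Let u_real t : I t -> real_valued (u t).
Proof.
by move=> It j; case: Ha => _ ra; case: Hb => _ rb; case: (mode_opp j It ra rb).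
Qed.

Let v_real t : I t -> real_valued (v t).
Proof.
by move=> It j; case: Ha => _ ra; case: Hb => _ rb; case: (mode_opp j It ra rb).
Qed.

Let sub_zero (w : R -> fourier R d) t t' : w t 0 = 0 -> w t' 0 = 0 -> (w t' - w t) 0 = 0.
Proof. by move=> w0 w0'; rewrite /GRing.add/= /GRing.opp/= w0 w0' subrr. Qed.

Let cvg_sub0 (z : Modes -> R -> R) i t (F : set_system R) (FF : Filter F) :
  z i r @[r --> F] --> z i t ->
  fmode (assemble z r - assemble z t) i @[r --> F] --> (0 : R).
Proof.
move=> cz; under eq_fun do rewrite fmodeB !fmode_assemble.
by rewrite -(subrr (z i t)); apply: cvgB => //; exact: cvg_cst.
Qed.

Let near_I t : \forall t' \near within I (nbhs t), I t'.
Proof. by rewrite near_withinE; near=> r. Unshelve. all: by end_near. Qed.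

Lemma assemble_class : evolution_class I s u v.
Proof.
have z t : I t -> u t 0 = 0 /\ v t 0 = 0 by move=> It; exact: zero_mode.
split; [|split].
- split=> t It; first by split; [exact: u_H0C|exact: u_real].
  apply: (@sobolev_dominated_cvg0 R d _ _ _ (fun t' => u t' - u t) c _ c_ge0 c_sum).
    apply: filterS (near_I t) => t' It'; split; last by move=> i; exact: pot_sub.
    by apply: sub_zero; [case: (z t It)|case: (z t' It')].
  by move=> i; apply: cvg_sub0; exact: continuous_x.
- split=> t It; first by split; [exact: u_H0C'|exact: u_real].
  apply: (@sobolev_dominated_cvg0 R d _ _ _ (fun t' => u t' - u t) c _ c_ge0 c_sum).
    apply: filterS (near_I t) => t' It'; split.
      by apply: sub_zero; [case: (z t It)|case: (z t' It')].
    by move=> i; apply: le_trans (pot_sub i It It'); exact: sob_term_mono.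
  by move=> i; apply: cvg_sub0; exact: continuous_x.
- split=> t It; first by split; [exact: v_H0C|exact: v_real].
  apply: (@sobolev_dominated_cvg0 R d _ _ _ (fun t' => v t' - v t) c _ c_ge0 c_sum).
    apply: filterS (near_I t) => t' It'; split; last by move=> i; exact: kin_sub.
    by apply: sub_zero; [case: (z t It)|case: (z t' It')].
  by move=> i; apply: cvg_sub0; exact: continuous_y.
- move=> t It; rewrite /has_deriv_within.
  have E i t' : fmode ((t' - t)^-1 *: (u t' - u t) - v t) i =
      (t' - t)^-1 * (x i t' - x i t) - y i t.
    by rewrite fmodeB fmodeZ fmodeB !fmode_assemble.
  apply: (@sobolev_dominated_cvg0 R d _ _ _ (fun t' => (t' - t)^-1 *: (u t' - u t) - v t) c _ c_ge0 c_sum).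
    have nI : \forall t' \near within I (dnbhs t), I t' /\ t' != t.
      rewrite near_withinE; near=> r => Ir; split => //.
      by near: r; exact: nbhs_dnbhs_neq.
    apply: filterS nI => t' [It' tt']; split.
      have [ut vt] := z t It; have [ut' _] := z t' It'.
      change ((t' - t)^-1 *: (u t' 0 - u t 0) - v t 0 = 0).
      by rewrite ut vt ut' !subrr scaler0 subr0.
    move=> i; rewrite sob_term_half' E.
    rewrite /c [leRHS](_ : _ = rho i * (4 * (Kd * ms0 i))); last by ring.
    by apply: ler_wpM2l (rho_ge0 i) _ _ _; exact: quotient_sq.
  move=> i; under eq_fun do rewrite E.
  rewrite -(subrr (y i t)); apply: cvgB; last exact: cvg_cst.
  have [/is_derive_quotient dx _] := ode i It.
  by apply: cvg_trans dx; apply: cvg_app; exact: cvg_within.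
Unshelve. all: by end_near. Qed.

End Regularity.

Let assemble_equation j t : I t -> alpha 0 = 0 -> beta 0 = 0 ->
  exists2 utt : Rcomplex R,
    has_deriv_within (fun z : Rcomplex R => `|z|) I (fun t' => v t' j) t utt
    & utt - (1 + int_grad_sq (u t)) *: laplacian (u t) j = 0.
Proof.
move=> It a0 b0; have [u0 v0] := zero_mode It a0 b0.
have [_ asum] := a_sum It.
have aE : int_grad_sq (u t) = a t - 1.
  have H : is_sum (fun i => freq R i ^+ 2 * fmode (u t) i ^+ 2) (a t - 1).
    by under eq_fun do rewrite fmode_assemble.
  exact: is_sum_unique (int_grad_is_sum u0 H.1) H.
exists (Complex (- (freq R (j, false) ^+ 2 * a t * x (j, false) t))
                (- (freq R (j, true) ^+ 2 * a t * x (j, true) t))).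
  rewrite /has_deriv_within.
  pose q b t' := (t' - t)^-1 * (y (j, b) t' - y (j, b) t)
     - - (freq R (j, b) ^+ 2 * a t * x (j, b) t).
  have qE t' : `|(t' - t)^-1 *: (v t' j - v t j) -
      (Complex (- (freq R (j, false) ^+ 2 * a t * x (j, false) t))
                (- (freq R (j, true) ^+ 2 * a t * x (j, true) t)) : Rcomplex R)| =
      Num.sqrt (q false t' ^+ 2 + q true t' ^+ 2).
    by [].
  under eq_fun do rewrite qE.
  have cq b : q b t' @[t' --> within I t^'] --> (0 : R).
    have [_ /is_derive_quotient dy] := ode (j, b) It.
    rewrite -(subrr (- (freq R (j, b) ^+ 2 * a t * x (j, b) t))).
    apply: cvgB; last exact: cvg_cst.
    by apply: cvg_trans dy; apply: cvg_app; exact: cvg_within.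
  rewrite -sqrtr0; apply: (continuous_cvg _ (@sqrt_continuous R 0)).
  rewrite -[0]addr0 -[X in X + X](mulr0 0).
  by apply: cvgD; under eq_fun do rewrite expr2; apply: cvgM; exact: cq.
(* At [j = 0] the frequency is 1 while [norm_sq j] is 0, but the mode vanishes. *)
have fx b : freq R (j, b) ^+ 2 * x (j, b) t = (norm_sq j)%:~R * x (j, b) t.
  have [j0|j0] := eqVneq j 0; last by rewrite /freq/= (negbTE j0) euclid_norm_sqr.
  by move: u0; rewrite j0 => -[x0 x1]; case: b; rewrite ?x0 ?x1 !mulr0.
rewrite laplacianE aE addrCA subrr addr0.
apply/eqP; rewrite subr_eq0; apply/eqP.
by rewrite /u /assemble; congr Complex; rewrite mulrAC fx /=; ring.
Qed.

Lemma assemble_solution (s : R) : H0 (s + 2^-1) alpha -> H0 (s - 2^-1) beta ->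
  kirchhoff_solution I s alpha beta u v.
Proof.
move=> Ha Hb; split.
- exact: assemble_class.
- by apply: fmode_inj => i; rewrite fmode_assemble; case: (init i).
- by apply: fmode_inj => i; rewrite fmode_assemble; case: (init i).
- move=> j t It; apply: assemble_equation => //; first by case: Ha => -[].
  by case: Hb => -[].
Qed.

End Assemble.

(** * From a solution of the equation to its modes *)

Section SolutionModes.
Variables (R : realType) (d : nat).
Notation Modes := ('rV[int]_d * bool)%type.
Implicit Types (w : fourier R d) (i : Modes) (s t : R).

Lemma powR_freq_ge1 i s : 0 <= s -> 1 <= freq R i `^ (2 * s).
Proof.
move=> s0; have s2 : 0 <= 2 * s by rewrite mulr_ge0.
by have := ler_powR (freq_ge1 R i) s2; rewrite powRr0.
Qed.

Lemma fmode_le_sobolev s w i : 0 <= s -> H0C s w -> `|fmode w i| <= sobolev_norm s w.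
Proof.
move=> s0 wH; have := sob_term_le i wH.
have p1 := powR_freq_ge1 i s0.
have := ler_wpM2r (sqr_ge0 (fmode w i)) p1; rewrite mul1r => H1 H2.
have := le_trans H1 H2; rewrite -{1}[fmode w i ^+ 2]real_normK ?num_real//.
by rewrite ler_pXn2r ?nnegrE ?sqrtr_ge0.
Qed.

Lemma weightE i : weight R i = freq R i `^ (2 * m0 R d).
Proof.
rewrite /weight /m0; case: ifP => _ /=.
  by rewrite mulr1 powR_mulrn// freq_ge0.
have -> : 2 * (3 / 2) = 3%:R :> R by rewrite mulrCA divff// mulr1.
by rewrite powR_mulrn// freq_ge0.
Qed.

Lemma m0_ge1 : 1 <= m0 R d.
Proof. by rewrite /m0; case: ifP => _; lra. Qed.

Variables (I : set R) (alpha beta : fourier R d) (u v : R -> fourier R d).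
Hypothesis sol : kirchhoff_solution I (m0 R d) alpha beta u v.
Variable T : R.
Hypothesis T0 : 0 <= T.
Hypothesis TI : forall t, 0 <= t <= T -> I t.

Let m1 := m0_ge1.

Let uH t : I t -> H0C (m0 R d + 2^-1) (u t).
Proof. by move=> It; case: sol => -[[/(_ t It)[]]]. Qed.

Let uH' t : I t -> H0C (m0 R d - 2^-1) (u t).
Proof. by move=> It; case: sol => -[_ [[/(_ t It)[]]]]. Qed.

Let vH t : I t -> H0C (m0 R d - 2^-1) (v t).
Proof. by move=> It; case: sol => -[_ [_ [/(_ t It)[]]]]. Qed.

Let cu t : I t -> sobolev_norm (m0 R d + 2^-1) (u t' - u t) @[t' --> within I (nbhs t)] --> (0 : R).
Proof. by move=> It; case: sol => -[[_ /(_ t It)]]. Qed.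

Let cv t : I t -> sobolev_norm (m0 R d - 2^-1) (v t' - v t) @[t' --> within I (nbhs t)] --> (0 : R).
Proof. by move=> It; case: sol => -[_ [_ [_ /(_ t It)]]]. Qed.

Let du t : I t -> has_deriv_within (@sobolev_norm R d (m0 R d - 2^-1)) I u t (v t).
Proof. by move=> It; case: sol => -[_ [_ _ /(_ t It)]]. Qed.

Let mp : 0 <= m0 R d + 2^-1. Proof. by move: m1; lra. Qed.
Let mm : 0 <= m0 R d - 2^-1. Proof. by move: m1; lra. Qed.

Let cont_mode s (w : R -> fourier R d) i : 0 <= s ->
  (forall t, I t -> H0C s (w t)) ->
  (forall t, I t -> sobolev_norm s (w t' - w t) @[t' --> within I (nbhs t)] --> (0 : R)) ->
  {within `[0, T], continuous (fun t => fmode (w t) i)}.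
Proof.
move=> s0 wH wc; apply/subspace_continuousP => t /=; rewrite in_itv/= => tT.
have It := TI tT; apply/cvgrPdist_le => /= e e0.
move: (wc t It) => /cvgrPdist_le /(_ _ e0).
rewrite !near_withinE; apply: filterS => r H /=; rewrite in_itv/= => rT.
have Ir := TI rT; have := H Ir; rewrite sub0r normrN => H'.
rewrite distrC -fmodeB; apply: le_trans (le_trans (ler_norm _) H').
by apply: fmode_le_sobolev => //; case: (H0C_sub (wH _ Ir) (wH _ It)).
Qed.

(** At an interior time, [I] contains a neighbourhood of [t], so the derivative within [I] is a
    genuine one. *)
Let deriv_mode (N : R -> R) (f : R -> R) t l : 0 < t < T ->
  N r @[r --> within I t^'] --> (0 : R) ->
  (forall r, I r -> `|(r - t)^-1 * (f r - f t) - l| <= N r) ->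
  is_derive t (1 : R) f l.
Proof.
move=> /andP[t0 tT] N0 fN; apply/is_derive_quotient/cvgrPdist_le => /= e e0.
move: N0 => /cvgrPdist_le /(_ _ e0); rewrite near_withinE => H.
have nI : \forall r \near t^', I r.
  apply: nbhs_dnbhs; near=> r; apply: TI; apply/andP; split; apply: ltW.
    by near: r; exact: lt_nbhsr.
  by near: r; exact: lt_nbhsl.
move: nI H; apply: filterS2 => r Ir /(_ Ir); rewrite sub0r normrN => H.
by rewrite distrC; apply: le_trans (fN r Ir) (le_trans (ler_norm _) H).
Unshelve. all: by end_near. Qed.

Let a t := 1 + int_grad_sq (u t).

Let Re_le (z : Rcomplex R) : `|complex.Re z| <= `|z| /\ `|complex.Im z| <= `|z|.
Proof.
have := Rcomplex_norm_sq z => E.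
by split; rewrite -(@ler_pXn2r _ 2) ?nnegrE ?normr_ge0// real_normK ?num_real// E
  ?lerDl ?lerDr ?sqr_ge0.
Qed.

Let u0 t : I t -> u t 0 = 0. Proof. by move=> /uH[]. Qed.

Lemma solution_modes : exists M,
  [/\ (forall i, C1in T (fun t => fmode (u t) i) (fun t => fmode (v t) i)),
      (forall i, C1in T (fun t => fmode (v t) i)
         (fun t => - (freq R i ^+ 2 * a t * fmode (u t) i))),
      (forall t, 0 <= t <= T ->
         is_sum (fun i => freq R i ^+ 2 * fmode (u t) i ^+ 2) (a t - 1)) &
      (forall t S, 0 <= t <= T -> uniq S ->
         \sum_(i <- S) (freq R i ^+ 3 * fmode (u t) i ^+ 2 + fmode (v t) i ^+ 2 / freq R i) <= M) /\
      (forall i, fmode (u 0) i = fmode alpha i /\ fmode (v 0) i = fmode beta i)].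
Proof.
(* Here [1 <= m0] is used, as 2 (m0 + 1/2) >= 3: the case [n = 3] is the bound that [stability] asks
   of the other solution. *)
have pot_le n t i : (n <= 3)%N -> freq R i ^+ n * fmode (u t) i ^+ 2 <= sob_term (m0 R d + 2^-1) (u t) i.
  move=> n3; apply: ler_wpM2r; first exact: sqr_ge0.
  rewrite -powR_mulrn ?freq_ge0//; apply: ler_powR; first exact: freq_ge1.
  have : n%:R <= 3%:R :> R by rewrite ler_nat.
  by move: m1; lra.
have kin_le t i : fmode (v t) i ^+ 2 / freq R i <= sob_term (m0 R d - 2^-1) (v t) i.
  rewrite mulrC; apply: ler_wpM2r; first exact: sqr_ge0.
  apply: (@le_trans _ _ 1); first by rewrite invf_le1 ?freq_ge1 ?freq_gt0.
  exact: powR_freq_ge1.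
(* Continuity in the Sobolev norm bounds the solution near each time only; a bound on all of
   [[0, T]] follows by compactness. *)
have [M HM] : exists M, forall t, 0 <= t <= T ->
    sobolev_norm (m0 R d + 2^-1) (u t) ^+ 2 + sobolev_norm (m0 R d - 2^-1) (v t) ^+ 2 <= M.
  apply: (@locally_bounded R (fun t => sobolev_norm (m0 R d + 2^-1) (u t) ^+ 2 +
    sobolev_norm (m0 R d - 2^-1) (v t) ^+ 2)) => t tT; have It := TI tT.
  have near1 s (w : R -> fourier R d) : (forall t, I t -> H0C s (w t)) ->
      sobolev_norm s (w t' - w t) @[t' --> within I (nbhs t)] --> (0 : R) ->
      \forall r \near t, I r -> sobolev_norm s (w r) ^+ 2 <= 2 + 2 * sobolev_norm s (w t) ^+ 2.
    move=> wH /cvgrPdist_le /(_ _ ltr01); rewrite near_withinE.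
    apply: filterS => r H Ir; have := H Ir; rewrite sub0r normrN => H1.
    have [wd _] := H0C_sub (wH _ Ir) (wH _ It).
    have [wN wNle] := H0C_scale (-1) (wH _ It).
    have [_] := H0C_sub wd wN; rewrite scaleN1r opprK subrK => H2.
    rewrite scaleN1r sqrrN expr1n mul1r in wNle.
    have n0 : 0 <= sobolev_norm s (w r - w t) by exact: sqrtr_ge0.
    rewrite ger0_norm// in H1.
    apply: le_trans H2 _; nra.
  have := near1 _ u uH (cu It); have := near1 _ v vH (cv It).
  move=> /filterI /[apply] -[e /= e0 He].
  exists (2 + 2 * sobolev_norm (m0 R d + 2^-1) (u t) ^+ 2 + (2 + 2 * sobolev_norm (m0 R d - 2^-1) (v t) ^+ 2)), e.
  split => // r rT rt; have Ir := TI rT.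
  have [|h1 h2] := He r; first by rewrite /ball_/= distrC.
  by apply: lerD; [exact: h2|exact: h1].
exists M; split.
- move=> i; split; first exact: cont_mode mp uH cu.
  move=> t tT; have It : I t by apply: TI; case/andP: tT => /ltW -> /ltW.
  apply: deriv_mode tT (du It) _ => r Ir.
  rewrite -fmodeB -fmodeZ -fmodeB; apply: fmode_le_sobolev => //.
  apply: (H0C_sub _ (vH It)).1; apply: (H0C_scale _ _).1.
  exact: (H0C_sub (uH' Ir) (uH' It)).1.
- move=> i; split; first exact: cont_mode mm vH cv.
  move=> t tT; have It : I t by apply: TI; case/andP: tT => /ltW -> /ltW.
  have [_ _ _ /(_ i.1 t It)[utt dv eqn]] := sol.
  have uttE : utt = a t *: (- (norm_sq i.1)%:~R *: u t i.1).
    by apply/eqP; rewrite -subr_eq0 -eqn laplacianE.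
  apply: deriv_mode tT dv _ => r Ir.
  have -> : - (freq R i ^+ 2 * a t * fmode (u t) i) =
      if i.2 then complex.Im utt else complex.Re utt.
    have fx : freq R i ^+ 2 * fmode (u t) i = (norm_sq i.1)%:~R * fmode (u t) i.
      have [i0|i0] := eqVneq i.1 0; last by rewrite /freq (negbTE i0) euclid_norm_sqr.
      by rewrite /fmode i0 u0//=; case: i.2; rewrite !mulr0.
    rewrite mulrAC fx uttE /fmode; case: (u t i.1) => p q.
    by case: i.2 => /=; ring.
  rewrite /fmode; case: i.2.
    have := (Re_le ((r - t)^-1 *: (v r i.1 - v t i.1) - utt)).2.
    by apply: le_trans; rewrite raddfB /= linearZ /= raddfB.
  have := (Re_le ((r - t)^-1 *: (v r i.1 - v t i.1) - utt)).1.
  by apply: le_trans; rewrite raddfB /= linearZ /= raddfB.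
- move=> t tT; have It := TI tT; rewrite /a addrC addKr.
  apply: int_grad_is_sum (u0 It) _ => S uS.
  apply: le_trans (sob_sum_le (uH It) uS); apply: ler_sum => i _.
  exact: pot_le.
- split=> [t S tT uS|i]; last by case: sol => _ -> ->.
  have It := TI tT; apply: le_trans (HM t tT).
  rewrite big_split/=; apply: lerD.
    by apply: le_trans (sob_sum_le (uH It) uS); apply: ler_sum => i _; exact: pot_le.
  by apply: le_trans (sob_sum_le (vH It) uS); apply: ler_sum => i _; exact: kin_le.
Qed.

End SolutionModes.

(** * Small data and the conclusion *)

Section DataModes.
Variables (R : realType) (d : nat) (alpha beta : fourier R d).
Hypotheses (Ha : H0 (m0 R d + 2^-1) alpha) (Hb : H0 (m0 R d - 2^-1) beta).

Let eps := sobolev_norm (m0 R d + 2^-1) alpha + sobolev_norm (m0 R d - 2^-1) beta.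

Lemma data_modes_le S : uniq S ->
  \sum_(i <- S) weight R i * mode_sq (@freq R d) (fmode alpha) (fmode beta) i <= eps ^+ 2.
Proof.
move=> uS; case: Ha => Ha' _; case: Hb => Hb' _.
apply: (@le_trans _ _ (sobolev_norm (m0 R d + 2^-1) alpha ^+ 2 + sobolev_norm (m0 R d - 2^-1) beta ^+ 2)).
  apply: le_trans (lerD (sob_sum_le Ha' uS) (sob_sum_le Hb' uS)).
  by rewrite -big_split/=; apply: ler_sum => i _; rewrite sob_term_mode_sq weightE.
rewrite /eps; have := mulr_ge0 (sqrtr_ge0 _ : 0 <= sobolev_norm (m0 R d + 2^-1) alpha)
  (sqrtr_ge0 _ : 0 <= sobolev_norm (m0 R d - 2^-1) beta).
lra.
Qed.

Lemma data_modes_eq0 i : eps = 0 -> fmode alpha i = 0 /\ fmode beta i = 0.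
Proof.
move=> eps0; case: Ha => Ha' _; case: Hb => Hb' _; have := m0_ge1 R d => m1.
have a0 : 0 <= m0 R d + 2^-1 by lra.
have b0 : 0 <= m0 R d - 2^-1 by lra.
have := fmode_le_sobolev i a0 Ha'; have := fmode_le_sobolev i b0 Hb'.
move: eps0; rewrite /eps.
have := normr_ge0 (fmode alpha i); have := normr_ge0 (fmode beta i) => n1 n2 e h1 h2.
by split; apply/eqP; rewrite -normr_le0; lra.
Qed.

End DataModes.

(** Uniqueness is stated for solutions on any [I] that contains [[0, T]], so that solutions on an
    unbounded interval can be compared on each bounded piece. *)
Lemma kirchhoff_modes (R : realType) (d : nat) (alpha beta : fourier R d) (T eta : R) :
  (1 <= d)%N -> 0 <= T -> 0 < eta -> 8 * eta <= 4^-1 -> 172 * eta ^+ 2 * T <= 2^-1 ->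
  (forall S, uniq S ->
    \sum_(i <- S) weight R i * mode_sq (@freq R d) (fmode alpha) (fmode beta) i <= eta) ->
  exists x y, mode_solution [set t | 0 <= t <= T] alpha beta x y /\
    forall (I : set R) (u v : R -> fourier R d), (forall t, 0 <= t <= T -> I t) ->
      kirchhoff_solution I (m0 R d) alpha beta u v ->
      forall t, 0 <= t <= T -> u t = assemble x t.
Proof.
move=> d1 T0 eta0 eta_small etaT data_le.
have [x [y [a [init ode a_sum [dom growth] unique]]]] :=
  modes_solution (admissible_freq R d1) T0 eta0 eta_small etaT data_le.
exists x, y; split.
  by exists a, (2 * expR T); split => //.
move=> I u v TI sol t tT.
have [M [dX dY sa [bnd ini]]] := solution_modes sol TI.
apply: fmode_inj => i; rewrite fmode_assemble.
exact: (unique _ _ _ M dX dY sa bnd ini).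
Qed.

Lemma zero_mode_solution (R : realType) (d : nat) (I : set R) (alpha beta : fourier R d) :
  (forall i, fmode alpha i = 0 /\ fmode beta i = 0) ->
  mode_solution I alpha beta (fun _ _ => 0) (fun _ _ => 0).
Proof.
move=> z; exists (fun=> 1), 1.
have ms0 i : mode_sq (@freq R d) (fmode alpha) (fmode beta) i = 0.
  by rewrite /mode_sq; have [-> ->] := z i; rewrite expr0n/= mulr0 mul0r addr0.
have ms0' i : mode_sq (@freq R d) (fun=> 0) (fun=> 0) i = 0.
  by rewrite /mode_sq expr0n/= mulr0 mul0r addr0.
split.
- by split=> // i; have [-> ->] := z i.
- by move=> i t _; rewrite mulr0 oppr0; split; exact: is_derive_cst.
- move=> t _; split; first by rewrite lexx/=; lra.
  rewrite subrr; split => [S _|e e0].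
    by rewrite big1// => i _; rewrite expr0n mulr0.
  by exists [::] => //; rewrite big_nil sub0r oppr_le0 ltW.
- by move=> i t _; rewrite ms0' ms0 mulr0.
- move=> rho K _ _ HK t S _ _; rewrite big1 => [|i _]; last by rewrite ms0' mulr0.
  by rewrite mulr_ge0//; have := HK [::] isT; rewrite big_nil.
Qed.

Theorem theorem1p1 (R : realType) :
  exists eps0 C C1 : R,
    [/\ 0 < eps0, 0 < C, 0 < C1 &
      forall (d : nat) (alpha beta : fourier R d),
        (1 <= d)%N ->
        H0 (m0 R d + 2^-1) alpha ->
        H0 (m0 R d - 2^-1) beta ->
        let eps := sobolev_norm (m0 R d + 2^-1) alpha
                   + sobolev_norm (m0 R d - 2^-1) beta in
        let I := time_interval (lifespan C1 eps) in
        eps <= eps0 ->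
        exists u v : R -> fourier R d,
          [/\ kirchhoff_solution I (m0 R d) alpha beta u v,
              (forall u' v' : R -> fourier R d,
                kirchhoff_solution I (m0 R d) alpha beta u' v' ->
                forall t, I t -> u' t = u t),
              (forall t, I t ->
                sobolev_norm (m0 R d + 2^-1) (u t)
                + sobolev_norm (m0 R d - 2^-1) (v t) <= C * eps) &
              (forall s : R, m0 R d <= s ->
                H0 (s + 2^-1) alpha ->
                H0 (s - 2^-1) beta ->
                evolution_class I s u v /\
                (forall t, I t ->
                  sobolev_norm (s + 2^-1) (u t) + sobolev_norm (s - 2^-1) (v t)
                  <= C * (sobolev_norm (s + 2^-1) alpha
                          + sobolev_norm (s - 2^-1) beta)))]].
Proof.
have c0 : 0 < 400^-1 :> R by rewrite invr_gt0 ltr0n.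
(* With [eta := eps ^+ 2], [eps <= 8^-1] gives 8 eta <= 1/8, within the required 1/4, and T = eps^-4
   / 400 gives 172 eta^2 T = 172/400 <= 1/2; the factor 4 is that of [assemble_bound]. *)
exists 8^-1, 4, 400^-1; split; [by rewrite invr_gt0|by []|exact: c0|].
move=> d alpha beta d1 Ha Hb eps I epsle.
have eps_ge0 : 0 <= eps by rewrite addr_ge0 ?sqrtr_ge0.
have data := data_modes_le Ha Hb.
suff [x [y [sol unique]]] : exists x y, mode_solution I alpha beta x y /\
    forall u' v', kirchhoff_solution I (m0 R d) alpha beta u' v' ->
    forall t, I t -> u' t = assemble x t.
  exists (assemble x), (assemble y); split => //.
  - exact: assemble_solution sol (m0 R d) Ha Hb.
  - by move=> t It; exact: assemble_bound sol (m0 R d) Ha Hb t It.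
  - move=> s _ sa sb; split; first exact: assemble_class sol s sa sb.
    by move=> t It; exact: assemble_bound sol s sa sb t It.
have [eps0|epsN0] := eqVneq eps 0.
  have IE t : I t <-> 0 <= t.
    by rewrite /I /lifespan eps0 eqxx /time_interval/= leey; split=> [[]|].
  have zsol := @zero_mode_solution R d I alpha beta (fun i => data_modes_eq0 Ha Hb i eps0).
  exists (fun _ _ => 0), (fun _ _ => 0); split => // u' v' sol' t It.
  have t0 : 0 <= t by apply/IE.
  have t1 : 0 < 1 + t by rewrite ltr_pwDl.
  (* With zero data [eta] may be as small as [[0, t]] demands; both [u'] and the zero solution then
     equal the same assembled solution at time [t]. *)
  pose eta := (32 * (1 + t))^-1.
  have eta0 : 0 < eta by rewrite invr_gt0 mulr_gt0.
  have etaE : eta * (32 * (1 + t)) = 1 by rewrite mulVf// lt0r_neq0// mulr_gt0.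
  have [||S uS|x [y [_ unique]]] := kirchhoff_modes (alpha := alpha) (beta := beta) d1 t0 eta0.
  - by have := mulr_ge0 (ltW eta0) t0; lra.
  - by have := mulr_ge0 (ltW eta0) t0; nra.
  - by apply: le_trans (data S uS) _; rewrite -/eps eps0 expr0n/= ltW.
  have TI s : 0 <= s <= t -> I s by move=> /andP[s0 _]; apply/IE.
  have tt : 0 <= t <= t by rewrite t0 lexx.
  rewrite (unique I u' v' TI sol' t tt).
  by rewrite (unique I _ _ TI (assemble_solution zsol Ha Hb) t tt).
have eps_gt0 : 0 < eps by rewrite lt0r epsN0.
pose T := 400^-1 * eps ^- 4.
have IE t : I t <-> 0 <= t <= T.
  rewrite /I /lifespan (negbTE epsN0) /time_interval/= lee_fin -/T.
  by split=> [[-> ->]|/andP[]].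
have T0 : 0 <= T by apply: mulr_ge0 (ltW c0) _; rewrite invr_ge0 exprn_ge0.
have e2 : 8 * eps ^+ 2 <= 4^-1 by nra.
have e20 : 0 < eps ^+ 2 by rewrite exprn_gt0.
have [|x [y [sol unique]]] := kirchhoff_modes d1 T0 e20 e2 _ data.
  have -> : 172 * (eps ^+ 2) ^+ 2 * T = 172 / 400 by rewrite /T; field.
  by lra.
have IS : I = [set t | 0 <= t <= T] by apply/seteqP; split => t /IE.
exists x, y; rewrite IS; split => // u' v' sol' t tT.
exact: (unique _ _ _ _ sol').
Qed.
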